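(* Let $n\ge2$ and $Q=n+2$ with $Q\geq 5$. For all $u\in C_c^\infty(\mathbb{R}^{n+1} \setminus \{o\})$: (a) $$\int_{\mathbb{R}^{n+1}}\frac{|\mathcal{L}_{G} u|^2}{|\nabla_G \varrho|^2}\,dx\,dt\geq \int_{\mathbb{R}^{n+1}} (Q+2-\varrho^2)|\nabla_G u|^2\,dx\,dt.$$ (b) $$\int_{\mathbb{R}^{n+1}}\frac{|\mathcal{L}_{G} u|^2}{|\nabla_G \varrho|^2}\,dx\,dt\geq \int_{\mathbb{R}^{n+1}}\left(\frac{Q+1}{\varrho}-1\right)|\nabla_G u|^2\,dx\,dt.$$ (c) For every real $b<1$: $$\int_{\mathbb{R}^{n+1}}\frac{|\mathcal{L}_{G} u|^2}{|\nabla_G \varrho|^2}\,dx\,dt\geq\int_{\mathbb{R}^{n+1}}\left(\frac{Q+1-b}{\varrho^{b+1}}-\frac{1}{\varrho^{2b}}\right)|\nabla_G u|^2\,dx\,dt.$$ (d) For every real $b>1$: $$\int_{\mathbb{R}^{n+1}}\frac{|\mathcal{L}_{G} u|^2}{|\nabla_G \varrho|^2}\,dx\,dt\geq\int_{\mathbb{R}^{n+1}}\left(\frac{Q+b-1}{\varrho^{b+1}}-\frac{1}{\varrho^{2b}}\right)|\nabla_G u|^2\,dx\,dt.$$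
   Context: Grushin space: $n\ge 2$ is an integer and $Q=n+2$ (homogeneous dimension). Points of $\mathbb{R}^{n+1}$ are written $(x,t)$ with $x\in\mathbb{R}^n$, $t\in\mathbb{R}$; $o$ is the origin; all functions are real-valued. The Grushin gradient is $\nabla_G u=(\nabla_x u,\ |x|\partial_t u)$, so $|\nabla_G u|^2=|\nabla_x u|^2+|x|^2(\partial_t u)^2$. The Grushin operator is $\mathcal{L}_G=\Delta_x+|x|^2\partial_t^2$. The homogeneous norm is $\varrho(x,t)=(|x|^4+4t^2)^{1/4}$; it satisfies $|\nabla_G\varrho|^2=|x|^2/\varrho^2$ away from $o$. *)

(* Defs.v *)
From HB Require Import structures.
From mathcomp Require Import all_boot all_order all_algebra.
From mathcomp Require Import all_classical all_reals all_analysis.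

Set Implicit Arguments.
Unset Strict Implicit.
Unset Printing Implicit Defensive.

Import Order.TTheory GRing.Theory Num.Theory.
Import numFieldNormedType.Exports.

Local Open Scope classical_set_scope.
Local Open Scope ring_scope.

(* The library has no n-dimensional Lebesgue measure: it is built here on
   n-tuples, as the iterated product of the one-dimensional one. *)
Section lebesgue_tuple.
Context {R : realType}.
Local Notation T n := (n.-tuple (measurableTypeR R)).

Definition tcons n (p : measurableTypeR R * T n) : T n.+1 :=
  [the n.+1.-tuple (measurableTypeR R) of p.1 :: p.2].

Lemma measurable_tcons n : measurable_fun setT (@tcons n).
Proof. exact: measurable_cons. Qed.

Section step.
Variables (n : nat) (mu : {sigma_finite_measure set T n -> \bar R}).

Definition lebesgue_step : set (T n.+1) -> \bar R :=
  pushforward (lebesgue_measure \x mu)%E (@tcons n).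

Let step0 : lebesgue_step set0 = 0%E.
Proof. by rewrite /lebesgue_step /pushforward preimage_set0 measure0. Qed.

Let step_ge0 A : (0 <= lebesgue_step A)%E.
Proof. exact: (measure_ge0 (lebesgue_measure \x mu)%E). Qed.

Let step_sigma_additive : semi_sigma_additive lebesgue_step.
Proof.
move=> F mF tF mUF; rewrite /lebesgue_step /pushforward preimage_bigcup.
apply: measure_semi_sigma_additive.
- by move=> i; rewrite -[X in measurable X]setTI; exact: measurable_tcons.
- apply/trivIsetP => /= i j _ _ ij; rewrite -preimage_setI.
  by move/trivIsetP : tF => /(_ _ _ _ _ ij) ->//; rewrite preimage_set0.
- by rewrite -preimage_bigcup -[X in measurable X]setTI; exact: measurable_tcons.
Qed.

HB.instance Definition _ := isMeasure.Build _ _ _ lebesgue_step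
  step0 step_ge0 step_sigma_additive.

Let step_sigma_finite : sigma_finite setT lebesgue_step.
Proof.
have /sigma_finiteP[F [TF ndF Foo]] := sigma_finiteT (@lebesgue_measure R).
have /sigma_finiteP[G [TG ndG Goo]] := sigma_finiteT mu.
pose h (t : T n.+1) : measurableTypeR R * T n :=
  (tnth t ord0, [tuple of behead t]).
have mh : measurable_fun setT h.
  apply/measurable_fun_pairP; split.
    exact: (measurable_tnth (ord0 : 'I_n.+1)).
  exact: measurable_behead.
have hK : h \o @tcons n = id.
  by apply/funext => -[x t]; congr pair; exact: val_inj.
exists (fun i => h @^-1` (F i `*` G i)).
  rewrite -preimage_bigcup (_ : \bigcup_i _ = setT) ?preimage_setT//.
  apply/seteqP; split => // -[x y] _.
  have [i _ Fx] : (\bigcup_i F i) x by rewrite -TF.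
  have [j _ Gy] : (\bigcup_j G j) y by rewrite -TG.
  exists (maxn i j) => //; split => /=.
    by move: x Fx; exact/subsetPset/ndF/leq_maxl.
  by move: y Gy; exact/subsetPset/ndG/leq_maxr.
move=> i; have [mF Fi] := Foo i; have [mG Gi] := Goo i; split.
  rewrite -[X in measurable X]setTI; apply: mh => //.
  exact: measurableX.
rewrite /lebesgue_step /pushforward -comp_preimage hK preimage_id.
by rewrite product_measure1E// lte_mul_pinfty// ge0_fin_numE.
Qed.

HB.instance Definition _ := Measure_isSigmaFinite.Build _ _ _ lebesgue_step
  step_sigma_finite.

End step.

Fixpoint lebesgue_tuple n : {sigma_finite_measure set T n -> \bar R} :=
  match n with
  | 0 => \d_[tuple]
  | m.+1 => lebesgue_step (lebesgue_tuple m)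
  end.

End lebesgue_tuple.

Section grushin.
Context {R : realType} {n : nat}.

(* Points (x, t) of R^n x R.  This type carries the library's sup norm, which
   is used only for its topology; `enorm` is the Euclidean norm of R^n. *)
Local Notation V := ('rV[R]_n * R)%type.

Definition enorm (x : 'rV[R]_n) : R := Num.sqrt (\sum_i x 0 i ^+ 2).

Definition dx (i : 'I_n) (f : V -> R) : V -> R := 'D_(delta_mx 0 i, 0) f.
Definition dt (f : V -> R) : V -> R := 'D_(0, 1) f.

Definition grad_G (u : V -> R) (p : V) : V :=
  (\row_i dx i u p, enorm p.1 * dt u p).

(* |v|^2 for the Euclidean norm of R^(n+1) *)
Definition sqnorm (v : V) : R := enorm v.1 ^+ 2 + v.2 ^+ 2.

Definition L_G (u : V -> R) (p : V) : R :=
  \sum_i dx i (dx i u) p + enorm p.1 ^+ 2 * dt (dt u) p.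

Definition varrho (p : V) : R := (enorm p.1 ^+ 4 + 4 * p.2 ^+ 2) `^ 4^-1.

Fixpoint Ck (k : nat) (f : V -> R) : Prop :=
  match k with
  | 0 => continuous f
  | j.+1 => (forall p, differentiable f p) /\ forall v, Ck j ('D_v f)
  end.

(* C_c^infty(R^(n+1) \ {o}); an element is identified with its extension by 0
   at o. *)
Definition test_function (u : V -> R) : Prop :=
  [/\ forall k, Ck k u,
      compact (closure [set p | u p != 0]) &
      ~ closure [set p | u p != 0] 0].

Definition integral_G (f : V -> R) : \bar R :=
  (\int[lebesgue_tuple n \x lebesgue_measure]_p
     (f (\row_i tnth p.1 i, p.2))%:E)%E.

End grushin.

(* Main.v *)
(* Write X = |x|^2, r = varrho^-2, psi = |grad_G varrho|^2, Z = x.grad_x + 2t d_t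
   for the generator of the dilations, and split
   varrho^2 |grad_G u|^2 = psi (Zu)^2 + D(u, u), where D is the part tangent to
   the level sets of varrho.  For every P one has
   |L_G u|^2 / psi >= 2 P L_G u - psi P^2 off the axis x = 0.  Take P = r (R - F)
   with R = Z^2 u + n Zu: after integration by parts the right-hand side is the
   integral of r^2 (psi R^2 - 2 D(u, R) + 2 D(u, F) - psi F^2).  If F satisfies
   the gap inequality
     int r^2 (2 D(u, F) - psi F^2) >= 4 int r^2 D(u, u),
   then completing the squares psi (Zv + g v)^2 and D(v + g u, v + g u), with
   v = Zu and g a function of varrho, bounds it below by the integral of
   w |grad_G u|^2 for w = r (2n - g^2 + (n-2) g + Zg).  The choice
   g = varrho^(1-b) - 2 gives (a), (b), (c) and g = n - varrho^(1-b) gives (d).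

   To produce F, split u into its even and odd parts in each coordinate.  For u
   odd in x_i, F = 4 u works because the ground state x_i gives
   int r^2 D(u, u) >= (n+1) int r^2 psi u^2 and n+1 >= 4.  For u even in every
   x_i, take F = eta Yu + (3/2) Bu, with Y the remaining tangential vector
   field, B the sum of squares of the rotation fields x_k d_l - x_l d_k (up to
   the factor -1/2) and eta a function of psi and t: each rotation derivative of
   u is odd in x_k and in x_l, so the ground state x_k x_l bounds its angular
   energy below by 2n, and the gap inequality becomes pointwise, namely two
   polynomial inequalities in psi on [0, 1]. *)

Require Import Defs.
From HB Require Import structures.
From mathcomp Require Import all_boot all_order all_algebra.
From mathcomp Require Import all_classical all_reals all_analysis.
From mathcomp Require Import measurable_realfun ring lra.

Set Implicit Arguments.
Unset Strict Implicit.
Unset Printing Implicit Defensive.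

Import Order.TTheory GRing.Theory Num.Theory.
Import numFieldNormedType.Exports.

Local Open Scope classical_set_scope.
Local Open Scope ring_scope.

(** * Smooth functions away from the origin *)

(** Let A be the tangential part of L_G, defined by int r^2 (Au) h = - int r^2 D(u, h), so that L_G
    u = r (psi R + Au). The best P is (L_G u) / psi, which means F = - (Au) / psi; but psi vanishes
    on the axis and this F is not smooth there. Leaving F free among smooth functions avoids the
    quotient. For the ideal F the gap inequality reads int r^2 (Au)^2 / psi >= 4 int r^2 D(u, u):
    the nonzero eigenvalues of - A relative to the weight psi are at least 4. A solution of L_G h =
    0 homogeneous of degree d has eigenvalue d (d + n); x_i gives n + 1, and n + 1 >= 4 is the
    hypothesis Q >= 5. No spectral decomposition is used, since F is explicit on each parity class.
    The number 4 is 2n - 2 (n - 2): with it psi (Zu)^2 and D(u, u) receive the same weight and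
    recombine into |grad_G u|^2. The values -2 and n in the two choices of g are the roots of 2n +
    (n - 2) g - g^2, so that no constant survives in w / r. *)

Section smooth.
Context {R : realType} {n : nat}.
Local Notation V := ('rV[R]_n * R)%type.
Implicit Types (f g : V -> R) (p q v w : V).

(** Continuity and directional derivatives replace Frechet differentiability: the sum, product and
    power rules are then elementary. Continuity is a separate clause because directional derivatives
    do not imply it. The origin is excluded since varrho is not smooth there. *)
Fixpoint smk (k : nat) (f : V -> R) : Prop :=
  match k with
  | 0 => forall p, p != 0 -> {for p, continuous f}
  | j.+1 => (forall p, p != 0 ->
              {for p, continuous f} /\ forall v, derivable f p v)
            /\ forall v, smk j ('D_v f)
  end.

Definition sm f := forall k, smk k f.

Lemma near_neq0 p : p != 0 -> \forall q \near p, q != 0.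
Proof.
move=> p0; have : open [set q : V | q != 0].
  have -> : [set q : V | q != 0] = ~` [set 0].
    by apply/seteqP; split => q /= /eqP.
  exact/closed_openC/accessible_closed_set1/hausdorff_accessible/norm_hausdorff.
by move=> oA; apply: open_nbhs_nbhs; split.
Qed.

Lemma smk_eq k f g : (forall p, p != 0 -> f p = g p) -> smk k f -> smk k g.
Proof.
elim: k f g => [|k IH] f g fg /=.
  move=> cf p p0; rewrite /prop_for /continuous_at -(fg p p0).
  apply: cvg_trans (cf p p0); apply: near_eq_cvg.
  by near=> q; apply: fg; near: q; exact: near_neq0.
have nfg p : p != 0 -> \forall q \near p, f q = g q.
  by move=> p0; near=> q; apply: fg; near: q; exact: near_neq0.
move=> [H1 H2]; split.
  move=> p p0; have [cf df] := H1 p p0; split.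
    rewrite /prop_for /continuous_at -(fg p p0).
    by apply: cvg_trans cf; apply: near_eq_cvg; exact: nfg.
  by move=> v; apply: near_eq_derivable (df v); exact: nfg.
move=> v; apply: IH (H2 v) => p p0; apply: near_eq_derive; exact: nfg.
Unshelve. all: by end_near. Qed.

Lemma sm_eq f g : (forall p, p != 0 -> f p = g p) -> sm f -> sm g.
Proof. by move=> fg sf k; apply: smk_eq (sf k). Qed.

Lemma smkS k f : smk k.+1 f -> smk k f.
Proof.
elim: k f => [|k IH] f; first by move=> [H _] p p0; exact: (H p p0).1.
by move=> [H1 H2]; split=> // v; exact: IH.
Qed.

Lemma sm_cont f p : sm f -> p != 0 -> {for p, continuous f}.
Proof. by move=> sf; exact: (sf 0). Qed.

Lemma sm_derivable f p v : sm f -> p != 0 -> derivable f p v.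
Proof. by move=> sf p0; have [H _] := sf 1; exact: (H p p0).2. Qed.

Lemma smD v f : sm f -> sm ('D_v f).
Proof. by move=> sf k; have [_] := sf k.+1; apply. Qed.

Lemma sm_cst (c : R) : sm (fun=> c).
Proof.
suff H : forall k c, smk k (fun=> c) by move=> k; exact: H.
elim=> [|k IH] {}c /=.
  by move=> p _; exact: cst_continuous.
split.
  by move=> p _; split; [exact: cst_continuous|move=> v; exact: derivable_cst].
move=> v; apply: smk_eq (IH 0) => p _.
by rewrite (@derive_cst _ V R^o c).
Qed.

Lemma smk_add k f g : smk k f -> smk k g -> smk k (fun p => f p + g p).
Proof.
elim: k f g => [|k IH] f g /=.
  by move=> cf cg p p0; apply: (@continuousD _ R^o V); [exact: cf|exact: cg].
move=> [f1 f2] [g1 g2]; split.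
  move=> p p0; have [cf df] := f1 p p0; have [cg dg] := g1 p p0; split.
    exact: (@continuousD _ R^o V).
  by move=> v; exact: (@derivableD _ V R^o).
move=> v; apply: smk_eq (IH _ _ (f2 v) (g2 v)) => p p0; apply/esym.
by apply: (@deriveD _ V R^o); [exact: (f1 p p0).2|exact: (g1 p p0).2].
Qed.

Lemma sm_add f g : sm f -> sm g -> sm (fun p => f p + g p).
Proof. by move=> sf sg k; exact: smk_add. Qed.

Lemma derive_mulf v f g p : derivable f p v -> derivable g p v ->
  'D_v (fun q => f q * g q) p = 'D_v f p * g p + f p * 'D_v g p.
Proof.
move=> df dg; rewrite (@deriveM _ V f g p v df dg) /GRing.scale/=; ring.
Qed.

Lemma derivable_sub v f g p : derivable f p v -> derivable g p v ->
  derivable (fun q => f q - g q) p v.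
Proof. exact: (@derivableB _ V R^o). Qed.

Lemma derive_subf v f g p : derivable f p v -> derivable g p v ->
  'D_v (fun q => f q - g q) p = 'D_v f p - 'D_v g p.
Proof. exact: (@deriveB _ V R^o). Qed.

Lemma smk_mul k f g : smk k f -> smk k g -> smk k (fun p => f p * g p).
Proof.
elim: k f g => [|k IH] f g.
  by move=> cf cg p p0; apply: (@continuousM _ V); [exact: cf|exact: cg].
move=> sf sg; have [f1 f2] := sf; have [g1 g2] := sg; split.
  move=> p p0; have [cf df] := f1 p p0; have [cg dg] := g1 p p0; split.
    exact: (@continuousM _ V).
  by move=> v; exact: (@derivableM _ V).
move=> v; have H1 := IH _ _ (f2 v) (smkS sg).
have H2 := IH _ _ (smkS sf) (g2 v).
apply: smk_eq (smk_add H1 H2) => p p0; apply/esym.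
by apply: derive_mulf; [exact: (f1 p p0).2|exact: (g1 p p0).2].
Qed.

Lemma sm_mul f g : sm f -> sm g -> sm (fun p => f p * g p).
Proof. by move=> sf sg k; exact: smk_mul. Qed.

Lemma sm_opp f : sm f -> sm (fun p => - f p).
Proof.
move=> sf; have := sm_mul (sm_cst (-1)) sf.
by apply: sm_eq => p _; rewrite mulN1r.
Qed.

Lemma sm_sub f g : sm f -> sm g -> sm (fun p => f p - g p).
Proof. by move=> sf sg; apply: sm_add => //; exact: sm_opp. Qed.

Lemma sm_exp f k : sm f -> sm (fun p => f p ^+ k).
Proof.
move=> sf; elim: k => [|k IH]; first exact: sm_cst.
have := sm_mul sf IH; apply: sm_eq => p _; by rewrite exprS.
Qed.

Lemma sm_sum (I : Type) (s : seq I) (F : I -> V -> R) :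
  (forall i, sm (F i)) -> sm (fun p => \sum_(i <- s) F i p).
Proof.
move=> sF; elim: s => [|i s IH].
  by apply: sm_eq (sm_cst 0) => p _; rewrite big_nil.
by apply: sm_eq (sm_add (sF i) IH) => p _; rewrite big_cons.
Qed.

Lemma is_derive_line f p v (s : R) : derivable f (s *: v + p) v ->
  is_derive s 1 (fun h : R => f (h *: v + p) : R^o) ('D_v f (s *: v + p)).
Proof.
have e : (fun h : R => h^-1 *: ((f (h *: v + (s *: v + p)) : R^o) - f (s *: v + p)))
  = (fun h : R => h^-1 *: ((f ((h *: (1:R) + s) *: v + p) : R^o) - f (s *: v + p))).
  by apply/funext => h /=; rewrite [_%:A]mulr1 scalerDl addrA.
move=> df; apply: DeriveDef; first by move: df; rewrite /derivable e.
by rewrite /derive e.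
Qed.

Lemma is_derive_line0 f p v : derivable f p v ->
  is_derive (0 : R) 1 (fun h : R => f (h *: v + p) : R^o) ('D_v f p).
Proof.
have E : (0 : R) *: v + p = p by rewrite scale0r add0r.
by move=> df; have := @is_derive_line f p v 0; rewrite E => /(_ df).
Qed.

Lemma deriv_powR (a : R) f p v : 0 < f p -> derivable f p v ->
  derivable (fun q => f q `^ a) p v /\
  'D_v (fun q => f q `^ a) p = a * f p `^ (a - 1) * 'D_v f p.
Proof.
move=> f0 df; have d1 := is_derive_line0 df.
have d2 : is_derive ((fun h : R => f (h *: v + p)) 0) 1 (fun x : R => x `^ a : R^o)
    (a * f p `^ (a - 1)).
  by rewrite /= scale0r add0r; exact: (@is_derive1_powR R a (f p) f0).
have d3 : is_derive (0:R) 1 ((fun x : R => x `^ a) \o (fun h : R => f (h *: v + p)))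
   ((a * f p `^ (a - 1)) * 'D_v f p).
  have := @is_derive1_comp R (fun x : R => x `^ a) (fun h : R => f (h *: v + p)) 0 _ _ d2 d1.
  by [].
have dd : derivable (fun q => f q `^ a) p v.
  by apply/derivable1P; exact: (@ex_derive _ _ _ _ _ _ _ d3).
split => //.
have [_ <-] := is_derive_line0 dd; have [_ <-] := d3; by [].
Qed.

Lemma cont_powR (a : R) f p : 0 < f p -> {for p, continuous f} ->
  {for p, continuous (fun q => f q `^ a)}.
Proof.
move=> f0 cf; apply: (@continuous_comp _ _ _ f (fun x : R => x `^ a)) => //.
have [d _] := @is_derive1_powR R a (f p) f0.
by move/derivable1_diffP: d; exact: differentiable_continuous.
Qed.

Lemma sm_powR (a : R) f : (forall p, p != 0 -> 0 < f p) -> sm f ->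
  sm (fun q => f q `^ a).
Proof.
(* Differentiation lowers the exponent, so the induction runs over all exponents at once. *)
move=> f0 sf k; elim: k a => [|k IH] a.
  by move=> p p0; apply: cont_powR; [exact: f0|exact: sm_cont].
split.
  move=> p p0; split; first by apply: cont_powR; [exact: f0|exact: sm_cont].
  by move=> v; apply: (deriv_powR a (f0 _ p0) _).1; exact: sm_derivable.
move=> v.
have H := smk_mul (smk_mul (sm_cst a k) (IH (a - 1))) (smD v sf k).
apply: smk_eq H => p p0; rewrite (deriv_powR a (f0 _ p0) _).2//.
exact: sm_derivable.
Qed.

Lemma mvt_line f p v (h : R) : (forall q, derivable f q v) -> 0 < h ->
  exists2 s, 0 <= s <= h & f (h *: v + p) - f p = 'D_v f (s *: v + p) * h.
Proof.
move=> df h0; pose g (s : R) : R := f (s *: v + p).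
have dg (s : R) : is_derive s 1 (g : R -> R^o) ('D_v f (s *: v + p)).
  exact: is_derive_line.
have cg : {within `[0, h], continuous g}.
  apply: continuous_subspaceT => s; apply/differentiable_continuous.
  by apply/derivable1_diffP; have [] := dg s.
have [s /itvP sh e] := MVT_segment (ltW h0) (fun s _ => dg s) cg.
exists s; first by rewrite !sh.
by move: e; rewrite /g scale0r add0r subr0.
Qed.

Lemma cont_ball f p (e : R) : {for p, continuous f} -> 0 < e ->
  exists2 d : R, 0 < d & forall q, `|p - q| < d -> `|f p - f q| < e.
Proof.
move=> cf e0; have /nbhs_ballP[d d0 H] : nbhs p (fun q => `|f p - f q| < e).
  by move: cf => /cvgrPdist_lt /(_ _ e0).
by exists d => // q pq; apply: H; rewrite -ball_normE.
Qed.

Let swap_diff (a b c d : R) : a - b - (c - d) = a - c - (b - d).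
Proof. by ring. Qed.

Let close_trans (x y z e : R) : `|x - z| < e / 2 -> `|y - z| < e / 2 ->
  `|x - y| <= e.
Proof. by move=> H1 H2; have := ler_distD z x y; rewrite (distrC z y); lra. Qed.

(** The second difference of [f] over the parallelogram spanned by h v and h w is symmetric in v and
    w. The mean value theorem, applied twice in either order, turns it into a mixed derivative at a
    point close to p; continuity at p then identifies the two. *)
Lemma schwarz f v w p :
  (forall q, derivable f q v) -> (forall q, derivable f q w) ->
  (forall q, derivable ('D_v f) q w) -> (forall q, derivable ('D_w f) q v) ->
  {for p, continuous ('D_w ('D_v f))} -> {for p, continuous ('D_v ('D_w f))} ->
  'D_w ('D_v f) p = 'D_v ('D_w f) p.
Proof.
move=> fv fw fvw fwv cA cB.
have key g (a b : V) (h : R) : (forall q, derivable g q a) ->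
    (forall q, derivable ('D_a g) q b) -> 0 < h ->
  exists s t : R, [/\ 0 <= s <= h, 0 <= t <= h &
   g (h *: b + (h *: a + p)) - g (h *: a + p) - (g (h *: b + p) - g p) =
   'D_b ('D_a g) (t *: b + (s *: a + p)) * h * h].
  move=> ga gab h0.
  pose G q := g (h *: b + q) - g q.
  have Gd q : derivable G q a /\ 'D_a G q = 'D_a g (h *: b + q) - 'D_a g q.
    have sh (u : V) :
        (fun k : R => k^-1 *: ((g (h *: b + (k *: a + u)) : R^o) - g (h *: b + u)))
       = (fun k : R => k^-1 *: ((g (k *: a + (h *: b + u)) : R^o) - g (h *: b + u))).
      by apply/funext => k; rewrite addrCA.
    have d1 : derivable (fun q => g (h *: b + q)) q a.
      by have := ga (h *: b + q); rewrite /derivable/= sh.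
    have e1 : 'D_a (fun q => g (h *: b + q)) q = 'D_a g (h *: b + q).
      by rewrite /derive/= sh.
    split; first exact: (@derivable_sub a (fun q => g (h *: b + q)) g q d1 (ga q)).
    by rewrite -e1; exact: (@derive_subf a (fun q => g (h *: b + q)) g q d1 (ga q)).
  have [s sh es] := mvt_line p (fun q => (Gd q).1) h0.
  have [t th et] := mvt_line (s *: a + p) gab h0.
  exists s, t; split => //; move: es; rewrite (Gd _).2 et /G => <-.
  by [].
apply/eqP; rewrite -subr_eq0 -normr_le0; apply/ler_addgt0Pl => e e0.
rewrite addr0.
have e20 : 0 < e / 2 by rewrite divr_gt0.
have [d1 d10 B1] := cont_ball cA e20.
have [d2 d20 B2] := cont_ball cB e20.
(* Every point s v + t w + p with 0 <= s, t <= h is within h C of p, and h C is less than both radii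
   of continuity. *)
pose C := 1 + `|v| + `|w|; have C0 : 0 < C by rewrite /C -addrA ltr_pwDl// addr_ge0.
pose h := Num.min d1 d2 / (2 * C).
have h0 : 0 < h by rewrite divr_gt0 ?lt_min ?d10//= mulr_gt0.
have hC : h * C < Num.min d1 d2.
  have m0 : 0 < Num.min d1 d2 by rewrite lt_min d10.
  rewrite (_ : h * C = Num.min d1 d2 / 2); first by lra.
  by rewrite /h; field; rewrite gt_eqF.
have inball (a b : V) (s t : R) : `|a| + `|b| <= C -> 0 <= s <= h -> 0 <= t <= h ->
    `|p - (t *: b + (s *: a + p))| < Num.min d1 d2.
  move=> ab /andP[s0 sh] /andP[t0 th]; apply: le_lt_trans hC.
  rewrite addrA opprD addrCA subrr addr0 normrN.
  apply: (le_trans (ler_normD _ _)); rewrite !normrZ ger0_norm// ger0_norm//.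
  have := ler_wpM2r (normr_ge0 a) sh; have := ler_wpM2r (normr_ge0 b) th.
  have := ler_wpM2l (ltW h0) ab; lra.
have [s1 [t1 [s1h t1h E1]]] := key f v w h fv fvw h0.
have [s2 [t2 [s2h t2h E2]]] := key f w v h fw fwv h0.
have E : 'D_w ('D_v f) (t1 *: w + (s1 *: v + p)) =
         'D_v ('D_w f) (t2 *: v + (s2 *: w + p)).
  apply: (mulIf (lt0r_neq0 h0)); apply: (mulIf (lt0r_neq0 h0)).
  have ew : f (h *: w + (h *: v + p)) = f (h *: v + (h *: w + p)).
    by congr f; exact: addrCA.
  apply: (etrans (esym E1)); apply: etrans E2.
  by rewrite ew; exact: swap_diff.
have vw : `|v| + `|w| <= C by rewrite /C -addrA lerDr ler01.
have wv : `|w| + `|v| <= C by rewrite addrC.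
have := inball _ _ _ _ vw s1h t1h; rewrite lt_min => /andP[b1 _].
have := inball _ _ _ _ wv s2h t2h; rewrite lt_min => /andP[_ b2].
have H1 := B1 _ b1; have H2 := B2 _ b2; rewrite E in H1.
exact: (close_trans H1 H2).
Qed.

(* regularity off the origin suffices, as the support stays away from it *)
Definition tf f := sm f /\ exists a M : R, 0 < a /\ forall p, f p != 0 -> a <= `|p| <= M.

Lemma tf_sm f : tf f -> sm f. Proof. by case. Qed.

Lemma tf0 f : tf f -> f 0 = 0.
Proof.
move=> [_ [a [M [a0 H]]]]; apply/eqP; apply: contraTT a0 => /H.
by rewrite normr0 -leNgt => /andP[].
Qed.

Lemma tf_near0 f : tf f -> \forall q \near (0 : V), f q = 0.
Proof.
move=> [_ [a [M [a0 H]]]]; apply/nbhs_ballP; exists a => //= q.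
rewrite -ball_normE/= sub0r normrN => qa; apply/eqP.
apply: contraTT qa => /H /andP[aq _]; by rewrite -leNgt.
Qed.

Lemma tf_derivable f p v : tf f -> derivable f p v.
Proof.
move=> tff; have [->|p0] := eqVneq p 0; last exact: sm_derivable (tf_sm tff) p0.
apply: (@near_eq_derivable _ V R^o (fun=> 0)); last exact: derivable_cst.
by have := tf_near0 tff; apply: filterS => q ->.
Qed.

Lemma tf_cont f : tf f -> continuous f.
Proof.
move=> tff p; have [->|p0] := eqVneq p 0; last exact: sm_cont (tf_sm tff) p0.
rewrite /prop_for /continuous_at (tf0 tff).
have z : (fun=> 0 : R) @ nbhs (0 : V) --> (0 : R) by exact: cvg_cst.
apply: cvg_trans z; apply: near_eq_cvg.
by have := tf_near0 tff; apply: filterS => q ->.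
Qed.

Lemma near_dist p (e : R) : 0 < e -> \forall q \near p, `|p - q| < e.
Proof.
by move=> e0; apply/nbhs_ballP; exists e => // q; rewrite -ball_normE.
Qed.

Lemma near_norm_lt p (a : R) : `|p| < a -> \forall q \near p, `|q| < a.
Proof.
move=> pa; have e0 : 0 < a - `|p| by rewrite subr_gt0.
apply: filterS (near_dist p e0) => q; rewrite ltrBrDr; apply: le_lt_trans.
rewrite -[X in `|X| <= _](subrK p) distrC.
by apply: le_trans (ler_normD _ _) _; rewrite distrC.
Qed.

Lemma near_norm_gt p (a : R) : a < `|p| -> \forall q \near p, a < `|q|.
Proof.
move=> pa; have e0 : 0 < `|p| - a by rewrite subr_gt0.
apply: filterS (near_dist p e0) => q; rewrite ltrBrDr -ltrBrDl => H.
by apply: lt_le_trans H _; rewrite lerBlDr addrC -lerBlDr lerB_dist.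
Qed.

(** The derivative vanishes wherever [f] vanishes near the point. As |p| < a and |p| > M are open
    conditions, the same annulus serves. *)
Lemma tf_D v f : tf f -> tf ('D_v f).
Proof.
move=> [sf [a [M [a0 H]]]]; split; first exact: smD.
exists a, M; split=> // p.
have zero : (\forall q \near p, f q = 0) -> 'D_v f p = 0.
  move=> fz; rewrite (@near_eq_derive _ V R^o f (fun=> 0))//.
  by rewrite (@derive_cst _ V R^o 0).
apply: contraNT; rewrite negb_and -!ltNge => /orP[pa|pM]; apply/eqP/zero.
  have : \forall q \near p, `|q| < a.
    by apply: near_norm_lt.
  apply: filterS => q qa; apply/eqP; apply: contraTT qa => /H /andP[aq _].
  by rewrite -leNgt.
have : \forall q \near p, M < `|q|.
  by apply: near_norm_gt.
apply: filterS => q qa; apply/eqP; apply: contraTT qa => /H /andP[_ aq].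
by rewrite -leNgt.
Qed.

Lemma tf_schwarz f v w p : tf f -> 'D_w ('D_v f) p = 'D_v ('D_w f) p.
Proof.
move=> tff; apply: schwarz.
- by move=> q; exact: tf_derivable.
- by move=> q; exact: tf_derivable.
- by move=> q; apply: tf_derivable; exact: tf_D.
- by move=> q; apply: tf_derivable; exact: tf_D.
- by apply: tf_cont; do 2 apply: tf_D.
- by apply: tf_cont; do 2 apply: tf_D.
Qed.

Lemma tf_mull f g : sm f -> tf g -> tf (fun p => f p * g p).
Proof.
move=> sf [sg [a [M [a0 H]]]]; split; first exact: sm_mul.
by exists a, M; split => // p; rewrite mulf_eq0 negb_or => /andP[_ /H].
Qed.

Lemma tf_mulr f g : tf f -> sm g -> tf (fun p => f p * g p).
Proof.
move=> [sf [a [M [a0 H]]]] sg; split; first exact: sm_mul.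
by exists a, M; split => // p; rewrite mulf_eq0 negb_or => /andP[/H].
Qed.

Lemma tf_add f g : tf f -> tf g -> tf (fun p => f p + g p).
Proof.
move=> [sf [a [M [a0 H]]]] [sg [b [K [b0 L]]]]; split; first exact: sm_add.
exists (Num.min a b), (Num.max M K); split; first by rewrite lt_min a0.
move=> p; have [-> fg|f0 _] := eqVneq (f p) 0.
  have /andP[h1 h2] : b <= `|p| <= K by apply: L; move: fg; rewrite add0r.
  by apply/andP; split; [rewrite ge_min h1 orbT|rewrite le_max h2 orbT].
have /andP[h1 h2] := H p f0.
by apply/andP; split; [rewrite ge_min h1|rewrite le_max h2].
Qed.

Lemma tf_cst0 : tf (fun=> 0).
Proof.
split; first exact: sm_cst.
by exists 1, 1; split=> // p; rewrite eqxx.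
Qed.

Lemma tf_opp f : tf f -> tf (fun p => - f p).
Proof.
move=> [sf [a [M [a0 H]]]]; split; first exact: sm_opp.
by exists a, M; split => // p; rewrite oppr_eq0 => /H.
Qed.

Lemma tf_exp f k : tf f -> tf (fun p => f p ^+ k.+1).
Proof.
move=> tff; have := tf_mulr tff (sm_exp k (tf_sm tff)).
by congr tf; apply/funext => p; rewrite exprS.
Qed.

Lemma tf_sum (I : Type) (s : seq I) (F : I -> V -> R) :
  (forall i, tf (F i)) -> tf (fun p => \sum_(i <- s) F i p).
Proof.
move=> tF; elim: s => [|i s IH].
  by have := tf_cst0; congr tf; apply/funext => p; rewrite big_nil.
have := tf_add (tF i) IH.
by congr tf; apply/funext => p; rewrite big_cons.
Qed.

End smooth.

(** * Invariance and null sets of the Lebesgue measure *)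

Section tuple_measure.
Context {R : realType}.
Local Notation MR := (measurableTypeR R).
Local Notation T n := (n.-tuple MR).
Local Notation leb := (@lebesgue_measure R).

Lemma ge0_integral_lebesgue_step n (f : T n.+1 -> \bar R) :
  measurable_fun setT f -> (forall t, 0 <= f t)%E ->
  (\int[lebesgue_tuple n.+1]_t f t =
   \int[leb]_x \int[lebesgue_tuple n]_t f (tcons (x, t)))%E.
Proof.
move=> mf f0.
transitivity (\int[leb \x lebesgue_tuple n]_z (f \o @tcons R n) z)%E.
  have := @ge0_integral_pushforward _ _ _ _ R _ (@measurable_tcons R n)
    (leb \x lebesgue_tuple n)%E setT f measurableT mf (fun y _ => f0 y).
  rewrite preimage_setT => <-.
  by apply: eq_measure_integral => [|? A mA _]; first exact: measurable_tcons.
rewrite fubini_tonelli1//; last by move=> z; exact: f0.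
by apply: measurableT_comp => //; exact: measurable_tcons.
Qed.

Definition leb_preserving (tau : R -> R) :=
  measurable_fun setT (tau : MR -> MR) /\
  forall A : set MR, measurable A -> leb (tau @^-1` A) = leb A.

Lemma ge0_integral_leb_preserving tau (f : MR -> \bar R) :
  leb_preserving tau -> measurable_fun setT f -> (forall t, 0 <= f t)%E ->
  (\int[leb]_x f (tau x) = \int[leb]_x f x)%E.
Proof.
move=> [mtau htau] mf f0.
have := @ge0_integral_pushforward _ _ _ _ R _ mtau leb setT f measurableT mf
  (fun y _ => f0 y).
rewrite preimage_setT => <-.
by apply: eq_measure_integral => A mA _; exact: (htau A mA).
Qed.

Definition tcoord n (i : 'I_n) (tau : R -> R) (t : T n) : T n :=
  [tuple (if j == i then tau (tnth t j) else tnth t j) | j < n].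

Lemma measurable_tcoord n (i : 'I_n) tau : measurable_fun setT (tau : MR -> MR) ->
  measurable_fun setT (tcoord i tau).
Proof.
move=> mtau; apply/measurable_fun_tnthP => j.
have [ji|ji] := eqVneq j i.
  rewrite (_ : _ \o _ = fun t : T n => tau (tnth t j)).
    by apply: (measurableT_comp mtau); exact: measurable_tnth.
  by apply/funext => t; rewrite /= tnth_mktuple ji eqxx.
rewrite (_ : _ \o _ = fun t : T n => tnth t j); first exact: measurable_tnth.
by apply/funext => t; rewrite /= tnth_mktuple (negbTE ji).
Qed.

Lemma tcoord_cons0 n tau (x : MR) (t : T n) :
  tcoord ord0 tau (tcons (x, t)) = tcons (tau x, t).
Proof.
apply: eq_from_tnth => j; rewrite tnth_mktuple.
case: (unliftP ord0 j) => [k ->|->]; last by rewrite eqxx !tnth0.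
by rewrite eq_sym (negbTE (neq_lift _ _)) !tnthS.
Qed.

Lemma tcoord_consS n (i : 'I_n) tau (x : MR) (t : T n) :
  tcoord (lift ord0 i) tau (tcons (x, t)) = tcons (x, tcoord i tau t).
Proof.
apply: eq_from_tnth => j; rewrite tnth_mktuple.
case: (unliftP ord0 j) => [k ->|->].
  by rewrite (inj_eq lift_inj) !tnthS tnth_mktuple.
by rewrite (negbTE (neq_lift _ _)) !tnth0.
Qed.

(** Induction on the dimension: the coordinate acted on is either the first one, integrated
    outermost, or one of the others, where the induction hypothesis applies inside the outer
    integral. *)
Lemma ge0_integral_tcoord n (i : 'I_n) tau (f : T n -> \bar R) :
  leb_preserving tau -> measurable_fun setT f -> (forall t, 0 <= f t)%E ->
  (\int[lebesgue_tuple n]_t f (tcoord i tau t) = \int[lebesgue_tuple n]_t f t)%E.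
Proof.
move=> ltau; elim: n i f => [|n IH] i f mf f0; first by case: i.
have mfc : measurable_fun setT (f \o tcoord i tau).
  by apply: measurableT_comp => //; apply: measurable_tcoord; case: ltau.
rewrite [LHS]ge0_integral_lebesgue_step// [RHS]ge0_integral_lebesgue_step//.
have mF : measurable_fun setT (f \o @tcons R n).
  by apply: measurableT_comp => //; exact: measurable_tcons.
case: (unliftP ord0 i) mfc => [k ->|->] mfc.
  apply: eq_integral => x _.
  under eq_integral do rewrite tcoord_consS.
  apply: (IH k (fun t => f (tcons (x, t)))) => //.
  by apply: (measurableT_comp mF); exact: measurable_pair1.
under eq_integral do under eq_integral do rewrite tcoord_cons0.
apply: (@ge0_integral_leb_preserving tau
  (fun x => \int[lebesgue_tuple n]_t f (tcons (x, t)))%E) => //.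
  apply: (@measurable_fun_fubini_tonelli_F _ _ _ _ _ (lebesgue_tuple n)
    (f \o @tcons R n)) => //.
  by move=> z; exact: f0.
by move=> x; exact: integral_ge0.
Qed.

Lemma leb_preservingN : leb_preserving -%R.
Proof.
split; first exact: oppr_measurable.
by move=> A mA; exact: lebesgue_measureN.
Qed.

Lemma leb_preserving_shift (h : R) : leb_preserving (fun x => x + h).
Proof.
have mh : measurable_fun setT ((fun x => x + h) : MR -> MR).
  by apply: measurable_funD.
split=> // A mA; have mhA := mh.
pose nu := pushforward leb ((fun x => x + h) : MR -> MR).
apply/esym; apply: (@lebesgue_measure_unique R
  (pushforward leb (((fun x => x + h) : MR -> MR)))) => //= _ [[a b]] _ <-.
rewrite /pushforward /=.
rewrite (_ : _ @^-1` _ = `]a - h, b - h]%classic); last first.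
  by apply/seteqP; split => x /=; rewrite !in_itv/= ltrBlDr lerBrDr.
rewrite !lebesgue_measure_itv/= !lte_fin ltrD2r.
by case: ifP => // _; rewrite -!EFinB; congr (_%:E); ring.
Qed.

Definition box n (M : R) : set (T n) := [set t | forall i, `|tnth t i| <= M].

Lemma measurable_box n M : measurable (@box n M).
Proof.
rewrite (_ : @box n M = \bigcap_(i in [set: 'I_n]) [set t | `|tnth t i| <= M]).
  apply: fin_bigcap_measurable => [|i _]; first exact: finite_finset.
  rewrite (_ : [set _ | _] = (fun t : T n => tnth t i : MR) @^-1` `[- M, M]%classic).
    by rewrite -[X in measurable X]setTI; apply: (measurable_tnth i).
  by apply/seteqP; split=> t /=; rewrite in_itv/= ler_norml.
by apply/seteqP; split=> t H i; [move=> _; exact: H|exact: (H i I)].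
Qed.

Lemma lebesgue_box n M : (lebesgue_tuple n (@box n M) < +oo)%E.
Proof.
elim: n => [|n IH]; first by rewrite /= diracE; case: (_ \in _); rewrite ltry.
rewrite /= /lebesgue_step /pushforward.
rewrite (_ : _ @^-1` _ = `[- M, M]%classic `*` @box n M).
  have l0 : (leb `[(- M)%R, M]%classic < +oo)%E.
    by rewrite lebesgue_measure_itv/=; case: ifP => // _; rewrite -EFinB ltry.
  rewrite product_measure1E//; last exact: measurable_box.
  by rewrite lte_mul_pinfty// ge0_fin_numE.
apply/seteqP; split=> -[x t] /=.
  move=> H; split; first by have := H ord0; rewrite tnth0 in_itv/= ler_norml.
  by move=> i; have := H (lift ord0 i); rewrite tnthS.
rewrite in_itv/= -ler_norml => -[xM H] i.
case: (unliftP ord0 i) => [k ->|->]; last by rewrite tnth0.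
by rewrite tnthS; exact: H.
Qed.

Lemma lebesgue_hyperplane n :
  lebesgue_tuple n.+1 [set t : T n.+1 | tnth t ord0 = 0 :> R] = 0%E.
Proof.
rewrite /= /lebesgue_step /pushforward.
rewrite (_ : _ @^-1` _ = ([set (0 : R)] : set MR) `*` [set: T n]).
  rewrite product_measure1E//.
  (* The second factor may be infinite; the product 0 * +oo is 0. *)
  transitivity ((0 : \bar R) * lebesgue_tuple n setT)%E; last exact: mul0e.
  by congr (_ * _)%E; exact: lebesgue_measure_set1.
by apply/seteqP; split=> -[x t] /=; rewrite tnth0// => -[].
Qed.

End tuple_measure.

(** * Integration on R^n x R of functions supported away from the origin *)

Section integral.
Context {R : realType} {n : nat}.
Local Notation V := ('rV[R]_n * R)%type.
Local Notation MR := (measurableTypeR R).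
Local Notation T := (n.-tuple MR).
Local Notation mu := (lebesgue_tuple n \x @lebesgue_measure R)%E.
Implicit Types (f g : V -> R) (p q v : V).

Definition emb (p : T * MR) : V := (\row_i tnth p.1 i, p.2).

Lemma rat_dense (x e : R) : 0 < e -> exists q : rat, `|x - ratr q| < e.
Proof.
move=> e0; have /rat_in_itvoo[q] : x - e < x + e by lra.
by rewrite in_itv/= => /andP[h1 h2]; exists q; rewrite ltr_norml; lra.
Qed.

Lemma ball_V p e q : 0 < e -> ball p e q <->
  (forall i, `|p.1 0 i - q.1 0 i| < e) /\ `|p.2 - q.2| < e.
Proof.
move=> e0; split.
  by move=> [[_ h1] h2]; split => [i|//]; have := h1 0 i.
move=> [h1 h2]; split => //; split => // i j.
by rewrite (ord1 i); exact: h1.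
Qed.

Lemma measurable_emb_ball p e : 0 < e -> measurable (emb @^-1` (ball p e)).
Proof.
move=> e0.
rewrite (_ : _ @^-1` _ =
  (\bigcap_(i in [set: 'I_n]) ((fun t : T => tnth t i : MR) @^-1` (ball (p.1 0 i) e : set R)))
   `*` (ball p.2 e : set R)).
  apply: measurableX.
    apply: fin_bigcap_measurable => [|i _]; first exact: finite_finset.
    rewrite -[X in measurable X]setTI; apply: (measurable_tnth i) => //.
    exact: measurable_ball.
  exact: measurable_ball.
apply/seteqP; split => q /=.
  by move=> /(ball_V _ _ e0) [h1 h2]; split => // i _ /=; have := h1 i; rewrite mxE.
move=> [h1 h2]; apply/(ball_V _ _ e0); split => // i.
by have := h1 i I; rewrite /= mxE.
Qed.

(** The topology comes from the sup norm on V, the sigma-algebra is the product one on tuples. They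
    meet because an open set is a countable union of balls with rational centres and radii 1/(m+1),
    whose preimages are measurable boxes. *)
Lemma measurable_emb_open (U : set V) : open U -> measurable (emb @^-1` U).
Proof.
move=> oU.
pose c (k : 'rV[rat]_n * rat * nat) : V := (\row_i ratr (k.1.1 0 i), ratr k.1.2).
pose S := [set k : 'rV[rat]_n * rat * nat | ball (c k) k.2.+1%:R^-1 `<=` U].
rewrite (_ : emb @^-1` U = \bigcup_(k in S) emb @^-1` (ball (c k) k.2.+1%:R^-1)).
  rewrite bigcup_mkcond; apply: countable_bigcupT_measurable => // k.
  by case: ifP => // _; apply: measurable_emb_ball; rewrite invr_gt0.
apply/seteqP; split => x /=; last by move=> [k /= kS xk]; exact: kS.
move=> Ux; have /nbhs_ballP[e /= e0 eU] : nbhs (emb x) U.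
  exact: open_nbhs_nbhs.
have e20 : 0 < e / 2 by rewrite divr_gt0.
pose m := Num.truncn (e / 2)^-1.
have m0 : (0 : R) < m.+1%:R^-1 by rewrite invr_gt0.
(* With 1/(m+1) < e/2, a ball of radius 1/(m+1) whose rational centre is that close to [emb x]
   contains [emb x] and stays in the ball of radius e. *)
have me : (m.+1%:R^-1 : R) < e / 2.
  by rewrite invf_plt ?posrE// Num.Theory.truncnS_gt.
have cq (i : 'I_n) := rat_dense (tnth x.1 i : R) m0.
pose qi i := sval (cid (cq i)).
have [q qe] := rat_dense (emb x).2 m0.
exists ((\row_i qi i, q), m) => /=.
  move=> y /(ball_V _ _ m0) [h1 h2]; apply: eU; apply/(ball_V _ _ e0); split.
    move=> i; have := h1 i; rewrite /c /= !mxE.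
    have := svalP (cid (cq i)); rewrite -/(qi i) /= => A B.
    apply: (le_lt_trans (ler_distD (ratr (qi i)) (tnth x.1 i) (y.1 0 i))).
    by rewrite (splitr e); apply: ltrD; [exact: lt_trans A me|exact: lt_trans B me].
  have := h2; rewrite /c /= => B; move: qe => /= A.
  apply: (le_lt_trans (ler_distD (ratr q) x.2 y.2)).
  by rewrite (splitr e); apply: ltrD; [exact: lt_trans A me|exact: lt_trans B me].
apply/(ball_V _ _ m0); split => [i|]; last by rewrite /c /= distrC.
by rewrite /c /= !mxE distrC; exact: (svalP (cid (cq i))).
Qed.

Lemma measurable_emb_cont f : continuous f ->
  measurable_fun [set: T * MR] (f \o emb).
Proof.
move=> /continuousP cf; apply: (measurability _ (RGenOpens.measurableE R)).
move=> _ [_ [a [b ->] <-]]; rewrite setTI comp_preimage.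
by apply: measurable_emb_open; apply: cf; exact: interval_open.
Qed.

Definition mbox (M : R) : set (T * MR) := @box R n M `*` `[- M, M]%classic.

Lemma measurable_mbox M : measurable (mbox M).
Proof. by apply: measurableX => //; exact: measurable_box. Qed.

Lemma mu_mbox M : (mu (mbox M) < +oo)%E.
Proof.
have l0 : (@lebesgue_measure R `[(- M)%R, M]%classic < +oo)%E.
  by rewrite lebesgue_measure_itv/=; case: ifP => // _; rewrite -EFinB ltry.
rewrite product_measure1E//; last exact: measurable_box.
by rewrite lte_mul_pinfty// ge0_fin_numE//; exact: lebesgue_box.
Qed.

Lemma norm_VE p M : (`|p| <= M) <-> 0 <= M /\ (forall i, `|p.1 0 i| <= M) /\ `|p.2| <= M.
Proof.
rewrite prod_normE ge_max; split.
  move=> /andP[h1 h2]; split; first exact: le_trans h2.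
  split=> // i; apply: le_trans h1; rewrite [leRHS]mx_normrE.
  exact: (le_bigmax _ (fun ij => `|p.1 ij.1 ij.2|) (0, i)).
move=> [M0 [h1 h2]]; rewrite h2 andbT.
rewrite [leLHS]mx_normrE; apply/bigmax_leP; split => // -[i j] _ /=.
by rewrite (ord1 i).
Qed.

Lemma embP x M : `|emb x| <= M -> mbox M x.
Proof.
move=> /norm_VE [M0 [h1 h2]]; split => /=.
  by move=> i; have := h1 i; rewrite /= mxE.
by rewrite in_itv/= -ler_norml.
Qed.

Lemma tf_bounded f : tf f -> exists C : R, 0 <= C /\ forall p, `|f p| <= C.
Proof.
move=> tff; have [sf [a [M [a0 H]]]] := tff.
pose K : set V :=
  [set v : 'rV[R]_n | forall i, `[- M, M]%classic (v ord0 i)] `*` `[- M, M]%classic.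
have cK : compact K.
  apply: compact_setX; last exact: segment_compact.
  by apply: (@rV_compact _ n (fun=> `[- M, M]%classic)) => i; exact: segment_compact.
have /compact_bounded[B [Br HB]] : compact (f @` K).
  apply: continuous_compact => //; apply: continuous_subspaceT; exact: tf_cont.
exists (`|B| + 1); split; first by rewrite addr_ge0.
move=> p; have [->|fp0] := eqVneq (f p) 0; first by rewrite normr0 addr_ge0.
apply: (HB (`|B| + 1)); first by rewrite (le_lt_trans (ler_norm _))// ltrDl.
exists p => //; have /andP[_ /norm_VE [M0 [h1 h2]]] := H p fp0.
by split => /= [i|]; rewrite in_itv/= -ler_norml.
Qed.

Definition integrable_V f := mu.-integrable setT (EFin \o (f \o emb)).

Lemma bounded_ig f (C M : R) : measurable_fun [set: T * MR] (f \o emb) ->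
  (forall p, `|f p| <= C) -> (forall p, f p != 0 -> `|p| <= M) -> integrable_V f.
Proof.
move=> mf fC fM.
have C0 : 0 <= C by apply: le_trans (fC 0).
have iK : mu.-integrable setT (fun x => C%:E * (\1_(mbox M) x)%:E)%E.
  apply: integrableZl => //; apply/integrableP; split.
    by apply/measurable_EFinP; exact: measurable_indic (measurable_mbox M).
  under eq_integral do rewrite gee0_abs ?lee_fin//.
  by rewrite integral_indic ?setIT; [exact: mu_mbox| |exact: measurable_mbox].
apply: le_integrable iK => //; first exact/measurable_EFinP.
move=> x _; rewrite /= lee_fin.
have [->|fx] := eqVneq (f (emb x)) 0; first by rewrite normr0.
have /embP xM := fM _ fx.
by rewrite indicE mem_set// mulr1 (le_trans (fC _))// ler_norm.
Qed.

Lemma tf_ig f : tf f -> integrable_V f.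
Proof.
move=> tff; have [C [C0 fC]] := tf_bounded tff.
have [_ [a [M [a0 H]]]] := tff.
apply: (@bounded_ig f C M) => //; first by apply: measurable_emb_cont; exact: tf_cont.
by move=> p /H /andP[].
Qed.

Definition intg f : R := (\int[mu]_x (f (emb x)))%R.

Lemma intgD f g : integrable_V f -> integrable_V g ->
  intg (fun p => f p + g p) = intg f + intg g.
Proof. by move=> h1 h2; exact: RintegralD. Qed.

Lemma intgB f g : integrable_V f -> integrable_V g ->
  intg (fun p => f p - g p) = intg f - intg g.
Proof. by move=> h1 h2; exact: RintegralB. Qed.

Lemma intgZ c f : integrable_V f -> intg (fun p => c * f p) = c * intg f.
Proof. by move=> h1; exact: RintegralZl. Qed.

Lemma le_intg f g : integrable_V f -> integrable_V g ->
  (forall p, f p <= g p) -> intg f <= intg g.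
Proof. by move=> h1 h2 fg; apply: le_Rintegral. Qed.

Lemma intg0 : intg (fun=> 0) = 0.
Proof. by rewrite /intg Rintegral_cst// mul0r. Qed.

Lemma integral_GE f : integrable_V f -> integral_G f = (intg f)%:E.
Proof.
move=> igf; rewrite /intg /Rintegral fineK//.
exact: integrable_fin_num.
Qed.

End integral.

(** * Invariance under coordinate maps, nullity of the axis, dominated convergence *)

Section invariance.
Context {R : realType} {n : nat}.
Local Notation V := ('rV[R]_n * R)%type.
Local Notation MR := (measurableTypeR R).
Local Notation T := (n.-tuple MR).
Local Notation mu := (lebesgue_tuple n \x @lebesgue_measure R)%E.
Implicit Types (f g : V -> R) (p q v : V).

Definition xcoord (i : 'I_n) (tau : R -> R) (p : V) : V :=
  (\row_j (if j == i then tau (p.1 0 j) else p.1 0 j), p.2).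

Definition ycoord (tau : R -> R) (p : V) : V := (p.1, tau p.2).

Let ximg (i : 'I_n) tau (x : T * MR) : T * MR := (tcoord i tau x.1, x.2).
Let yimg tau (x : T * MR) : T * MR := (x.1, tau x.2).

Let emb_ximg i tau x : emb (ximg i tau x) = xcoord i tau (emb x).
Proof.
by rewrite /emb /xcoord /=; congr pair; apply/rowP => j; rewrite !mxE tnth_mktuple.
Qed.

Let emb_yimg tau x : emb (yimg tau x) = ycoord tau (emb x).
Proof. by []. Qed.

Let measurable_ximg i tau : leb_preserving tau -> measurable_fun setT (ximg i tau).
Proof.
move=> [mt _]; apply: measurable_fun_pair => //.
by apply: (measurableT_comp (measurable_tcoord i mt)).
Qed.

Let measurable_yimg tau : leb_preserving tau -> measurable_fun setT (yimg tau).
Proof.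
move=> [mt _]; apply: measurable_fun_pair => //.
by apply: (measurableT_comp mt).
Qed.

Let ge0_ximg i tau (F : T * MR -> \bar R) : leb_preserving tau ->
  measurable_fun setT F -> (forall x, 0 <= F x)%E ->
  (\int[mu]_x F (ximg i tau x) = \int[mu]_x F x)%E.
Proof.
move=> lt mF F0.
have mFc : measurable_fun setT (F \o ximg i tau).
  by apply: measurableT_comp => //; exact: measurable_ximg.
rewrite (@fubini_tonelli2 _ _ _ _ _ _ _ (F \o ximg i tau) mFc (fun x => F0 _)).
rewrite (@fubini_tonelli2 _ _ _ _ _ _ _ F mF F0).
apply: eq_integral => y _; rewrite /fubini_G /=.
apply: (@ge0_integral_tcoord R n i tau (fun t => F (t, y))) => //.
by apply: (measurableT_comp mF); exact: measurable_pair2.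
Qed.

Let ge0_yimg tau (F : T * MR -> \bar R) : leb_preserving tau ->
  measurable_fun setT F -> (forall x, 0 <= F x)%E ->
  (\int[mu]_x F (yimg tau x) = \int[mu]_x F x)%E.
Proof.
move=> lt mF F0.
have mFc : measurable_fun setT (F \o yimg tau).
  by apply: measurableT_comp => //; exact: measurable_yimg.
rewrite (@fubini_tonelli1 _ _ _ _ _ _ _ (F \o yimg tau) mFc (fun x => F0 _)).
rewrite (@fubini_tonelli1 _ _ _ _ _ _ _ F mF F0).
apply: eq_integral => y _; rewrite /fubini_F /=.
apply: (@ge0_integral_leb_preserving R tau (fun s => F (y, s))) => //.
by apply: (measurableT_comp mF); exact: measurable_pair1.
Qed.

(** Tonelli transports the positive and the negative part separately, so measurability of [f] is
    enough. *)
Lemma intg_xcoord i tau f : leb_preserving tau ->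
  measurable_fun [set: T * MR] (f \o emb) -> intg (fun p => f (xcoord i tau p)) = intg f.
Proof.
move=> lt mf; rewrite /intg /Rintegral; congr fine.
rewrite integralE [RHS]integralE.
have mE : measurable_fun [set: T * MR] (EFin \o (f \o emb)) by exact/measurable_EFinP.
congr (_ - _)%E.
  rewrite -[RHS](ge0_ximg i lt); last 2 first.
  - exact: measurable_funepos.
  - by move=> x; exact: funepos_ge0.
  by apply: eq_integral => x _; rewrite !funeposE /= emb_ximg.
rewrite -[RHS](ge0_ximg i lt); last 2 first.
- exact: measurable_funeneg.
- by move=> x; exact: funeneg_ge0.
by apply: eq_integral => x _; rewrite !funenegE /= emb_ximg.
Qed.

Lemma intg_ycoord tau f : leb_preserving tau ->
  measurable_fun [set: T * MR] (f \o emb) -> intg (fun p => f (ycoord tau p)) = intg f.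
Proof.
move=> lt mf; rewrite /intg /Rintegral; congr fine.
rewrite integralE [RHS]integralE.
have mE : measurable_fun [set: T * MR] (EFin \o (f \o emb)) by exact/measurable_EFinP.
congr (_ - _)%E.
  rewrite -[RHS](ge0_yimg lt); last 2 first.
  - exact: measurable_funepos.
  - by move=> x; exact: funepos_ge0.
  by apply: eq_integral => x _; rewrite !funeposE /= emb_yimg.
rewrite -[RHS](ge0_yimg lt); last 2 first.
- exact: measurable_funeneg.
- by move=> x; exact: funeneg_ge0.
by apply: eq_integral => x _; rewrite !funenegE /= emb_yimg.
Qed.

(** Division by |grad_G varrho|^2 breaks down where x = 0. This set lies in a coordinate hyperplane,
    which is null, so comparisons of integrands off the axis suffice. *)
Lemma axis_null : (0 < n)%N -> mu (emb @^-1` [set p : V | p.1 = 0]) = 0%E.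
Proof.
move=> n0; pose i0 := Ordinal n0.
have mH : measurable [set t : T | tnth t i0 = 0 :> R].
  rewrite (_ : [set _ | _] = (fun t : T => tnth t i0 : MR) @^-1` [set (0 : R)]).
    by rewrite -[X in measurable X]setTI; apply: (measurable_tnth i0).
  by apply/seteqP; split.
have H0 m (m0 : (0 < m)%N) :
    lebesgue_tuple m [set t : m.-tuple MR | tnth t (Ordinal m0) = 0 :> R] = 0%E.
  case: m m0 => // m m0.
  rewrite -[RHS](@lebesgue_hyperplane R m); congr (lebesgue_tuple _ _).
  by apply/seteqP; split => t /=; rewrite (_ : Ordinal m0 = ord0)//; exact: val_inj.
apply: (@subset_measure0 _ _ _ mu _ ([set t : T | tnth t i0 = 0 :> R] `*` setT)).
- have := @measurable_emb_open R n; move=> mo.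
  rewrite (_ : _ @^-1` _ =
      \bigcap_(i in [set: 'I_n]) ((fun t : T * MR => tnth t.1 i : MR) @^-1` [set (0 : R)])).
    apply: fin_bigcap_measurable => [|i _]; first exact: finite_finset.
    rewrite -[X in measurable X]setTI.
    have mi : measurable_fun setT (fun t : T * MR => tnth t.1 i : MR).
      by apply: (measurableT_comp (measurable_tnth i)).
    exact: mi.
  apply/seteqP; split => x /=.
    by move=> x0 i _ /=; move/rowP : x0 => /(_ i); rewrite !mxE.
  by move=> H; apply/rowP => i; rewrite !mxE; exact: (H i I).
- exact: measurableX.
- move=> x /= /rowP /(_ i0); rewrite !mxE => h; split => //.
- pose N : set T := [set t : T | tnth t i0 = 0 :> R].
  transitivity (lebesgue_tuple n N * (@lebesgue_measure R) setT)%E;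
    first exact: product_measure1E.
  by rewrite (H0 n n0) mul0e.
Qed.

Lemma intg_dct (F : nat -> V -> R) (G : V -> R) (C M : R) :
  (forall k, measurable_fun [set: T * MR] (F k \o emb)) ->
  (forall k p, `|F k p| <= C) -> (forall k p, F k p != 0 -> `|p| <= M) ->
  (forall p, F ^~ p @ \oo --> G p) ->
  (fun k => intg (F k)) @ \oo --> intg G.
Proof.
move=> mF FC FM FG.
pose g (x : T * MR) : \bar R := (C%:E * (\1_(mbox M) x)%:E)%E.
have integrable_V : mu.-integrable setT g.
  apply: integrableZl => //; apply/integrableP; split.
    by apply/measurable_EFinP; exact: measurable_indic (measurable_mbox M).
  under eq_integral do rewrite gee0_abs ?lee_fin//.
  by rewrite integral_indic ?setIT; [exact: mu_mbox| |exact: measurable_mbox].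
have mFE k : measurable_fun [set: T * MR] (EFin \o (F k \o emb)).
  by apply/measurable_EFinP.
have FGE x : (fun k => (EFin \o (F k \o emb)) x) @ \oo --> (EFin \o (G \o emb)) x.
  by apply: cvg_EFin; [exact: nearW|exact: FG].
have mG : measurable_fun [set: T * MR] (EFin \o (G \o emb)).
  by apply: (emeasurable_fun_cvg (fun k => EFin \o (F k \o emb))).
have dom x k : (`|(EFin \o (F k \o emb)) x| <= g x)%E.
  rewrite /g /= lee_fin.
  have [->|fx] := eqVneq (F k (emb x)) 0.
    by rewrite normr0 mulr_ge0//; apply: le_trans (FC 0%N 0).
  have /embP xM := FM _ _ fx.
  by rewrite indicE mem_set// mulr1 FC.
have [iG _ cv] := @dominated_convergence _ _ R mu setT measurableT
  (fun k => EFin \o (F k \o emb)) (EFin \o (G \o emb)) g mFE mG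
  (aeW _ (fun x _ => FGE x)) integrable_V (aeW _ (fun x k _ => dom x k)).
have := fine_cvg; rewrite /intg /Rintegral => H.
apply: H; rewrite fineK; first exact: cv.
exact: integrable_fin_num.
Qed.

End invariance.

(** * Integration by parts and density of the complement of the axis *)

Section ibp.
Context {R : realType} {n : nat}.
Local Notation V := ('rV[R]_n * R)%type.
Local Notation MR := (measurableTypeR R).
Local Notation T := (n.-tuple MR).
Implicit Types (f g u : V -> R) (p q v : V).

Definition ex (i : 'I_n) : V := (delta_mx 0 i, 0).
Definition et : V := (0, 1).

Lemma xcoord_shift i (h : R) p : xcoord i (fun x => x + h) p = h *: ex i + p.
Proof.
rewrite /xcoord /ex; case: p => x t; congr pair => /=; last first.
  by rewrite scaler0 add0r.
apply/rowP => j; rewrite !mxE eqxx /=.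
by case: eqVneq => _ /=; rewrite ?mulr1 ?mulr0 ?add0r// addrC.
Qed.

Lemma ycoord_shift (h : R) p : ycoord (fun x => x + h) p = h *: et + p.
Proof.
rewrite /ycoord /et; case: p => x t; congr pair => /=.
  by rewrite scaler0 add0r.
by rewrite [_%:A]mulr1 addrC.
Qed.

Lemma tf_measurable f : tf f -> measurable_fun [set: T * MR] (f \o emb).
Proof. by move=> tff; apply: measurable_emb_cont; exact: tf_cont. Qed.

Lemma cont_shift f v : continuous f -> continuous (fun p => f (v + p)).
Proof.
move=> cf p; have cs : (fun q => v + q) @ p --> v + p.
  by apply: cvgD; [exact: cvg_cst|exact: cvg_id].
exact: (@continuous_comp _ _ _ (fun q : V => v + q) f p cs (cf _)).
Qed.

(** Difference quotients along v integrate to 0 by invariance. The mean value theorem bounds them by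
    the supremum of the derivative and gives their pointwise limit; their supports stay in a fixed
    box, so dominated convergence applies. *)
Lemma intg_deriv f v : tf f ->
  (forall h, intg (fun p => f (h *: v + p)) = intg f) -> intg ('D_v f) = 0.
Proof.
move=> tff shf.
have tfD := tf_D v tff.
have [C [C0 fC]] := tf_bounded tfD.
have [_ [a [M [a0 H]]]] := tff.
pose h (k : nat) : R := k.+1%:R^-1.
have h0 k : 0 < h k by rewrite invr_gt0.
have h1 k : h k <= 1 by rewrite invf_le1// ler1n.
pose F (k : nat) p := (h k)^-1 * (f (h k *: v + p) - f p).
have FE k p : exists2 s : R, 0 <= s <= h k & F k p = 'D_v f (s *: v + p).
  have [s sh e] := @mvt_line R n f p v (h k) (fun q => tf_derivable tff) (h0 k).
  exists s => //; rewrite /F e mulrCA mulVf ?mulr1//.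
  exact: lt0r_neq0.
have cF k : continuous (F k).
  move=> p; have c1 := @cont_shift f (h k *: v) (tf_cont tff) p.
  have c2 : (fun q => f (h k *: v + q) - f q) @ p --> f (h k *: v + p) - f p.
    exact: (@cvgB _ R^o _ _ _ _ _ _ _ c1 (tf_cont tff (x := p))).
  have c3 : (fun=> (h k)^-1 : R) @ p --> (h k)^-1 by exact: cvg_cst.
  exact: (@cvgM _ _ _ _ _ _ _ _ c3 c2).
have igs k : integrable_V (fun p => f (h k *: v + p)).
  have [B [B0 fB]] := tf_bounded tff.
  (* Since h k <= 1, the translation moves the support by at most |v|. *)
  apply: (@bounded_ig _ _ _ B (M + `|v|)).
  - by apply: measurable_emb_cont; apply: cont_shift; exact: tf_cont.
  - by move=> p; exact: fB.
  - move=> p /H /andP[_ pM].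
    rewrite -[p](addKr (h k *: v)) addrC.
    apply: (le_trans (ler_normB _ _)); apply: lerD => //.
    rewrite normrZ ger0_norm ?(ltW (h0 k))//.
    by rewrite ler_piMl// h1.
have lim1 : (fun k => intg (F k)) @ \oo --> intg ('D_v f).
  apply: (@intg_dct _ _ F ('D_v f) C (M + `|v|)).
  - by move=> k; exact: measurable_emb_cont.
  - by move=> k p; have [s _ ->] := FE k p; exact: fC.
  - move=> k p Fp.
    have [fp0|/H /andP[_ pM]] := eqVneq (f p) 0; last first.
      by apply: (le_trans pM); rewrite lerDl.
    have : f (h k *: v + p) != 0.
      by apply: contraNneq Fp => e; rewrite /F e fp0 subrr mulr0.
    move=> /H /andP[_ pM].
    rewrite -[p](addKr (h k *: v)) addrC.
    apply: (le_trans (ler_normB _ _)); apply: lerD => //.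
    rewrite normrZ ger0_norm ?(ltW (h0 k))//.
    by rewrite ler_piMl// h1.
  - move=> p; apply/cvgrPdist_lt => e e0.
    have [d d0 Hd] := cont_ball (tf_cont tfD (x := p)) e0.
    have d1 : 0 < d / (1 + `|v|) by rewrite divr_gt0// ltr_pwDl.
    near=> k; have [s /andP[s0 sh] ->] := FE k p; apply: Hd.
    rewrite opprD addrCA subrr addr0 normrN normrZ ger0_norm//.
    have hk : h k < d / (1 + `|v|).
      by near: k; exact: near_infty_natSinv_lt (PosNum d1).
    apply: (@le_lt_trans _ _ (h k * `|v|)); first exact: ler_wpM2r.
    rewrite ltr_pdivlMr ?ltr_pwDl// in hk; apply: le_lt_trans hk.
    by rewrite mulrDr mulr1 lerDr ltW.
have E k : intg (F k) = 0.
  rewrite /F intgZ; last first.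
    have B1 := igs k; have B2 := tf_ig tff.
    by have := integrableB measurableT B1 B2.
  by rewrite intgB ?shf ?subrr ?mulr0//; exact: tf_ig.
have lim0 : (fun k => intg (F k)) @ \oo --> (0 : R).
  by under eq_fun do rewrite E; exact: cvg_cst.
exact: (cvg_unique _ lim1 lim0).
Unshelve. all: by end_near. Qed.

Lemma intg_dx i f : tf f -> intg (dx i f) = 0.
Proof.
move=> tff; apply: intg_deriv => // h.
under [in LHS]eq_fun do rewrite -xcoord_shift.
by apply: intg_xcoord; [exact: leb_preserving_shift|exact: tf_measurable].
Qed.

Lemma intg_dt f : tf f -> intg (dt f) = 0.
Proof.
move=> tff; apply: intg_deriv => // h.
under [in LHS]eq_fun do rewrite -ycoord_shift.
by apply: intg_ycoord; [exact: leb_preserving_shift|exact: tf_measurable].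
Qed.

Lemma intg_sum (J : Type) (s : seq J) (F : J -> V -> R) : (forall j, tf (F j)) ->
  intg (fun p => \sum_(j <- s) F j p) = \sum_(j <- s) intg (F j).
Proof.
move=> tF; elim: s => [|j s IH].
  rewrite big_nil; apply: etrans (@intg0 R n); congr intg.
  by apply/funext => p; rewrite big_nil.
rewrite big_cons -IH -intgD; [|exact: tf_ig|by apply: tf_ig; exact: tf_sum].
by congr intg; apply/funext => p; rewrite big_cons.
Qed.

Definition refl (i : 'I_n) p : V := xcoord i -%R p.

Lemma intg_odd i f : tf f -> (forall p, f (refl i p) = - f p) -> intg f = 0.
Proof.
move=> tff fo.
have := intg_xcoord i leb_preservingN (tf_measurable tff).
under [X in intg X]eq_fun do rewrite -/(refl i _) fo -mulN1r.
rewrite intgZ; [lra|exact: tf_ig].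
Qed.

Lemma norm_ex i : `|ex i| <= 1.
Proof.
apply/norm_VE; split => //; split => [j|] /=; last by rewrite normr0.
by rewrite mxE eqxx; case: eqP => _; rewrite ?normr1 ?normr0.
Qed.

(** Points off the axis are dense and both functions are continuous. This is what permits
    multiplying a pointwise claim by psi, which is positive only off the axis. *)
Lemma dense_le f g : (0 < n)%N -> tf f -> tf g ->
  (forall p, p.1 != 0 -> f p <= g p) -> forall p, f p <= g p.
Proof.
move=> n0 tff tfg fg p; have [p0|] := eqVneq p.1 0; last exact: fg.
rewrite leNgt; apply/negP => gf.
have tfh : tf (fun p => f p - g p) by apply: tf_add => //; exact: tf_opp.
have e0 : 0 < f p - g p by rewrite subr_gt0.
have [d d0 Hd] := cont_ball (tf_cont tfh (x := p)) e0.
pose i0 := Ordinal n0; pose q := (d / 2) *: ex i0 + p.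
have d20 : 0 < d / 2 by rewrite divr_gt0.
have q1 : q.1 != 0.
  apply/eqP => /rowP /(_ i0); rewrite /q /= p0 !mxE !eqxx /= addr0 mulr1.
  by move=> e; move: d20; rewrite e ltxx.
have pq : `|p - q| < d.
  rewrite /q opprD addrCA subrr addr0 normrN normrZ gtr0_norm//.
  apply: (@le_lt_trans _ _ (d / 2)); last by lra.
  by rewrite ler_piMr ?norm_ex// ltW.
by have := Hd q pq; have := fg q q1; rewrite ltr_norml; lra.
Qed.

Lemma dense_eq f g : (0 < n)%N -> tf f -> tf g ->
  (forall p, p.1 != 0 -> f p = g p) -> f = g.
Proof.
move=> n0 tff tfg fg; apply/funext => p; apply/le_anti/andP.
by split; apply: dense_le => // q q0; rewrite fg.
Qed.

(** [u] vanishes on the hyperplane x_i = 0, and the mean value theorem along x_i, between p and that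
    hyperplane, bounds it by the supremum of its derivative. *)
Lemma odd_bound i u : tf u -> (forall p, u (refl i p) = - u p) ->
  exists2 C : R, 0 <= C & forall p, `|u p| <= C * `|p.1 0 i|.
Proof.
move=> tfu uo; have [C [C0 uC]] := tf_bounded (tf_D (ex i) tfu).
exists C => // p.
have u0 q : q.1 0 i = 0 -> u q = 0.
  move=> q0; have : refl i q = q.
    rewrite /refl /xcoord; case: q q0 => x t /= x0; congr pair.
    by apply/rowP => j; rewrite !mxE; case: eqVneq => // ->; rewrite x0 oppr0.
  by move=> e; have := uo q; rewrite e; lra.
have eqh (x y h : R) : 0 <= h -> (exists2 d : R, `|d| <= C & x - y = d * h) ->
    `|x - y| <= C * h.
  move=> h0 [d dC ->]; rewrite normrM (ger0_norm h0).
  exact: ler_wpM2r.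
(* [mvt_line] moves in the positive direction only: the segment ends on the hyperplane if x_i < 0
   and starts there if x_i > 0. *)
have [xi|xi|xi] := ltgtP (p.1 0 i) 0.
- pose h := - p.1 0 i; have h0 : 0 < h by rewrite /h oppr_gt0.
  have [s _ e] := @mvt_line R n u p (ex i) h (fun q => tf_derivable tfu) h0.
  rewrite -normrN (ltr0_norm xi) -/h.
  rewrite [u (h *: _ + _)]u0 in e; last first.
    by rewrite /= !mxE !eqxx /= mulr1 /h addNr.
  rewrite -[- u p]add0r; apply: eqh; first exact: ltW.
  by exists ('D_(ex i) u (s *: ex i + p)); [exact: uC|rewrite -e].
- pose h := p.1 0 i; pose q := (- h) *: ex i + p.
  have [s _ e] := @mvt_line R n u q (ex i) h (fun q => tf_derivable tfu) xi.
  rewrite (gtr0_norm xi) -/h.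
  have q0 : u q = 0 by apply: u0; rewrite /q /= !mxE !eqxx /= mulr1 addNr.
  rewrite q0 in e.
  rewrite (_ : u p = u (h *: ex i + q) - 0); last first.
    by rewrite subr0 /q addrA -scalerDl subrr scale0r add0r.
  apply: eqh; first exact: ltW.
  by exists ('D_(ex i) u (s *: ex i + q)); [exact: uC|rewrite -e].
- by rewrite u0// xi !normr0 mulr0.
Qed.

End ibp.

(** * Vector fields and invariants *)

Section derivations.
Context {R : realType} {n : nat}.
Local Notation V := ('rV[R]_n * R)%type.
Implicit Types (f g u : V -> R) (p q v : V).

(** One interface for the partial derivatives, Z, Y, the rotations and, with the first argument
    fixed, the forms [Gam] and [Df]: all are local, obey the Leibniz rule off the origin and
    preserve smoothness and support. *)
Record is_der (T : (V -> R) -> V -> R) : Prop := IsDer {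
  drv_add : forall f g p, sm f -> sm g -> p != 0 ->
    T (fun q => f q + g q) p = T f p + T g p;
  drv_mul : forall f g p, sm f -> sm g -> p != 0 ->
    T (fun q => f q * g q) p = T f p * g p + f p * T g p;
  drv_cst : forall (c : R) p, p != 0 -> T (fun=> c) p = 0;
  drv_eq : forall f g p, (forall q, q != 0 -> f q = g q) -> p != 0 ->
    T f p = T g p;
  drv_sm : forall f, sm f -> sm (T f);
  drv_tf : forall f, tf f -> tf (T f) }.

Section der_theory.
Context (T : (V -> R) -> V -> R) (dT : is_der T).

Lemma drv_scale c f p : sm f -> p != 0 -> T (fun q => c * f q) p = c * T f p.
Proof.
move=> sf p0; rewrite (drv_mul dT (sm_cst c) sf p0) (drv_cst dT)//.
by rewrite mul0r add0r.
Qed.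

Lemma drv_opp f p : sm f -> p != 0 -> T (fun q => - f q) p = - T f p.
Proof.
move=> sf p0; rewrite -mulN1r -drv_scale//.
by congr T; apply/funext => q; rewrite mulN1r.
Qed.

Lemma drv_sub f g p : sm f -> sm g -> p != 0 ->
  T (fun q => f q - g q) p = T f p - T g p.
Proof.
by move=> sf sg p0; rewrite (drv_add dT sf (sm_opp sg) p0) drv_opp.
Qed.

Lemma drv_sqr f p : sm f -> p != 0 -> T (fun q => f q ^+ 2) p = 2 * f p * T f p.
Proof.
move=> sf p0; rewrite (_ : (fun q => f q ^+ 2) = fun q => f q * f q).
  by rewrite (drv_mul dT sf sf p0); ring.
by apply/funext => q; rewrite expr2.
Qed.

Lemma drv_sum (J : Type) (s : seq J) (F : J -> V -> R) p :
  (forall j, sm (F j)) -> p != 0 ->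
  T (fun q => \sum_(j <- s) F j q) p = \sum_(j <- s) T (F j) p.
Proof.
move=> sF p0; elim: s => [|j s IH].
  rewrite big_nil -(drv_cst dT 0 p0); congr T; apply/funext => q.
  by rewrite big_nil (drv_cst dT).
rewrite big_cons -IH -(drv_add dT (sF j) (sm_sum s sF) p0).
by congr T; apply/funext => q; rewrite big_cons.
Qed.

End der_theory.

Lemma is_der_D v : is_der (fun f => 'D_v f).
Proof.
split.
- move=> f g p sf sg p0.
  by apply: (@deriveD _ V R^o); exact: sm_derivable.
- move=> f g p sf sg p0.
  exact: (derive_mulf (sm_derivable sf p0) (sm_derivable sg p0)).
- by move=> c p p0; rewrite (@derive_cst _ V R^o c).
- move=> f g p fg p0; apply: (@near_eq_derive _ V R^o).
  by apply: filterS (near_neq0 p0) => q; exact: fg.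
- by move=> f; exact: smD.
- by move=> f; exact: tf_D.
Qed.

End derivations.

(** Locking keeps unification from unfolding derivatives and sums when large expressions are
    compared. *)
HB.lock Definition dX (R : realType) (n : nat) (i : 'I_n)
  (f : 'rV[R]_n * R -> R) (p : 'rV[R]_n * R) : R := dx i f p.
HB.lock Definition dT (R : realType) (n : nat)
  (f : 'rV[R]_n * R -> R) (p : 'rV[R]_n * R) : R := dt f p.
HB.lock Definition op (R : realType) (n : nat) (a : 'I_n -> 'rV[R]_n * R -> R)
  (b f : 'rV[R]_n * R -> R) (p : 'rV[R]_n * R) : R :=
  \sum_i a i p * dX i f p + b p * dT f p.

Arguments dX {R n} i f p.
Arguments dT {R n} f p.
Arguments op {R n} a b f p.

(** * First-order operators and the divergence formula *)

Section operators.
Context {R : realType} {n : nat}.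
Local Notation V := ('rV[R]_n * R)%type.
Implicit Types (f g u : V -> R) (p q v : V).

Lemma dXE : @dX R n = @dx R n. Proof. by rewrite unlock. Qed.

Lemma dTE : @dT R n = @dt R n. Proof. by rewrite unlock. Qed.

Lemma is_der_dX i : is_der (@dX R n i). Proof. by rewrite dXE; exact: is_der_D. Qed.
Lemma is_der_dT : is_der (@dT R n). Proof. by rewrite dTE; exact: is_der_D. Qed.

Lemma intg_dX i f : tf f -> intg (dX i f) = 0. Proof. by rewrite dXE; exact: intg_dx. Qed.
Lemma intg_dT f : tf f -> intg (dT f) = 0. Proof. by rewrite dTE; exact: intg_dt. Qed.

Lemma opE (a : 'I_n -> V -> R) b f p :
  op a b f p = \sum_i a i p * dX i f p + b p * dT f p.
Proof. by rewrite unlock. Qed.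

Lemma opEf (a : 'I_n -> V -> R) b f :
  op a b f = fun p => \sum_i a i p * dX i f p + b p * dT f p.
Proof. by apply/funext => p; exact: opE. Qed.

Lemma is_der_op (a : 'I_n -> V -> R) b : (forall i, sm (a i)) -> sm b -> is_der (op a b).
Proof.
move=> sa sb; split.
- move=> f g p sf sg p0; rewrite !opE (drv_add is_der_dT)//.
  under eq_bigr do rewrite (drv_add (is_der_dX _))// mulrDr.
  by rewrite big_split /=; ring.
- move=> f g p sf sg p0; rewrite !opE (drv_mul is_der_dT)//.
  under eq_bigr => i _ do
    rewrite (drv_mul (is_der_dX i))// mulrDr mulrA [_ * (f p * _)]mulrCA.
  by rewrite big_split /= -mulr_suml -mulr_sumr; ring.
- move=> c p p0; rewrite !opE (drv_cst is_der_dT)// mulr0 addr0.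
  by apply: big1 => i _; rewrite (drv_cst (is_der_dX i))// mulr0.
- move=> f g p fg p0; rewrite !opE (drv_eq is_der_dT fg p0); congr (_ + _).
  by apply: eq_bigr => i _; rewrite (drv_eq (is_der_dX i) fg p0).
- move=> f sf; rewrite opEf; apply: sm_add.
  2: by apply: sm_mul => //; exact: (drv_sm is_der_dT).
  by apply: sm_sum => i; apply: sm_mul => //; exact: (drv_sm (is_der_dX i)).
- move=> f sf; rewrite opEf; apply: tf_add.
  2: by apply: tf_mull => //; exact: (drv_tf is_der_dT).
  by apply: tf_sum => i; apply: tf_mull => //; exact: (drv_tf (is_der_dX i)).
Qed.

Lemma tf_ext f g : tf f -> tf g -> (forall p, p != 0 -> f p = g p) -> f = g.
Proof.
move=> tff tfg fg; apply/funext => p.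
by have [->|] := eqVneq p 0; [rewrite !tf0|exact: fg].
Qed.

(** The integrand is the divergence of [f] times the field with components [a] and [b], and each
    partial derivative has integral 0. *)
Lemma intg_op (a : 'I_n -> V -> R) b f : (forall i, sm (a i)) -> sm b -> tf f ->
  intg (fun p => op a b f p + (\sum_i dX i (a i) p + dT b p) * f p) = 0.
Proof.
move=> sa sb tff.
have ta i : tf (fun p => a i p * f p) by exact: tf_mull.
have tb : tf (fun p => b p * f p) by exact: tf_mull.
have sff := tf_sm tff.
transitivity (intg (fun p => \sum_i dX i (fun q => a i q * f q) p
   + dT (fun q => b q * f q) p)).
  congr intg; apply: tf_ext.
  - apply: tf_add; first exact: (drv_tf (is_der_op sa sb)).
    apply: tf_mull => //; apply: sm_add; last exact: (drv_sm is_der_dT).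
    by apply: sm_sum => i; exact: (drv_sm (is_der_dX i)).
  - apply: tf_add; last exact: (drv_tf is_der_dT).
    by apply: tf_sum => i; exact: (drv_tf (is_der_dX i)).
  move=> p p0; rewrite (drv_mul is_der_dT)//.
  under [in RHS]eq_bigr => i _ do rewrite (drv_mul (is_der_dX i))//.
  by rewrite big_split /= opE -mulr_suml; ring.
rewrite intgD; last 2 first.
- by apply: tf_ig; apply: tf_sum => i; exact: (drv_tf (is_der_dX i)).
- by apply: tf_ig; exact: (drv_tf is_der_dT).
rewrite intg_dT// addr0 intg_sum; last by move=> i; exact: (drv_tf (is_der_dX i)).
by apply: big1 => i _; exact: intg_dX.
Qed.

Definition xc (i : 'I_n) (p : V) : R := p.1 0 i.
Definition tc (p : V) : R := p.2.

Lemma D_affine (l : V -> R) v p :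
  (forall (h : R) q, l (h *: v + q) = h * l v + l q) ->
  derivable l p v /\ 'D_v l p = l v.
Proof.
move=> lh.
have e : (fun h : R => l (h *: v + p) : R^o) = (fun h : R => h * l v + l p : R^o).
  by apply/funext => h; exact: lh.
have d : is_derive (0 : R) (1 : R) (fun h : R => h * l v + l p : R^o) (l v).
  have d1 := @is_deriveM R R^o id (cst (l v)) 0 1 1 0 (is_derive_id _ _) (is_derive_cst _ _ _).
  have d2 := @is_deriveD R R^o R^o _ (cst (l p)) 0 1 _ 0 d1 (is_derive_cst _ _ _).
  apply: (@is_derive_eq _ R^o R^o _ _ _ _ _ d2).
  by rewrite /GRing.scale /= mulr0 add0r addr0 mulr1.
have dl : derivable l p v by apply/derivable1P; rewrite e; case: d.
split => //.
by have [_ <-] := is_derive_line0 dl; rewrite e; case: d.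
Qed.

Lemma sm_affine (l : V -> R) : (forall v (h : R) q, l (h *: v + q) = h * l v + l q) ->
  continuous l -> sm l.
Proof.
move=> lh cl [|k]; first by move=> p _; exact: cl.
split.
  by move=> p _; split; [exact: cl|move=> v; exact: (D_affine p (lh v)).1].
move=> v; apply: smk_eq (sm_cst (l v) k) => p _.
by rewrite (D_affine p (lh v)).2.
Qed.

Lemma xc_affine i v (h : R) q : xc i (h *: v + q) = h * xc i v + xc i q.
Proof. by rewrite /xc /= !mxE. Qed.

Lemma tc_affine v (h : R) q : tc (h *: v + q) = h * tc v + tc q.
Proof. by []. Qed.

Lemma sm_xc i : sm (xc i).
Proof.
apply: sm_affine; first by move=> v h q; exact: xc_affine.
move=> p; apply: (@continuous_comp _ _ _ fst (fun M : 'rV[R]_n => M 0 i)).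
  exact: cvg_fst.
exact: coord_continuous.
Qed.

Lemma sm_tc : sm tc.
Proof.
apply: sm_affine; first by move=> v h q; exact: tc_affine.
move=> p; exact: cvg_snd.
Qed.

Lemma dx_xc i j p : dX i (xc j) p = (i == j)%:R.
Proof.
rewrite dXE /dx (D_affine p (@xc_affine j _)).2 /xc /= mxE eqxx /=.
by rewrite eq_sym.
Qed.

Lemma dt_xc j p : dT (xc j) p = 0.
Proof. by rewrite dTE /dt (D_affine p (@xc_affine j _)).2 /xc /= mxE. Qed.

Lemma dx_tc i p : dX i tc p = 0.
Proof. by rewrite dXE /dx (D_affine p (@tc_affine _)).2. Qed.

Lemma dt_tc p : dT tc p = 1.
Proof. by rewrite dTE /dt (D_affine p (@tc_affine _)).2. Qed.

Definition Xf (p : V) : R := \sum_i xc i p ^+ 2.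
Definition Nf (p : V) : R := Xf p ^+ 2 + 4 * tc p ^+ 2.

End operators.

(* r = varrho^-2, psi = |grad_G varrho|^2 and sg = 2 t / varrho^2 *)
HB.lock Definition rf (R : realType) (n : nat) (p : 'rV[R]_n * R) : R :=
  Nf p `^ (- 2^-1).
Arguments rf {R n} p.

(** * The radial functions r, psi, sg and their derivatives *)

Section invariants.
Context {R : realType} {n : nat}.
Local Notation V := ('rV[R]_n * R)%type.
Implicit Types (f g u : V -> R) (p q v : V).

Definition psi (p : V) : R := Xf p * rf p.
Definition sg (p : V) : R := 2 * tc p * rf p.

Lemma rfE p : rf p = Nf p `^ (- 2^-1). Proof. by rewrite unlock. Qed.

Lemma Xf_ge0 (p : V) : 0 <= Xf p.
Proof. by apply: sumr_ge0 => i _; exact: sqr_ge0. Qed.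

Lemma Xf_eq0 p : (Xf p == 0) = (p.1 == 0).
Proof.
rewrite psumr_eq0; last by move=> i _; exact: sqr_ge0.
apply/idP/eqP => [/allP H|p0].
  apply/rowP => i; have := H i (mem_index_enum _); rewrite /= sqrf_eq0 mxE.
  by rewrite /xc => /eqP.
by apply/allP => i _ /=; rewrite /xc p0 mxE expr0n.
Qed.

Lemma Xf_gt0 p : p.1 != 0 -> 0 < Xf p.
Proof. by move=> p0; rewrite lt_def Xf_eq0 p0 Xf_ge0. Qed.

Lemma Nf_gt0 p : p != 0 -> 0 < Nf p.
Proof.
have X2 : 0 <= Xf p ^+ 2 by exact: sqr_ge0.
have t2 : 0 <= 4 * tc p ^+ 2 by rewrite mulr_ge0// sqr_ge0.
move=> p0; rewrite lt_def /Nf (addr_ge0 X2 t2) andbT.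
apply: contra p0; rewrite (paddr_eq0 X2 t2).
rewrite sqrf_eq0 mulf_eq0 pnatr_eq0 /= sqrf_eq0 Xf_eq0 => /andP[/eqP x0 /eqP t0].
by rewrite /tc in t0; rewrite (surjective_pairing p) x0 t0.
Qed.

Lemma rf_gt0 p : p != 0 -> 0 < rf p.
Proof. by move=> p0; rewrite rfE powR_gt0// Nf_gt0. Qed.

Lemma rfN p : p != 0 -> rf p ^+ 2 * Nf p = 1.
Proof.
move=> p0; have N0 := Nf_gt0 p0.
rewrite rfE expr2 -powRD; last by rewrite (lt0r_neq0 N0) implybT.
rewrite (_ : - 2^-1 + - 2^-1 = -1 :> R); last by field.
by rewrite powR_inv1 ?ltW// mulVf//; exact: lt0r_neq0.
Qed.

Lemma sm_Xf : sm (@Xf R n).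
Proof. by apply: sm_sum => i; apply: sm_exp; exact: sm_xc. Qed.

Lemma sm_Nf : sm (@Nf R n).
Proof.
apply: sm_add; first by apply: sm_exp; exact: sm_Xf.
by apply: sm_mul; [exact: sm_cst|apply: sm_exp; exact: sm_tc].
Qed.

Lemma sm_rf : sm (@rf R n).
Proof.
have -> : @rf R n = fun p => Nf p `^ (- 2^-1) by apply/funext => p; exact: rfE.
by apply: sm_powR; [move=> p; exact: Nf_gt0|exact: sm_Nf]. Qed.

Lemma sm_psi : sm psi.
Proof. by apply: sm_mul; [exact: sm_Xf|exact: sm_rf]. Qed.

Lemma sm_sg : sm sg.
Proof.
apply: sm_mul; last exact: sm_rf.
by apply: sm_mul; [exact: sm_cst|exact: sm_tc].
Qed.

Lemma psi_sg p : p != 0 -> psi p ^+ 2 + sg p ^+ 2 = 1.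
Proof. by move=> /rfN <-; rewrite /psi /sg /Nf; ring. Qed.

Lemma psi_ge0 p : 0 <= psi p.
Proof. by rewrite mulr_ge0 ?Xf_ge0// rfE powR_ge0. Qed.

Lemma psi_gt0 p : p.1 != 0 -> 0 < psi p.
Proof.
move=> p0; rewrite mulr_gt0 ?Xf_gt0// rf_gt0//.
by apply: contraNneq p0 => ->.
Qed.

Lemma dx_Xf i p : p != 0 -> dX i Xf p = 2 * xc i p.
Proof.
move=> p0; rewrite (drv_sum (is_der_dX i))//; last first.
  by move=> j; apply: sm_exp; exact: sm_xc.
rewrite (bigD1 i)//= big1 => [|j ji].
  by rewrite (drv_sqr (is_der_dX i) (sm_xc i) p0) dx_xc eqxx mulr1 addr0.
rewrite (drv_sqr (is_der_dX i) (sm_xc j) p0) dx_xc eq_sym (negbTE ji).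
by rewrite mulr0.
Qed.

Lemma dt_Xf p : p != 0 -> dT Xf p = 0.
Proof.
move=> p0; rewrite (drv_sum is_der_dT)//; last first.
  by move=> j; apply: sm_exp; exact: sm_xc.
by apply: big1 => j _; rewrite (drv_sqr is_der_dT (sm_xc j) p0) dt_xc mulr0.
Qed.

Lemma drv_Nf T p : is_der T -> p != 0 ->
  T Nf p = 2 * Xf p * T Xf p + 8 * tc p * T tc p.
Proof.
move=> dT p0; have st : sm (fun q : V => tc q ^+ 2) by exact: sm_exp 2 sm_tc.
rewrite (drv_add dT (sm_exp 2 sm_Xf) (sm_mul (sm_cst 4) st) p0).
by rewrite (drv_sqr dT sm_Xf p0) (drv_scale dT 4 st p0) (drv_sqr dT sm_tc p0); ring.
Qed.

(** Obtained by differentiating r^2 N = 1, which needs only the rules of [is_der] and no chain rule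
    for powers. *)
Lemma drv_rf T p : is_der T -> p != 0 ->
  T rf p = - (rf p ^+ 3 * (Xf p * T Xf p + 4 * tc p * T tc p)).
Proof.
move=> dT p0.
have sr := sm_rf; have sN := sm_Nf.
have E : T (fun q => rf q ^+ 2 * Nf q) p = 0.
  by rewrite (drv_eq dT (g := fun=> 1) _ p0) ?(drv_cst dT)// => q; exact: rfN.
move: E; rewrite (drv_mul dT (sm_exp 2 sr) sN p0) (drv_sqr dT sr p0) drv_Nf//.
have := rfN p0; have := rf_gt0 p0.
move: (rf p) (Nf p) (T rf p) (Xf p) (T Xf p) (tc p) (T tc p) => r N Tr X TX t Tt.
move=> r0 rN E.
(* The equation is multiplied by r^2 so that r^2 N = 1 can be substituted. *)
have E2 : r * (2 * Tr * (r ^+ 2 * N) + 2 * r ^+ 3 * (X * TX + 4 * t * Tt)) = 0.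
  by rewrite -[RHS](mulr0 (r ^+ 2)) -E; ring.
move/eqP: E2; rewrite mulf_eq0 gt_eqF//= rN => /eqP E2; lra.
Qed.

End invariants.

(** * Dilations, rotations, the field Y and the associated forms *)

Section vector_fields.
Context {R : realType} {n : nat}.
Local Notation V := ('rV[R]_n * R)%type.
Implicit Types (f g u a b : V -> R) (p q v : V).

(* Y is tangent to the level sets of varrho.  Gam is the angular part
   X grad_x a . grad_x b - (Ea)(Eb), and Df is
   varrho^2 grad_G a . grad_G b - psi (Za)(Zb); both are written as first-order
   operators in their second argument so that they inherit [is_der_op]. *)
Definition Ef : (V -> R) -> V -> R := op xc (fun=> 0).
Definition Zf : (V -> R) -> V -> R := op xc (fun q => 2 * tc q).
Definition Yf : (V -> R) -> V -> R :=
  op (fun i q => - 2 * rf q * tc q * xc i q) (fun q => rf q * Xf q ^+ 2).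
Definition Om (k l : 'I_n) f p : R := xc k p * dX l f p - xc l p * dX k f p.
Definition Sf a b p : R := \sum_i dX i a p * dX i b p.
Definition Gam a : (V -> R) -> V -> R :=
  op (fun i q => Xf q * dX i a q - Ef a q * xc i q) (fun=> 0).
Definition Df a : (V -> R) -> V -> R :=
  op (fun i q => Nf q * rf q * dX i a q - Xf q * rf q * Zf a q * xc i q)
     (fun q => Nf q * rf q * Xf q * dT a q - Xf q * rf q * Zf a q * (2 * tc q)).

Lemma EfE u p : Ef u p = \sum_i xc i p * dX i u p.
Proof. by rewrite /Ef opE mul0r addr0. Qed.

Lemma ZfE u p : Zf u p = Ef u p + 2 * tc p * dT u p.
Proof. by rewrite EfE /Zf opE. Qed.

Lemma YfE u p : Yf u p = rf p * (Xf p ^+ 2 * dT u p - 2 * tc p * Ef u p).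
Proof.
rewrite /Yf opE EfE.
have E i : - 2 * rf p * tc p * xc i p * dX i u p =
  (- 2 * rf p * tc p) * (xc i p * dX i u p) by rewrite mulrA.
under eq_bigr do rewrite E.
by rewrite -mulr_sumr; ring.
Qed.

Lemma GamE a b p : Gam a b p = Xf p * Sf a b p - Ef a p * Ef b p.
Proof.
rewrite /Gam opE mul0r addr0 (EfE b).
have E i : (Xf p * dX i a p - Ef a p * xc i p) * dX i b p =
  Xf p * (dX i a p * dX i b p) - Ef a p * (xc i p * dX i b p) by ring.
under eq_bigr do rewrite E.
by rewrite sumrB -!mulr_sumr.
Qed.

Lemma DfE a b p : Df a b p = Nf p * rf p * (Sf a b p + Xf p * (dT a p * dT b p))
  - psi p * (Zf a p * Zf b p).
Proof.
rewrite /Df opE.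
have E i : (Nf p * rf p * dX i a p - Xf p * rf p * Zf a p * xc i p) * dX i b p =
  Nf p * rf p * (dX i a p * dX i b p)
  - Xf p * rf p * Zf a p * (xc i p * dX i b p) by ring.
under eq_bigr do rewrite E.
by rewrite sumrB -!mulr_sumr (ZfE b) EfE /psi /Sf; ring.
Qed.

Lemma sm_dX i f : sm f -> sm (dX i f). Proof. by rewrite ?dXE ?dTE; exact: smD. Qed.
Lemma sm_dT f : sm f -> sm (dT f). Proof. by rewrite ?dXE ?dTE; exact: smD. Qed.
Lemma tf_dX i f : tf f -> tf (dX i f). Proof. by rewrite ?dXE ?dTE; exact: tf_D. Qed.
Lemma tf_dT f : tf f -> tf (dT f). Proof. by rewrite ?dXE ?dTE; exact: tf_D. Qed.

Lemma is_der_E : is_der Ef.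
Proof. by apply: is_der_op; [exact: sm_xc|exact: sm_cst]. Qed.

Lemma is_der_Z : is_der Zf.
Proof.
by apply: is_der_op; [exact: sm_xc|apply: sm_mul; [exact: sm_cst|exact: sm_tc]].
Qed.

Lemma sm_Yx i : sm (fun q : V => - 2 * rf q * tc q * xc i q).
Proof.
apply: sm_mul; last exact: sm_xc.
apply: sm_mul; last exact: sm_tc.
by apply: sm_mul; [exact: sm_cst|exact: sm_rf].
Qed.

Lemma sm_Yt : sm (fun q : V => rf q * Xf q ^+ 2).
Proof. by apply: sm_mul; [exact: sm_rf|apply: sm_exp; exact: sm_Xf]. Qed.

Lemma is_der_Y : is_der Yf.
Proof. by apply: is_der_op; [exact: sm_Yx|exact: sm_Yt]. Qed.

Lemma is_der_Om k l : is_der (Om k l).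
Proof.
split.
- move=> f g p sf sg p0; rewrite /Om (drv_add (is_der_dX l) sf sg p0).
  by rewrite (drv_add (is_der_dX k) sf sg p0); ring.
- move=> f g p sf sg p0; rewrite /Om (drv_mul (is_der_dX l) sf sg p0).
  by rewrite (drv_mul (is_der_dX k) sf sg p0); ring.
- move=> c p p0; rewrite /Om (drv_cst (is_der_dX l) c p0).
  by rewrite (drv_cst (is_der_dX k) c p0) !mulr0 subr0.
- move=> f g p fg p0; rewrite /Om (drv_eq (is_der_dX l) fg p0).
  by rewrite (drv_eq (is_der_dX k) fg p0).
- move=> f sf; have s1 i j : sm (fun p => xc i p * dX j f p).
    by apply: sm_mul; [exact: sm_xc|exact: sm_dX].
  exact: sm_sub (s1 k l) (s1 l k).
- move=> f tff; have t1 i j : tf (fun p => xc i p * dX j f p).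
    by apply: tf_mull; [exact: sm_xc|exact: tf_dX].
  exact: tf_add (t1 k l) (tf_opp (t1 l k)).
Qed.

Lemma is_der_Gam a : sm a -> is_der (Gam a).
Proof.
move=> sa; apply: is_der_op; last exact: sm_cst.
move=> i; apply: sm_sub; apply: sm_mul.
- exact: sm_Xf.
- exact: sm_dX.
- exact: (drv_sm is_der_E).
- exact: sm_xc.
Qed.

Lemma is_der_Df a : sm a -> is_der (Df a).
Proof.
move=> sa; have s1 : sm (fun q : V => Nf q * rf q).
  by apply: sm_mul; [exact: sm_Nf|exact: sm_rf].
have s2 : sm (fun q : V => Xf q * rf q * Zf a q).
  apply: sm_mul; first exact: sm_psi.
  exact: (drv_sm is_der_Z).
apply: is_der_op.
  by move=> i; apply: sm_sub; apply: sm_mul => //; [exact: sm_dX|exact: sm_xc].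
apply: sm_sub; apply: sm_mul => //.
- by apply: sm_mul => //; exact: sm_Xf.
- exact: sm_dT.
- by apply: sm_mul; [exact: sm_cst|exact: sm_tc].
Qed.

Lemma Sf_sym a b p : Sf a b p = Sf b a p.
Proof. by apply: eq_bigr => i _; rewrite mulrC. Qed.

Lemma Gam_sym a b p : Gam a b p = Gam b a p.
Proof. by rewrite !GamE Sf_sym; ring. Qed.

Lemma Df_sym a b p : Df a b p = Df b a p.
Proof. by rewrite !DfE Sf_sym; ring. Qed.

(** Off the axis the tangent spaces of the level sets of varrho are spanned by Y and the rotations.
    These fields degenerate on the axis, hence the factor psi. The two sides differ by a multiple of
    r^2 N - 1. *)
Lemma psi_Df a b p : p != 0 -> psi p * Df a b p = Yf a p * Yf b p + Gam a b p.
Proof.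
move=> p0; apply/eqP; rewrite -subr_eq0; apply/eqP.
rewrite DfE GamE !YfE !ZfE /psi.
transitivity ((rf p ^+ 2 * Nf p - 1) * (Xf p * Sf a b p - Ef a p * Ef b p)).
  by rewrite /Nf; ring.
by rewrite rfN// subrr mul0r.
Qed.

(** Lagrange's identity for the vectors x, grad_x a and grad_x b; each coordinate plane is counted
    twice, hence the factor 2. *)
Lemma sum_Om a b p : \sum_k \sum_l Om k l a p * Om k l b p = 2 * Gam a b p.
Proof.
rewrite GamE !EfE /Sf /Xf.
rewrite (_ : 2 * _ = (\sum_i xc i p ^+ 2) * (\sum_i dX i a p * dX i b p)
   + (\sum_i dX i a p * dX i b p) * (\sum_i xc i p ^+ 2)
   - (\sum_i xc i p * dX i a p) * (\sum_i xc i p * dX i b p)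
   - (\sum_i xc i p * dX i b p) * (\sum_i xc i p * dX i a p)); last by ring.
rewrite !big_distrlr -big_split /= -!sumrB; apply: eq_bigr => k _.
rewrite -big_split /= -!sumrB; apply: eq_bigr => l _.
by rewrite /Om; ring.
Qed.

Lemma Ef_xc i p : p != 0 -> Ef (xc i) p = xc i p.
Proof.
move=> p0; rewrite EfE (bigD1 i)//= big1 => [|j ji].
  by rewrite dx_xc eqxx mulr1 addr0.
by rewrite dx_xc (negbTE ji) mulr0.
Qed.

Lemma Ef_tc p : p != 0 -> Ef tc p = 0.
Proof. by move=> p0; rewrite EfE big1// => j _; rewrite dx_tc mulr0. Qed.

Lemma Ef_Xf p : p != 0 -> Ef Xf p = 2 * Xf p.
Proof.
move=> p0; rewrite EfE /Xf mulr_sumr; apply: eq_bigr => i _.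
by rewrite -/(Xf) dx_Xf//; ring.
Qed.

Lemma Zf_xc i p : p != 0 -> Zf (xc i) p = xc i p.
Proof. by move=> p0; rewrite ZfE Ef_xc// dt_xc mulr0 addr0. Qed.

Lemma Zf_tc p : p != 0 -> Zf tc p = 2 * tc p.
Proof. by move=> p0; rewrite ZfE Ef_tc// dt_tc mulr1 add0r. Qed.

Lemma Zf_Xf p : p != 0 -> Zf Xf p = 2 * Xf p.
Proof. by move=> p0; rewrite ZfE Ef_Xf// dt_Xf// mulr0 addr0. Qed.

Lemma Zf_rf p : p != 0 -> Zf rf p = - 2 * rf p.
Proof.
move=> p0; rewrite (drv_rf is_der_Z p0) Zf_Xf// Zf_tc//.
transitivity (- 2 * rf p * (rf p ^+ 2 * Nf p)); first by rewrite /Nf; ring.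
by rewrite rfN// mulr1.
Qed.

Lemma Zf_psi p : p != 0 -> Zf psi p = 0.
Proof.
move=> p0; rewrite (drv_mul is_der_Z sm_Xf sm_rf p0) Zf_Xf// Zf_rf//; ring.
Qed.

Lemma Yf_xc i p : p != 0 -> Yf (xc i) p = - 2 * rf p * tc p * xc i p.
Proof. by move=> p0; rewrite YfE dt_xc Ef_xc//; ring. Qed.

Lemma Yf_tc p : p != 0 -> Yf tc p = rf p * Xf p ^+ 2.
Proof. by move=> p0; rewrite YfE dt_tc Ef_tc//; ring. Qed.

Lemma Yf_Xf p : p != 0 -> Yf Xf p = - 2 * sg p * Xf p.
Proof. by move=> p0; rewrite YfE dt_Xf// Ef_Xf// /sg; ring. Qed.

Lemma Yf_rf p : p != 0 -> Yf rf p = 0.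
Proof. by move=> p0; rewrite (drv_rf is_der_Y p0) Yf_Xf// Yf_tc// /sg; ring. Qed.

Lemma Yf_psi p : p != 0 -> Yf psi p = - 2 * psi p * sg p.
Proof.
by move=> p0; rewrite (drv_mul is_der_Y sm_Xf sm_rf p0) Yf_Xf// Yf_rf// /psi; ring.
Qed.

Lemma Yf_sg p : p != 0 -> Yf sg p = 2 * psi p ^+ 2.
Proof.
move=> p0; have s2 : sm (fun q : V => 2 * tc q) by exact: sm_mul (sm_cst 2) sm_tc.
rewrite (drv_mul is_der_Y s2 sm_rf p0) (drv_scale is_der_Y 2 sm_tc p0).
by rewrite Yf_tc// Yf_rf// /psi; ring.
Qed.

Lemma Om_tc k l p : p != 0 -> Om k l tc p = 0.
Proof. by move=> p0; rewrite /Om !dx_tc !mulr0 subrr. Qed.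

Lemma Om_Xf k l p : p != 0 -> Om k l Xf p = 0.
Proof. by move=> p0; rewrite /Om !dx_Xf//; ring. Qed.

Lemma Om_rf k l p : p != 0 -> Om k l rf p = 0.
Proof.
by move=> p0; rewrite (drv_rf (is_der_Om k l) p0) Om_Xf// Om_tc//; ring.
Qed.

Lemma Om_psi k l p : p != 0 -> Om k l psi p = 0.
Proof.
by move=> p0; rewrite (drv_mul (is_der_Om k l) sm_Xf sm_rf p0) Om_Xf// Om_rf//; ring.
Qed.

Lemma Om_sg k l p : p != 0 -> Om k l sg p = 0.
Proof.
move=> p0; have s2 : sm (fun q : V => 2 * tc q) by exact: sm_mul (sm_cst 2) sm_tc.
rewrite (drv_mul (is_der_Om k l) s2 sm_rf p0) (drv_scale (is_der_Om k l) 2 sm_tc p0).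
by rewrite Om_tc// Om_rf//; ring.
Qed.

Lemma dx_rf i p : p != 0 -> dX i rf p = - (2 * rf p ^+ 3 * Xf p * xc i p).
Proof. by move=> p0; rewrite (drv_rf (is_der_dX i) p0) dx_Xf// dx_tc; ring. Qed.

Lemma dt_rf p : p != 0 -> dT rf p = - (4 * rf p ^+ 3 * tc p).
Proof. by move=> p0; rewrite (drv_rf is_der_dT p0) dt_Xf// dt_tc; ring. Qed.

(** n + 2 is the divergence of Z, that is, the homogeneous dimension. *)
Lemma intg_Zf f : tf f -> intg (fun p => Zf f p + (n + 2)%:R * f p) = 0.
Proof.
move=> tff; have s2 : sm (fun q : V => 2 * tc q) by exact: sm_mul (sm_cst 2) sm_tc.
rewrite -(intg_op (@sm_xc R n) s2 tff); congr intg.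
apply: tf_ext.
- apply: tf_add; first exact: (drv_tf is_der_Z).
  by apply: tf_mull => //; exact: sm_cst.
- apply: tf_add; first exact: (drv_tf is_der_Z).
  apply: tf_mull => //; apply: sm_add; last by apply: sm_dT.
  by apply: sm_sum => i; apply: sm_dX; exact: sm_xc.
move=> p p0; rewrite (drv_scale is_der_dT 2 sm_tc p0) dt_tc.
under eq_bigr do rewrite dx_xc eqxx.
by rewrite sumr_const card_ord /Zf natrD mulr1.
Qed.

(** In the divergence of Y the terms that differentiate r add up to (Yr) / r = 0, which leaves - 2 n
    r t = - n sg. *)
Lemma intg_Yf f : tf f -> intg (fun p => Yf f p - n%:R * sg p * f p) = 0.
Proof.
move=> tff.
rewrite -(intg_op (@sm_Yx) sm_Yt tff); congr intg.
apply: tf_ext.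
- apply: tf_add; first exact: (drv_tf is_der_Y).
  by apply: tf_opp; apply: tf_mull => //; apply: sm_mul; [exact: sm_cst|exact: sm_sg].
- apply: tf_add; first exact: (drv_tf is_der_Y).
  apply: tf_mull => //; apply: sm_add; last by apply: sm_dT; exact: sm_Yt.
  by apply: sm_sum => i; apply: sm_dX; exact: sm_Yx.
move=> p p0; rewrite -mulNr; congr (_ + _ * _).
rewrite (drv_mul is_der_dT sm_rf (sm_exp 2 sm_Xf) p0).
rewrite (drv_sqr is_der_dT sm_Xf p0) dt_Xf// dt_rf//.
have st : sm (fun q : V => rf q * tc q) by apply: sm_mul; [exact: sm_rf|exact: sm_tc].
have E i : dX i (fun q => - 2 * rf q * tc q * xc i q) p =
    (4 * rf p ^+ 3 * Xf p * tc p) * xc i p ^+ 2 - 2 * rf p * tc p.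
  have s2 : sm (fun q : V => -2 * rf q) by exact: sm_mul (sm_cst (-2)) sm_rf.
  rewrite (drv_mul (is_der_dX i) (sm_mul s2 sm_tc) (sm_xc i) p0).
  rewrite (drv_mul (is_der_dX i) s2 sm_tc p0).
  rewrite (drv_scale (is_der_dX i) (-2) sm_rf p0) dx_rf// dx_tc dx_xc eqxx mulr1.
  ring.
under eq_bigr do rewrite E.
rewrite sumrB -mulr_sumr sumr_const card_ord -/(Xf p) /sg -mulr_natl; ring.
Qed.

Lemma intg_Om k l f : tf f -> intg (Om k l f) = 0.
Proof.
move=> tff; have tk j : tf (fun p => xc j p * f p) by apply: tf_mull => //; exact: sm_xc.
transitivity (intg (fun p => dX l (fun q => xc k q * f q) p
    - dX k (fun q => xc l q * f q) p)).
  congr intg; apply: tf_ext.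
  - exact: (drv_tf (is_der_Om k l)).
  - by apply: tf_add; [|apply: tf_opp]; exact: tf_dX.
  move=> p p0; have sff := tf_sm tff.
  rewrite (drv_mul (is_der_dX l) (sm_xc k) sff p0).
  rewrite (drv_mul (is_der_dX k) (sm_xc l) sff p0) !dx_xc /Om (eq_sym l k); ring.
by rewrite intgB ?intg_dX ?subrr//; apply: tf_ig; exact: tf_dX.
Qed.

(** The working form of integration by parts: the difference of the integrands only has to be
    recognised, off the axis, as a function H of integral 0, in practice a divergence. *)
Lemma intg_eq F G H : (0 < n)%N -> tf F -> tf G -> tf H -> intg H = 0 ->
  (forall p, p != 0 -> p.1 != 0 -> F p - G p = H p) -> intg F = intg G.
Proof.
move=> n0 tF tG tH H0 E; apply/eqP; rewrite -subr_eq0; apply/eqP.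
rewrite -intgB; [|exact: tf_ig|exact: tf_ig]; rewrite -H0; congr intg.
apply: dense_eq => //; first by apply: tf_add => //; exact: tf_opp.
move=> p p1; apply: E => //; by apply: contraNneq p1 => ->.
Qed.

End vector_fields.

(** * Commutators of the vector fields and invariance of the forms *)

Section commutators.
Context {R : realType} {n : nat}.
Local Notation V := ('rV[R]_n * R)%type.
Implicit Types (f g u a b : V -> R) (p q v : V).

Lemma dX_dX i j u p : tf u -> dX i (dX j u) p = dX j (dX i u) p.
Proof. by move=> tfu; rewrite dXE; exact: tf_schwarz. Qed.

Lemma dX_dT i u p : tf u -> dX i (dT u) p = dT (dX i u) p.
Proof. by move=> tfu; rewrite dXE dTE; exact: tf_schwarz. Qed.

(** Derivations that commute with all partial derivatives; their commutator with a first-order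
    operator merely differentiates its coefficients. *)
Definition partial (T : (V -> R) -> V -> R) :=
  [/\ is_der T, forall i u p, tf u -> T (dX i u) p = dX i (T u) p
   & forall u p, tf u -> T (dT u) p = dT (T u) p].

Lemma partial_dX i : partial (dX i).
Proof.
split; [exact: is_der_dX|by move=> *; exact: dX_dX|by move=> *; exact: dX_dT].
Qed.

Lemma partial_dT : partial dT.
Proof. by split; [exact: is_der_dT|move=> *; rewrite dX_dT|]. Qed.

Lemma partial_op T (a : 'I_n -> V -> R) b u p : partial T ->
  (forall i, sm (a i)) -> sm b -> tf u -> p != 0 ->
  T (op a b u) p = op a b (T u) p
    + (\sum_i T (a i) p * dX i u p + T b p * dT u p).
Proof.
move=> [drT TX TT] sa sb tfu p0; have su := tf_sm tfu.
have sX i : sm (fun q => a i q * dX i u q) by apply: sm_mul => //; exact: sm_dX.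
have sT : sm (fun q => b q * dT u q) by apply: sm_mul => //; exact: sm_dT.
rewrite opEf (drv_add drT (sm_sum _ sX) sT p0) (drv_sum drT _ sX p0).
have E i : T (fun q => a i q * dX i u q) p =
    a i p * dX i (T u) p + T (a i) p * dX i u p.
  by rewrite (drv_mul drT (sa i) (sm_dX i su) p0) TX// addrC.
under eq_bigr do rewrite E.
rewrite big_split /= (drv_mul drT sb (sm_dT su) p0) TT// opE; ring.
Qed.

Lemma sm_2tc : sm (fun q : V => 2 * tc q).
Proof. by apply: sm_mul; [exact: sm_cst|exact: sm_tc]. Qed.

Lemma sum_delta i (F : 'I_n -> R) : \sum_j (i == j)%:R * F j = F i.
Proof.
rewrite (bigD1 i)//= eqxx mul1r big1 ?addr0// => j ji.
by rewrite eq_sym (negbTE ji) mul0r.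
Qed.

Lemma dX_Ef i u p : tf u -> p != 0 -> dX i (Ef u) p = Ef (dX i u) p + dX i u p.
Proof.
move=> tfu p0.
rewrite /Ef (partial_op (partial_dX i) (@sm_xc R n) (sm_cst 0) tfu p0).
under eq_bigr do rewrite dx_xc.
by rewrite sum_delta (drv_cst (is_der_dX i))// mul0r addr0.
Qed.

Lemma dX_Zf i u p : tf u -> p != 0 -> dX i (Zf u) p = Zf (dX i u) p + dX i u p.
Proof.
move=> tfu p0.
rewrite /Zf (partial_op (partial_dX i) (@sm_xc R n) sm_2tc tfu p0).
under eq_bigr do rewrite dx_xc.
by rewrite sum_delta (drv_scale (is_der_dX i) 2 sm_tc p0) dx_tc mulr0 mul0r addr0.
Qed.

Lemma dT_Zf u p : tf u -> p != 0 -> dT (Zf u) p = Zf (dT u) p + 2 * dT u p.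
Proof.
move=> tfu p0.
rewrite /Zf (partial_op partial_dT (@sm_xc R n) sm_2tc tfu p0).
rewrite big1 => [|i _]; last by rewrite dt_xc mul0r.
by rewrite add0r (drv_scale is_der_dT 2 sm_tc p0) dt_tc mulr1.
Qed.

(* the radial part, proportional to x_i, is killed by Gam and Om *)
Definition Yrest u p : R :=
  4 * tc p * rf p ^+ 3 * Xf p * Ef u p
  + (4 * rf p * Xf p - 2 * rf p ^+ 3 * Xf p ^+ 3) * dT u p.

Lemma dX_Yf i u p : tf u -> p != 0 -> dX i (Yf u) p =
  Yf (dX i u) p - 2 * rf p * tc p * dX i u p + xc i p * Yrest u p.
Proof.
move=> tfu p0.
rewrite /Yf (partial_op (partial_dX i) (@sm_Yx R n) sm_Yt tfu p0).
have s2 : sm (fun q : V => -2 * rf q) by apply: sm_mul; [exact: sm_cst|exact: sm_rf].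
have E j : dX i (fun q => - 2 * rf q * tc q * xc j q) p * dX j u p =
    (4 * tc p * rf p ^+ 3 * Xf p * xc i p) * (xc j p * dX j u p)
    + (i == j)%:R * (- 2 * rf p * tc p * dX j u p).
  rewrite (drv_mul (is_der_dX i) (sm_mul s2 sm_tc) (sm_xc j) p0).
  rewrite (drv_mul (is_der_dX i) s2 sm_tc p0).
  rewrite (drv_scale (is_der_dX i) (-2) sm_rf p0) dx_rf// dx_tc dx_xc.
  ring.
under eq_bigr do rewrite E.
rewrite big_split /= -mulr_sumr sum_delta -EfE.
rewrite (drv_mul (is_der_dX i) sm_rf (sm_exp 2 sm_Xf) p0).
rewrite (drv_sqr (is_der_dX i) sm_Xf p0) dx_Xf// dx_rf// /Yrest; ring.
Qed.

Lemma Om_dX k l m u p : tf u -> p != 0 -> dX m (Om k l u) p =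
  Om k l (dX m u) p + (m == k)%:R * dX l u p - (m == l)%:R * dX k u p.
Proof.
move=> tfu p0; have su := tf_sm tfu.
have s1 i j : sm (fun q => xc i q * dX j u q).
  by apply: sm_mul; [exact: sm_xc|exact: sm_dX].
rewrite (drv_sub (is_der_dX m) (s1 k l) (s1 l k) p0).
rewrite (drv_mul (is_der_dX m) (sm_xc k) (sm_dX l su) p0).
rewrite (drv_mul (is_der_dX m) (sm_xc l) (sm_dX k su) p0) !dx_xc.
by rewrite (dX_dX m l p tfu) (dX_dX m k p tfu) /Om; ring.
Qed.

Lemma Om_dT k l u p : tf u -> p != 0 -> dT (Om k l u) p = Om k l (dT u) p.
Proof.
move=> tfu p0; have su := tf_sm tfu.
have s1 i j : sm (fun q => xc i q * dX j u q).
  by apply: sm_mul; [exact: sm_xc|exact: sm_dX].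
rewrite (drv_sub is_der_dT (s1 k l) (s1 l k) p0).
rewrite (drv_mul is_der_dT (sm_xc k) (sm_dX l su) p0).
rewrite (drv_mul is_der_dT (sm_xc l) (sm_dX k su) p0) !dt_xc.
by rewrite /Om (dX_dT l p tfu) (dX_dT k p tfu); ring.
Qed.

Lemma Om_comm T k l u p : is_der T -> tf u -> p != 0 ->
  T (Om k l u) p = T (xc k) p * dX l u p - T (xc l) p * dX k u p
   + (xc k p * T (dX l u) p - xc l p * T (dX k u) p).
Proof.
move=> drT tfu p0; have su := tf_sm tfu.
have s1 i j : sm (fun q => xc i q * dX j u q).
  by apply: sm_mul; [exact: sm_xc|exact: sm_dX].
rewrite (drv_sub drT (s1 k l) (s1 l k) p0).
rewrite (drv_mul drT (sm_xc k) (sm_dX l su) p0).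
by rewrite (drv_mul drT (sm_xc l) (sm_dX k su) p0); ring.
Qed.

Lemma Om_Ef k l u p : tf u -> p != 0 -> Om k l (Ef u) p = Ef (Om k l u) p.
Proof.
move=> tfu p0; rewrite (Om_comm k l is_der_E tfu p0) !Ef_xc// [LHS]/Om !dX_Ef//; ring.
Qed.

Lemma Om_Zf k l u p : tf u -> p != 0 -> Om k l (Zf u) p = Zf (Om k l u) p.
Proof.
move=> tfu p0; rewrite (Om_comm k l is_der_Z tfu p0) !Zf_xc// [LHS]/Om !dX_Zf//; ring.
Qed.

Lemma drv_Sf T a b p : is_der T -> tf a -> tf b -> p != 0 ->
  T (Sf a b) p = \sum_i (T (dX i a) p * dX i b p + dX i a p * T (dX i b) p).
Proof.
move=> drT ta tb p0.
have sa i := sm_dX i (tf_sm ta); have sb i := sm_dX i (tf_sm tb).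
rewrite (drv_sum drT _ _ p0); last by move=> i; exact: sm_mul.
by apply: eq_bigr => i _; rewrite (drv_mul drT (sa i) (sb i) p0).
Qed.

Lemma sm_Sf a b : sm a -> sm b -> sm (Sf a b).
Proof. by move=> sa sb; apply: sm_sum => i; apply: sm_mul; exact: sm_dX. Qed.

(** Rotations preserve the Euclidean form: the corrections coming from [Om_dX] cancel in the sum
    over the coordinates. *)
Lemma Om_Sf k l a b p : tf a -> tf b -> p != 0 ->
  Om k l (Sf a b) p = Sf (Om k l a) b p + Sf a (Om k l b) p.
Proof.
move=> ta tb p0; rewrite (drv_Sf (is_der_Om k l) ta tb p0).
rewrite /Sf -big_split /=.
pose c m := (m == k)%:R * (dX l a p * dX k b p - dX l a p * dX k b p).
have E m : dX m (Om k l a) p * dX m b p + dX m a p * dX m (Om k l b) p =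
   Om k l (dX m a) p * dX m b p + dX m a p * Om k l (dX m b) p
   + ((k == m)%:R * (dX l a p * dX m b p + dX m a p * dX l b p)
     - (l == m)%:R * (dX k a p * dX m b p + dX m a p * dX k b p)).
  by rewrite !Om_dX// (eq_sym m k) (eq_sym m l); ring.
under [in RHS]eq_bigr do rewrite E.
by rewrite [RHS]big_split /= sumrB !sum_delta; ring.
Qed.

Lemma Zf_Sf a b p : tf a -> tf b -> p != 0 ->
  Zf (Sf a b) p = Sf (Zf a) b p + Sf a (Zf b) p - 2 * Sf a b p.
Proof.
move=> ta tb p0; rewrite (drv_Sf is_der_Z ta tb p0).
rewrite /Sf -big_split /= mulr_sumr -sumrB; apply: eq_bigr => i _.
by rewrite !dX_Zf//; ring.
Qed.

Lemma Om_Gam k l a b p : tf a -> tf b -> p != 0 ->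
  Om k l (Gam a b) p = Gam (Om k l a) b p + Gam a (Om k l b) p.
Proof.
move=> ta tb p0; have sa := tf_sm ta; have sb := tf_sm tb.
have sS := sm_Sf sa sb; have dO := @is_der_Om R n k l.
have sEa := drv_sm is_der_E sa; have sEb := drv_sm is_der_E sb.
rewrite (drv_eq dO (g := fun q => Xf q * Sf a b q - Ef a q * Ef b q)) => // [|q q0];
  last exact: GamE.
rewrite (drv_sub dO (sm_mul sm_Xf sS) (sm_mul sEa sEb) p0).
rewrite (drv_mul dO sm_Xf sS p0) (drv_mul dO sEa sEb p0).
by rewrite Om_Xf// Om_Sf// !Om_Ef// !GamE; ring.
Qed.

Lemma Om_Df k l a b p : tf a -> tf b -> p != 0 ->
  Om k l (Df a b) p = Df (Om k l a) b p + Df a (Om k l b) p.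
Proof.
move=> ta tb p0; have sa := tf_sm ta; have sb := tf_sm tb.
have sS := sm_Sf sa sb; have dO := @is_der_Om R n k l.
have sZa := drv_sm is_der_Z sa; have sZb := drv_sm is_der_Z sb.
have sTa := sm_dT sa; have sTb := sm_dT sb.
have sNr : sm (fun q : V => Nf q * rf q) by apply: sm_mul; [exact: sm_Nf|exact: sm_rf].
have sTT := sm_mul sTa sTb; have sXT := sm_mul (@sm_Xf R n) sTT.
have sSX := sm_add sS sXT; have sZZ := sm_mul sZa sZb.
rewrite (drv_eq dO (g := fun q => Nf q * rf q * (Sf a b q + Xf q * (dT a q * dT b q))
   - psi q * (Zf a q * Zf b q))) => // [|q q0]; last exact: DfE.
rewrite (drv_sub dO (sm_mul sNr sSX) (sm_mul sm_psi sZZ) p0).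
rewrite (drv_mul dO sNr sSX p0) (drv_mul dO sm_Nf sm_rf p0).
rewrite (drv_add dO sS sXT p0) (drv_mul dO sm_Xf sTT p0).
rewrite (drv_mul dO sTa sTb p0) (drv_mul dO sm_psi sZZ p0).
rewrite (drv_mul dO sZa sZb p0) (drv_Nf dO p0).
rewrite Om_Xf// Om_tc// Om_rf// Om_psi// Om_Sf// !Om_Zf// -!Om_dT// !DfE; ring.
Qed.

(** Invariance under dilations: the degrees of the coefficients of [Df] balance those of the
    derivatives. *)
Lemma Zf_Df a b p : tf a -> tf b -> p != 0 ->
  Zf (Df a b) p = Df (Zf a) b p + Df a (Zf b) p.
Proof.
move=> ta tb p0; have sa := tf_sm ta; have sb := tf_sm tb.
have sS := sm_Sf sa sb; have dO := @is_der_Z R n.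
have sZa := drv_sm is_der_Z sa; have sZb := drv_sm is_der_Z sb.
have sTa := sm_dT sa; have sTb := sm_dT sb.
have sNr : sm (fun q : V => Nf q * rf q) by apply: sm_mul; [exact: sm_Nf|exact: sm_rf].
have sTT := sm_mul sTa sTb; have sXT := sm_mul (@sm_Xf R n) sTT.
have sSX := sm_add sS sXT; have sZZ := sm_mul sZa sZb.
rewrite (drv_eq dO (g := fun q => Nf q * rf q * (Sf a b q + Xf q * (dT a q * dT b q))
   - psi q * (Zf a q * Zf b q))) => // [|q q0]; last exact: DfE.
rewrite (drv_sub dO (sm_mul sNr sSX) (sm_mul sm_psi sZZ) p0).
rewrite (drv_mul dO sNr sSX p0) (drv_mul dO sm_Nf sm_rf p0).
rewrite (drv_add dO sS sXT p0) (drv_mul dO sm_Xf sTT p0).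
rewrite (drv_mul dO sTa sTb p0) (drv_mul dO sm_psi sZZ p0).
rewrite (drv_mul dO sZa sZb p0) (drv_Nf dO p0).
rewrite Zf_Xf// Zf_tc// Zf_rf// Zf_psi// Zf_Sf// !DfE !dT_Zf// /Nf; ring.
Qed.

(** Invariance of [Gam] under Y: the factor - 2 sg in Y X is balanced by the term - sg in the
    commutator of each x-derivative with Y, and [Yrest], which multiplies x_i, cancels between the
    two terms of [Gam]. *)
Lemma Yf_Gam u p : tf u -> p != 0 -> Yf (Gam u u) p = 2 * Gam u (Yf u) p.
Proof.
move=> tfu p0; have su := tf_sm tfu; have dO := @is_der_Y R n.
have sS := sm_Sf su su; have sE := drv_sm is_der_E su.
rewrite (drv_eq dO (g := fun q => Xf q * Sf u u q - Ef u q * Ef u q)) => // [|q q0];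
  last exact: GamE.
rewrite (drv_sub dO (sm_mul sm_Xf sS) (sm_mul sE sE) p0).
rewrite (drv_mul dO sm_Xf sS p0) (drv_mul dO sE sE p0) Yf_Xf// (drv_Sf dO tfu tfu p0).
have sxd i : sm (fun q => xc i q * dX i u q).
  by apply: sm_mul; [exact: sm_xc|exact: sm_dX].
pose A := \sum_i dX i u p * Yf (dX i u) p.
pose B := \sum_i xc i p * Yf (dX i u) p.
have YE : Yf (Ef u) p = - 2 * rf p * tc p * Ef u p + B.
  rewrite (drv_eq dO (g := fun q => \sum_i xc i q * dX i u q)) => // [|q q0];
    last exact: EfE.
  rewrite (drv_sum dO _ sxd p0) EfE mulr_sumr /B -big_split /=.
  apply: eq_bigr => i _.
  by rewrite (drv_mul dO (sm_xc i) (sm_dX i su) p0) Yf_xc// mulrA.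
have SY : Sf u (Yf u) p = A - 2 * rf p * tc p * Sf u u p + Ef u p * Yrest u p.
  rewrite /Sf EfE mulr_sumr mulr_suml /A -sumrB -big_split /=.
  by apply: eq_bigr => i _; rewrite dX_Yf//; ring.
have EY : Ef (Yf u) p = B - 2 * rf p * tc p * Ef u p + Xf p * Yrest u p.
  rewrite !EfE mulr_sumr mulr_suml /B -sumrB -big_split /=.
  by apply: eq_bigr => i _; rewrite dX_Yf//; ring.
rewrite (eq_bigr (fun i => 2 * (dX i u p * Yf (dX i u) p))); last by move=> i _; ring.
rewrite -mulr_sumr -/A YE GamE SY EY /sg; ring.
Qed.

End commutators.

Ltac smt :=
  lazymatch goal with
  | |- sm (fun p => @?f p + @?g p) => apply: (@sm_add _ _ f g); smt
  | |- sm (fun p => - @?f p) => apply: (@sm_opp _ _ f); smt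
  | |- sm (fun p => @?f p * @?g p) => apply: (@sm_mul _ _ f g); smt
  | |- sm (fun p => @?f p ^+ ?k) => apply: (@sm_exp _ _ f k); smt
  | |- sm (fun _ => ?c) => exact: sm_cst
  | |- sm (fun p => ?h p) => change (sm h); smt
  | |- sm (dX _ _) => apply: sm_dX; smt
  | |- sm (dT _) => apply: sm_dT; smt
  | |- sm (Ef _) => apply: (drv_sm is_der_E); smt
  | |- sm (Zf _) => apply: (drv_sm is_der_Z); smt
  | |- sm (Yf _) => apply: (drv_sm is_der_Y); smt
  | |- sm (Om _ _ _) => apply: (drv_sm (is_der_Om _ _)); smt
  | |- sm (Gam _ _) => apply: (drv_sm (is_der_Gam _)); smt
  | |- sm (Df _ _) => apply: (drv_sm (is_der_Df _)); smt
  | |- sm (xc _) => exact: sm_xc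
  | |- sm tc => exact: sm_tc
  | |- sm Xf => exact: sm_Xf
  | |- sm Nf => exact: sm_Nf
  | |- sm rf => exact: sm_rf
  | |- sm psi => exact: sm_psi
  | |- sm sg => exact: sm_sg
  | H : sm ?f |- sm ?f => exact: H
  | H : tf ?f |- sm ?f => exact: tf_sm H
  end.

Ltac tft :=
  lazymatch goal with
  | |- tf (fun p => @?f p + @?g p) => apply: (@tf_add _ _ f g); tft
  | |- tf (fun p => - @?f p) => apply: (@tf_opp _ _ f); tft
  | |- tf (fun p => @?f p * @?g p) =>
      first [ apply: (@tf_mulr _ _ f g); [tft|smt]
            | apply: (@tf_mull _ _ f g); [smt|tft] ]
  | |- tf (fun p => @?f p ^+ 2) => apply: (@tf_exp _ _ f 1); tft
  | |- tf (fun p => ?h p) => change (tf h); tft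
  | |- tf (dX _ _) => apply: tf_dX; tft
  | |- tf (dT _) => apply: tf_dT; tft
  | |- tf (Ef _) => apply: (drv_tf is_der_E); tft
  | |- tf (Zf _) => apply: (drv_tf is_der_Z); tft
  | |- tf (Yf _) => apply: (drv_tf is_der_Y); tft
  | |- tf (Om _ _ _) => apply: (drv_tf (is_der_Om _ _)); tft
  | |- tf (Gam _ _) => apply: (drv_tf (is_der_Gam _)); [smt|tft]
  | |- tf (Df _ _) => apply: (drv_tf (is_der_Df _)); [smt|tft]
  | H : tf ?f |- tf ?f => exact: H
  end.

(** * Reduction to the gap inequality *)

Section core.
Context {R : realType} {n : nat}.
Local Notation V := ('rV[R]_n * R)%type.
Implicit Types (f g h u a b F : V -> R) (p q v : V).

(** Half the sum of the squares of the rotation derivatives of a + c b, for a number c. The claim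
    being pointwise, the value at p of any function may be used for c without being
    differentiated. *)
Lemma Gam_psd a b p (c : R) :
  0 <= Gam a a p + 2 * c * Gam a b p + c ^+ 2 * Gam b b p.
Proof.
rewrite -(@pmulr_rge0 _ 2)//.
rewrite [leRHS](_ : _ = 2 * Gam a a p + 2 * c * (2 * Gam a b p)
   + c ^+ 2 * (2 * Gam b b p)); last by ring.
rewrite -!sum_Om !mulr_sumr -!big_split /=; apply: sumr_ge0 => k _.
rewrite !mulr_sumr -!big_split /=; apply: sumr_ge0 => l _.
rewrite [leRHS](_ : _ = (Om k l a p + c * Om k l b p) ^+ 2); last by ring.
exact: sqr_ge0.
Qed.

Lemma Gam_ge0 a p : 0 <= Gam a a p.
Proof. by have := Gam_psd a a p 0; rewrite expr0n/= !(mulr0, mul0r, addr0). Qed.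

(** Off the axis this follows from [psi_Df]. On the axis psi = 0 and that identity is void, but
    there the form reduces to a multiple of the Euclidean one in x. *)
Lemma Df_psd a b p (c : R) : p != 0 ->
  0 <= Df a a p + 2 * c * Df a b p + c ^+ 2 * Df b b p.
Proof.
move=> p0; have [p1|p1] := eqVneq p.1 0; last first.
  rewrite -(pmulr_rge0 _ (psi_gt0 p1)).
  rewrite [leRHS](_ : _ = psi p * Df a a p + 2 * c * (psi p * Df a b p)
     + c ^+ 2 * (psi p * Df b b p)); last by ring.
  rewrite !psi_Df//.
  rewrite [leRHS](_ : _ = (Yf a p + c * Yf b p) ^+ 2
    + (Gam a a p + 2 * c * Gam a b p + c ^+ 2 * Gam b b p)); last by ring.
  by rewrite addr_ge0 ?sqr_ge0 ?Gam_psd.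
have X0 : Xf p = 0 by apply/eqP; rewrite Xf_eq0 p1.
rewrite !DfE /psi X0 !mul0r !subr0 !addr0.
have Nr : 0 <= Nf p * rf p by rewrite mulr_ge0 ?ltW ?Nf_gt0 ?rf_gt0.
rewrite [leRHS](_ : _ = Nf p * rf p * (Sf a a p + 2 * c * Sf a b p + c ^+ 2 * Sf b b p));
  last by ring.
rewrite mulr_ge0// /Sf !mulr_sumr -!big_split /=; apply: sumr_ge0 => i _.
rewrite [leRHS](_ : _ = (dX i a p + c * dX i b p) ^+ 2); last by ring.
exact: sqr_ge0.
Qed.

Lemma Df_ge0 a p : p != 0 -> 0 <= Df a a p.
Proof. by move=> /(Df_psd a a 0); rewrite expr0n/= !(mulr0, mul0r, addr0). Qed.

Definition Lf u p : R := \sum_i dX i (dX i u) p + Xf p * dT (dT u) p.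

Lemma tf_Lf u : tf u -> tf (Lf u).
Proof.
move=> tfu; apply: (@tf_add _ _ (fun p => \sum_i dX i (dX i u) p)
  (fun p => Xf p * dT (dT u) p)); last by tft.
by apply: tf_sum => i; tft.
Qed.

Lemma grad_Df a b p : p != 0 ->
  Sf a b p + Xf p * (dT a p * dT b p) = rf p * (psi p * (Zf a p * Zf b p) + Df a b p).
Proof.
move=> p0; rewrite DfE.
transitivity ((rf p ^+ 2 * Nf p) * (Sf a b p + Xf p * (dT a p * dT b p))).
  by rewrite rfN// mul1r.
ring.
Qed.

Lemma tf_Sf a b : tf a -> tf b -> tf (Sf a b).
Proof. by move=> ta tb; apply: tf_sum => i; tft. Qed.

Lemma intg_div u g : tf u -> tf g ->
  intg (fun p => Lf u p * g p + (Sf u g p + Xf p * (dT u p * dT g p))) = 0.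
Proof.
move=> tfu tfg; have su := tf_sm tfu; have sg' := tf_sm tfg.
have ti i : tf (fun p => dX i u p * g p) by tft.
have tt : tf (fun p => Xf p * (dT u p * g p)) by tft.
transitivity (intg (fun p => \sum_i dX i (fun q => dX i u q * g q) p
   + dT (fun q => Xf q * (dT u q * g q)) p)).
  congr intg; apply: tf_ext.
  - have := tf_Lf tfu; have := tf_Sf tfu tfg => t1 t2.
    apply: tf_add; first by tft.
    by apply: tf_add; [exact: t1|tft].
  - by apply: tf_add; [apply: tf_sum => i|]; tft.
  move=> p p0.
  have s1 : sm (fun q => dT u q * g q) by smt.
  have s2 := sm_dT su.
  rewrite (drv_mul is_der_dT sm_Xf s1 p0) dt_Xf// mul0r add0r.
  rewrite (drv_mul is_der_dT s2 sg' p0).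
  under [in RHS]eq_bigr => i _ do rewrite (drv_mul (is_der_dX i) (sm_dX i su) sg' p0).
  by rewrite big_split /= -mulr_suml /Lf /Sf; ring.
rewrite intgD; [|by apply: tf_ig; apply: tf_sum => i; tft|by apply: tf_ig; tft].
rewrite intg_dT// addr0 intg_sum; last by move=> i; tft.
by apply: big1 => i _; exact: intg_dX.
Qed.

(** The radial part of L_G is r psi [Rf]; functions homogeneous of degree d are multiplied by d (d +
    n). *)
Definition Rf u p : R := Zf (Zf u) p + n%:R * Zf u p.

Lemma tf_Rf u : tf u -> tf (Rf u).
Proof. by move=> tfu; change (tf (fun p => Zf (Zf u) p + n%:R * Zf u p)); tft. Qed.

Context (n0 : (0 < n)%N).

(** Weak polar form of L_G: the energy splits by [grad_Df], and the divergence formula for Z moves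
    the derivative Zh onto u. *)
Lemma green u h : tf u -> tf h ->
  intg (fun p => Lf u p * (rf p * h p)) =
  intg (fun p => rf p ^+ 2 * (psi p * Rf u p * h p - Df u h p)).
Proof.
move=> tfu tfh; have su := tf_sm tfu; have sh := tf_sm tfh.
have tg : tf (fun p => rf p * h p) by tft.
have tL := tf_Lf tfu; have tR := tf_Rf tfu.
have tS := tf_Sf tfu tg.
pose g p := rf p * h p.
pose H1 p := Lf u p * g p + (Sf u g p + Xf p * (dT u p * dT g p)).
pose f p := rf p ^+ 2 * (psi p * (Zf u p * h p)).
pose H2 p := Zf f p + (n + 2)%:R * f p.
have tf2 : tf f by rewrite /f; tft.
have tH1 : tf H1.
  apply: tf_add; first by rewrite /g; tft.
  by apply: tf_add; [exact: tS|rewrite /g; tft].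
have tH2 : tf H2 by rewrite /H2; tft.
have sr2 : sm (fun q : V => rf q ^+ 2) by smt.
have szh : sm (fun q => Zf u q * h q) by smt.
have spz : sm (fun q => psi q * (Zf u q * h q)) by smt.
have szu := drv_sm is_der_Z su.
apply: (@intg_eq _ _ _ _ (fun p => H1 p - H2 p)) => //; try by tft.
  by rewrite intgB ?intg_div ?intg_Zf ?subrr//; exact: tf_ig.
move=> p p0 p1.
rewrite /H1 /H2 {2}/f.
rewrite (drv_mul is_der_Z sr2 spz p0) (drv_sqr is_der_Z sm_rf p0).
rewrite (drv_mul is_der_Z sm_psi szh p0) (drv_mul is_der_Z szu sh p0).
rewrite Zf_psi// Zf_rf//.
have -> : Sf u g p + Xf p * (dT u p * dT g p) =
   rf p * (rf p * (psi p * (Zf u p * Zf h p) + Df u h p))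
   - 2 * rf p ^+ 2 * psi p * Zf u p * h p.
  rewrite -grad_Df// (drv_mul is_der_dT sm_rf sh p0) dt_rf//.
  rewrite /Sf.
  under eq_bigr => i _ do rewrite (drv_mul (is_der_dX i) sm_rf sh p0) dx_rf//.
  have E i : dX i u p * (- (2 * rf p ^+ 3 * Xf p * xc i p) * h p + rf p * dX i h p) =
    rf p * (dX i u p * dX i h p) - (2 * rf p ^+ 3 * Xf p * h p) * (xc i p * dX i u p).
    by ring.
  under eq_bigr do rewrite E.
  by rewrite sumrB -!mulr_sumr -EfE ZfE /psi; ring.
rewrite /Rf /g /f natrD; ring.
Qed.

(** For h = R - F one has 2 R h - h^2 = R^2 - F^2, so no mixed term psi R F survives. *)
Lemma square_expand u F : tf u -> tf F ->
  let h := fun p => Rf u p - F p in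
  intg (fun p => 2 * (Lf u p * (rf p * h p)) - psi p * (rf p * h p) ^+ 2) =
  intg (fun p => rf p ^+ 2 * (psi p * Rf u p ^+ 2 - 2 * Df u (Rf u) p
                              + (2 * Df u F p - psi p * F p ^+ 2))).
Proof.
move=> tfu tfF h; have tR := tf_Rf tfu; have tL := tf_Lf tfu.
have th : tf h by rewrite /h; tft.
have E : intg (fun p => 2 * (Lf u p * (rf p * h p)) - psi p * (rf p * h p) ^+ 2) =
   2 * intg (fun p => Lf u p * (rf p * h p)) - intg (fun p => psi p * (rf p * h p) ^+ 2).
  by rewrite -intgZ ?intgB//; apply: tf_ig; tft.
rewrite E (green tfu th) -intgZ; last by apply: tf_ig; tft.
rewrite -intgB; [|by apply: tf_ig; tft|by apply: tf_ig; tft].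
congr intg; apply: tf_ext; try by tft.
move=> p p0; rewrite (drv_sub (is_der_Df (tf_sm tfu)) (tf_sm tR) (tf_sm tfF) p0) /h.
ring.
Qed.

(* the difference of the two integrands is that of the gap, plus the squares
   psi (Zv + g v)^2, D(v, v) and D(v + g u, v + g u) for v = Zu, plus the
   divergence Z f + (n+2) f *)
Lemma core_ineq u F g : tf u -> tf F -> sm g ->
  let om := fun p => 2 * n%:R - g p ^+ 2 + (n%:R - 2) * g p + Zf g p in
  0 <= intg (fun p => rf p ^+ 2 * (2 * Df u F p - psi p * F p ^+ 2 - 4 * Df u u p)) ->
  intg (fun p => rf p ^+ 2 * om p * (psi p * Zf u p ^+ 2 + Df u u p)) <=
  intg (fun p => rf p ^+ 2 * (psi p * Rf u p ^+ 2 - 2 * Df u (Rf u) p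
                              + (2 * Df u F p - psi p * F p ^+ 2))).
Proof.
move=> tfu tfF sg' om gap; have tR := tf_Rf tfu.
have su := tf_sm tfu.
(* The factor n - g reduces the cross term 2n (Zu)(Z^2 u) of psi R^2 to 2g (Zu)(Z^2 u); the factor 2
   + g changes the coefficient of D(u, Zu) from -2n to -2n + 2(n - 2) + 2(2 + g) = 2g. Both are the
   cross terms of the squares to be completed. *)
pose f1 p := rf p ^+ 2 * (psi p * ((n%:R - g p) * Zf u p ^+ 2)).
pose f2 p := rf p ^+ 2 * (2 * Df u (Zf u) p + (2 + g p) * Df u u p).
pose f p := f1 p - f2 p.
have tff1 : tf f1 by rewrite /f1; tft.
have tff2 : tf f2 by rewrite /f2; tft.
have tff : tf f by rewrite /f; tft.
have som : sm om by rewrite /om; smt.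
set J := (X in _ <= intg X); set W := (X in intg X <= _).
set G := (X in 0 <= intg X) in gap.
have tJ : tf J by rewrite /J; tft.
have tW : tf W by rewrite /W; tft.
have tG : tf G by rewrite /G; tft.
pose H p := Zf f p + (n + 2)%:R * f p.
have tH : tf H by rewrite /H; tft.
rewrite -subr_ge0 -intgB; [|exact: tf_ig|exact: tf_ig].
apply: (le_trans gap).
have -> : intg G = intg (fun p => G p + H p).
  by rewrite intgD ?intg_Zf ?addr0//; exact: tf_ig.
apply: le_intg; [by apply: tf_ig; tft|by apply: tf_ig; tft|].
move=> p; have [->|p0] := eqVneq p 0.
  by rewrite (tf0 tJ) (tf0 tW) (tf0 tG) (tf0 tH) !subr0 addr0.
have tv : tf (Zf u) by tft.
have sv := tf_sm tv; have szv := drv_sm is_der_Z sv.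
have D1 := Df_ge0 (Zf u) p0.
have D2 := Df_psd (Zf u) u (g p) p0.
have P0 := psi_ge0 p.
have S0 := sqr_ge0 (Zf (Zf u) p + g p * Zf u p).
have r2 : 0 <= rf p ^+ 2 by exact: sqr_ge0.
have HE : H p = rf p ^+ 2 * (psi p * (2 * (n%:R - g p) * Zf u p * Zf (Zf u) p
    + Zf u p ^+ 2 * ((n%:R - 2) * (n%:R - g p) - Zf g p))
   - (2 * Df (Zf u) (Zf u) p + 2 * Df u (Zf (Zf u)) p + 2 * (n%:R - 2) * Df u (Zf u) p
      + (2 + g p) * (2 * Df u (Zf u) p + (n%:R - 2) * Df u u p) + Zf g p * Df u u p)).
  have dZ := @is_der_Z R n.
  have sng : sm (fun q => n%:R - g q) by smt.
  have sv2 : sm (fun q => Zf u q ^+ 2) by smt.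
  have sA : sm (fun q => (n%:R - g q) * Zf u q ^+ 2) by smt.
  have sB : sm (fun q => psi q * ((n%:R - g q) * Zf u q ^+ 2)) by smt.
  have sr2 : sm (fun q : V => rf q ^+ 2) by smt.
  have sDv : sm (Df u (Zf u)) by smt.
  have sDu : sm (Df u u) by smt.
  have s2D : sm (fun q => 2 * Df u (Zf u) q) by smt.
  have s2g : sm (fun q => 2 + g q) by smt.
  have sgD : sm (fun q => (2 + g q) * Df u u q) by smt.
  have sC : sm (fun q => 2 * Df u (Zf u) q + (2 + g q) * Df u u q) by smt.
  rewrite /H /f (drv_sub dZ (tf_sm tff1) (tf_sm tff2) p0) /f1 /f2.
  rewrite (drv_mul dZ sr2 sB p0) (drv_mul dZ sm_psi sA p0) (drv_mul dZ sng sv2 p0).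
  rewrite (drv_sub dZ (sm_cst n%:R) sg' p0) (drv_cst dZ _ p0) (drv_sqr dZ sv p0).
  rewrite (drv_mul dZ sr2 sC p0) (drv_add dZ s2D sgD p0) (drv_scale dZ 2 sDv p0).
  rewrite (drv_mul dZ s2g sDu p0) (drv_add dZ (sm_cst 2) sg' p0) (drv_cst dZ _ p0).
  rewrite (drv_sqr dZ sm_rf p0) Zf_psi// Zf_rf//.
  rewrite (Zf_Df tfu tv p0) (Zf_Df tfu tfu p0) (Df_sym (Zf u) u) natrD; ring.
rewrite HE /J /W /G /om.
have -> : Df u (Rf u) p = Df u (Zf (Zf u)) p + n%:R * Df u (Zf u) p.
  have snz : sm (fun q => n%:R * Zf u q) by smt.
  rewrite /Rf (drv_add (is_der_Df su) szv snz p0).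
  by rewrite (drv_scale (is_der_Df su) _ sv p0).
rewrite (Df_sym (Zf u) u) in D2.
rewrite -subr_ge0 [leRHS](_ : _ = rf p ^+ 2 * (psi p * (Zf (Zf u) p + g p * Zf u p) ^+ 2
  + Df (Zf u) (Zf u) p
  + (Df (Zf u) (Zf u) p + 2 * g p * Df u (Zf u) p + g p ^+ 2 * Df u u p))).
  by apply: mulr_ge0 => //; apply: addr_ge0 => //; apply: addr_ge0 => //; exact: mulr_ge0.
rewrite /Rf; ring.
Qed.

End core.

(** * The gap for odd functions *)

Section ground_state.
Context {R : realType} {n : nat}.
Local Notation V := ('rV[R]_n * R)%type.
Implicit Types (f g h u v a b F : V -> R) (p q : V) (i j : 'I_n).

Lemma cvg0_invS (a : nat -> R) (K : R) :
  (forall k, `|a k| <= K * k.+1%:R^-1) -> a @ \oo --> (0 : R).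
Proof.
move=> aK; apply/cvgrPdist_lt => e e0.
have K1 : 0 < 1 + `|K| by rewrite ltr_pwDl.
have d0 : 0 < e / (1 + `|K|) by rewrite divr_gt0.
near=> k; rewrite sub0r normrN.
have hk : (k.+1%:R^-1 : R) < e / (1 + `|K|).
  by near: k; exact: near_infty_natSinv_lt (PosNum d0).
rewrite ltr_pdivlMr// in hk; apply: le_lt_trans hk; apply: (le_trans (aK k)).
rewrite mulrC; apply: ler_wpM2l; first by rewrite invr_ge0.
by rewrite (le_trans (ler_norm _))// lerDr.
Unshelve. all: by end_near. Qed.

Lemma ge0_err (A : R) (b : nat -> R) : b @ \oo --> (0 : R) ->
  (forall k, 0 <= A + b k) -> 0 <= A.
Proof.
move=> /cvgrPdist_lt b0 H; rewrite leNgt; apply/negP => A0.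
have nA : 0 < - A by rewrite oppr_gt0.
have [k /=] := filter_ex (b0 _ nA).
rewrite sub0r normrN => bk; have := H k; have := ler_norm (b k); lra.
Qed.

(* q = 1 / (x_i^2 + e) regularizes the ground state x_i, and x_i q its
   logarithmic gradient; s = 1 - x_i^2 q is the resulting error *)
Definition qf (e : R) (i : 'I_n) (p : V) : R := (xc i p ^+ 2 + e)^-1.
Definition sf (e : R) (i : 'I_n) (p : V) : R := 1 - xc i p ^+ 2 * qf e i p.

Section eps.
Context (e : R) (e0 : 0 < e) (i : 'I_n).

Lemma xe_gt0 (p : V) : 0 < xc i p ^+ 2 + e.
Proof. by rewrite ltr_pwDr// sqr_ge0. Qed.

Lemma qf_gt0 p : 0 < qf e i p.
Proof. by rewrite invr_gt0 xe_gt0. Qed.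

Lemma qfE p : (xc i p ^+ 2 + e) * qf e i p = 1.
Proof. by rewrite mulfV// gt_eqF// xe_gt0. Qed.

Lemma sfE p : sf e i p = e * qf e i p.
Proof. by rewrite /sf -[X in X - _](qfE p); ring. Qed.

Lemma sf_ge0 p : 0 <= sf e i p.
Proof. by rewrite sfE mulr_ge0// ltW// qf_gt0. Qed.

Lemma sf_le1 p : sf e i p <= 1.
Proof. by rewrite /sf gerBl mulr_ge0 ?sqr_ge0// ltW// qf_gt0. Qed.

Lemma xq_le1 p : xc i p ^+ 2 * qf e i p <= 1.
Proof. by have := sf_ge0 p; rewrite /sf; lra. Qed.

Lemma sm_qf : sm (qf e i).
Proof.
have s1 : sm (fun p : V => xc i p ^+ 2 + e) by smt.
apply: (sm_eq _ (sm_powR (-1) (fun p _ => xe_gt0 p) s1)) => p _.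
by rewrite powR_inv1// ltW// xe_gt0.
Qed.

Lemma sm_sf : sm (sf e i).
Proof. by have := sm_qf => sq; rewrite /sf; smt. Qed.

Lemma drv_qf T p : is_der T -> p != 0 ->
  T (qf e i) p = - (2 * xc i p * qf e i p ^+ 2 * T (xc i) p).
Proof.
move=> dT p0; have sq := sm_qf.
have s1 : sm (fun p : V => xc i p ^+ 2) by smt.
have s2 : sm (fun p : V => xc i p ^+ 2 + e) by smt.
have E : T (fun p => (xc i p ^+ 2 + e) * qf e i p) p = 0.
  by rewrite (drv_eq dT (g := fun=> 1) _ p0) ?(drv_cst dT)// => z _; exact: qfE.
rewrite (drv_mul dT s2 sq p0) (drv_add dT s1 (sm_cst e) p0) (drv_cst dT)// in E.
rewrite (drv_sqr dT (sm_xc i) p0) addr0 in E.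
move: E (qfE p) (xe_gt0 p).
move: (xc i p) (qf e i p) (T (xc i) p) (T (qf e i) p) => x q t Tq E qE x0.
have : (x ^+ 2 + e) * (Tq + 2 * x * q ^+ 2 * t) = 0.
  rewrite -[RHS]E mulrDr addrC; congr (_ + _).
  by transitivity (((x ^+ 2 + e) * q) * (2 * x * t * q)); [ring|rewrite qE mul1r].
move/eqP; rewrite mulf_eq0 gt_eqF//= addr_eq0 => /eqP ->; ring.
Qed.

End eps.

Local Notation eps := (fun k : nat => k.+1%:R^-1 : R).

Lemma eps_gt0 k : 0 < eps k. Proof. by rewrite /= invr_gt0. Qed.
Lemma eps_ge0 k : 0 <= eps k. Proof. exact/ltW/eps_gt0. Qed.

Lemma tf_support f : tf f -> exists M : R, forall p, f p != 0 -> `|p| <= M.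
Proof. by move=> [_ [a [M [_ H]]]]; exists M => p /H /andP[]. Qed.

(** s = e / (x_i^2 + e) stays in [0, 1] and tends to 0 except on the hyperplane x_i = 0, where [f]
    vanishes; dominated convergence applies. *)
Lemma lim_sf i f : tf f -> (forall p, xc i p = 0 -> f p = 0) ->
  (fun k => intg (fun p => f p * sf (eps k) i p)) @ \oo --> (0 : R).
Proof.
move=> tff f0; have [C [C0 fC]] := tf_bounded tff.
have [M fM] := tf_support tff.
rewrite -(@intg0 R n); apply: (@intg_dct R n _ (fun=> 0) C M).
- move=> k; apply: tf_measurable; have := sm_sf (eps_gt0 k) i => ss; tft.
- move=> k p; rewrite normrM (ger0_norm (sf_ge0 (eps_gt0 k) i p)).
  by apply: le_trans (fC p); rewrite ler_piMr// sf_le1// eps_gt0.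
- by move=> k p; rewrite mulf_eq0 negb_or => /andP[/fM].
- move=> p; have [x0|x0] := eqVneq (xc i p) 0.
    by apply: (@cvg0_invS _ 0) => k; rewrite f0// !mul0r normr0.
  apply: (@cvg0_invS _ (`|f p| * (xc i p ^+ 2)^-1)) => k.
  rewrite normrM (ger0_norm (sf_ge0 (eps_gt0 k) i p)) -mulrA ler_wpM2l//.
  rewrite sfE ?eps_gt0// mulrC ler_wpM2r ?eps_ge0// lef_pV2 ?posrE ?xe_gt0 ?eps_gt0//.
    by rewrite lerDl eps_ge0.
  by rewrite lt_def sqrf_eq0 x0 sqr_ge0.
Qed.

(* the cancellation u v = O(x_i^2) compensates the singularity of q *)
Lemma lim_qsf i u v : tf u -> tf v ->
  (forall p, u (refl i p) = - u p) -> (forall p, v (refl i p) = - v p) ->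
  (fun k => intg (fun p => u p * v p * (qf (eps k) i p * sf (eps k) i p))) @ \oo
    --> (0 : R).
Proof.
move=> tfu tfv uo vo.
have [B B0 uB] := odd_bound tfu uo; have [C C0 vC] := odd_bound tfv vo.
have [M uM] := tf_support tfu.
have uvB p : `|u p * v p| <= B * C * xc i p ^+ 2.
  rewrite normrM -[xc i p ^+ 2]real_normK ?num_real//.
  have := ler_pM (normr_ge0 _) (normr_ge0 _) (uB p) (vC p).
  by rewrite -/(xc i p) => H; apply: (le_trans H); rewrite expr2 mulrACA.
have qs0 k p : 0 <= qf (eps k) i p * sf (eps k) i p.
  by rewrite mulr_ge0 ?sf_ge0 ?ltW ?qf_gt0 ?eps_gt0.
rewrite -(@intg0 R n); apply: (@intg_dct R n _ (fun=> 0) (B * C) M).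
- move=> k; apply: tf_measurable.
  have := sm_sf (eps_gt0 k) i; have := sm_qf (eps_gt0 k) i => sq ss; tft.
- move=> k p; rewrite normrM (ger0_norm (qs0 k p)).
  apply: le_trans (ler_wpM2r (qs0 k p) (uvB p)) _.
  rewrite -[leRHS]mulr1 -[leLHS]mulrA; apply: ler_wpM2l; first exact: mulr_ge0.
  rewrite mulrA -[leRHS]mulr1; apply: ler_pM; rewrite ?sf_le1 ?xq_le1 ?sf_ge0 ?eps_gt0//.
  by rewrite mulr_ge0 ?sqr_ge0// ltW// qf_gt0// eps_gt0.
- by move=> k p; rewrite !mulf_eq0 !negb_or => /andP[/andP[/uM]].
- move=> p; have [x0|x0] := eqVneq (xc i p) 0.
    apply: (@cvg0_invS _ 0) => k.
    have : `|u p * v p| <= 0 by apply: (le_trans (uvB p)); rewrite x0 expr0n mulr0.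
    by rewrite normr_le0 => /eqP ->; rewrite !mul0r normr0.
  have x2 : 0 < xc i p ^+ 2 by rewrite lt_def sqrf_eq0 x0 sqr_ge0.
  apply: (@cvg0_invS _ (`|u p * v p| * (xc i p ^+ 2)^-1 ^+ 2)) => k.
  rewrite normrM (ger0_norm (qs0 k p)) -mulrA ler_wpM2l//.
  have qx : qf (eps k) i p <= (xc i p ^+ 2)^-1.
    by rewrite lef_pV2 ?posrE ?xe_gt0 ?eps_gt0// lerDl eps_ge0.
  have q0 := ltW (qf_gt0 (eps_gt0 k) i p).
  rewrite sfE ?eps_gt0// mulrCA mulrC ler_wpM2r ?eps_ge0//.
  by rewrite expr2; apply: ler_pM.
Qed.

Lemma xc_refl i j p : xc j (refl i p) = (if j == i then - xc j p else xc j p).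
Proof. by rewrite /xc /refl /xcoord /= mxE. Qed.

Lemma tc_refl i p : tc (refl i p) = tc p. Proof. by []. Qed.

Lemma Xf_refl i p : Xf (refl i p) = Xf p.
Proof.
by apply: eq_bigr => j _; rewrite xc_refl; case: ifP => // _; rewrite sqrrN.
Qed.

Lemma rf_refl i p : rf (refl i p) = rf p.
Proof. by rewrite !rfE /Nf Xf_refl tc_refl. Qed.

Lemma odd_vanish i u p : (forall p, u (refl i p) = - u p) -> xc i p = 0 -> u p = 0.
Proof.
move=> uo x0; have : refl i p = p.
  rewrite /refl /xcoord [RHS]surjective_pairing; congr pair.
  apply/rowP => j; rewrite !mxE; case: eqVneq => // ->.
  by move: x0; rewrite /xc => ->; rewrite oppr0.
by move=> e; have := uo p; rewrite e; lra.
Qed.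

(** x_i is homogeneous of degree 1 and killed by L_G, hence a tangential eigenfunction of eigenvalue
    n + 1. Formally, r^2 (D(u, u) - (n + 1) psi u^2) is a divergence plus r^2 x_i^2 D(u / x_i, u /
    x_i). Since 1 / x_i is only available as x_i q, two errors appear; the oddness of u makes them
    vanish in the limit. *)
Lemma odd_gap i u : tf u -> (forall p, u (refl i p) = - u p) ->
  0 <= intg (fun p => rf p ^+ 2 * (Df u u p - (n%:R + 1) * (psi p * u p ^+ 2))).
Proof.
move=> tfu uo; have su := tf_sm tfu.
pose F p := rf p ^+ 2 * (Df u u p - (n%:R + 1) * (psi p * u p ^+ 2)).
pose f p := rf p ^+ 3 * Xf p * u p ^+ 2.
pose v p := rf p * u p.
have tF : tf F by rewrite /F; tft.
have tff : tf f by rewrite /f; tft.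
have tfv : tf v by rewrite /v; tft.
have vo p : v (refl i p) = - v p by rewrite /v rf_refl uo mulrN.
have f0 p : xc i p = 0 -> f p = 0.
  by move=> x0; rewrite /f (odd_vanish uo x0) expr0n mulr0.
have L1 := lim_sf tff f0; have L2 := lim_qsf tfu tfv uo vo.
have L : (fun k => (n%:R + 1) * intg (fun p => f p * sf (eps k) i p)
   + intg (fun p => u p * v p * (qf (eps k) i p * sf (eps k) i p))) @ \oo --> (0 : R).
  rewrite -[X in _ --> X](addr0 0) -[X in _ --> X + _](mulr0 (n%:R + 1)).
  by apply: cvgD => //; apply: cvgMr.
apply: (ge0_err L) => k; have e0 := eps_gt0 k; set e := eps k.
have sq := sm_qf e0 i; have ss := sm_sf e0 i.
have tE1 : tf (fun p => f p * sf e i p) by tft.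
have tE2 : tf (fun p => u p * v p * (qf e i p * sf e i p)) by tft.
(* The field r^2 u^2 x_i q D(x_i, .) equals g times the i-th partial derivative minus h Z; H is its
   divergence. *)
pose g p := rf p * (xc i p * qf e i p * u p ^+ 2).
pose h p := rf p ^+ 3 * Xf p * (xc i p ^+ 2 * qf e i p * u p ^+ 2).
have tg : tf g by rewrite /g; tft.
have th : tf h by rewrite /h; tft.
pose H p := dX i g p - (Zf h p + (n + 2)%:R * h p).
have tH : tf H by rewrite /H; tft.
have H0 : intg H = 0.
  rewrite /H intgB ?intg_dX ?intg_Zf ?subrr//; apply: tf_ig; tft.
rewrite -/F -intgZ; last exact: tf_ig.
have -> : intg F = intg (fun p => F p - H p) by rewrite intgB ?H0 ?subr0//; exact: tf_ig.
rewrite -intgD; [|by apply: tf_ig; tft|by apply: tf_ig; tft].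
rewrite -intgD; [|by apply: tf_ig; tft|by apply: tf_ig; tft].
rewrite -[X in X <= _](@intg0 R n); apply: le_intg.
- by apply: tf_ig; exact: tf_cst0.
- by apply: tf_ig; tft.
move=> p; have [->|p0] := eqVneq p 0.
  by rewrite (tf0 tF) (tf0 tH) (tf0 tE1) (tf0 tE2) mulr0 subr0 !addr0.
have dZ := @is_der_Z R n; have dX' := @is_der_dX R n i.
have sr3 : sm (fun q : V => rf q ^+ 3) by smt.
have sr3X : sm (fun q : V => rf q ^+ 3 * Xf q) by smt.
have sxq : sm (fun q => xc i q * qf e i q) by smt.
have sx2q : sm (fun q => xc i q ^+ 2 * qf e i q) by smt.
have sx2 : sm (fun q : V => xc i q ^+ 2) by smt.
have su2 : sm (fun q => u q ^+ 2) by smt.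
have sxqu : sm (fun q => xc i q * qf e i q * u q ^+ 2) by smt.
have sx2qu : sm (fun q => xc i q ^+ 2 * qf e i q * u q ^+ 2) by smt.
have HE : H p = 2 * u p * xc i p * qf e i p * rf p * dX i u p
   - rf p ^+ 3 * Xf p * xc i p ^+ 2 * qf e i p * 2 * u p * Zf u p
   + u p ^+ 2 * (rf p * (qf e i p - 2 * xc i p ^+ 2 * qf e i p ^+ 2)
     - 2 * rf p ^+ 3 * Xf p * xc i p ^+ 2 * qf e i p
     - rf p ^+ 3 * Xf p * (n%:R * xc i p ^+ 2 * qf e i p
        - 2 * xc i p ^+ 4 * qf e i p ^+ 2)).
  have Zr3 : Zf (fun q : V => rf q ^+ 3) p = - 6 * rf p ^+ 3.
    rewrite (drv_eq dZ (g := fun q => rf q * rf q ^+ 2) _ p0); last by move=> z _; rewrite exprS.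
    rewrite (drv_mul dZ sm_rf (sm_exp 2 sm_rf) p0) (drv_sqr dZ sm_rf p0) Zf_rf//; ring.
  rewrite /H /g /h (drv_mul dX' sm_rf sxqu p0) (drv_mul dX' sxq su2 p0).
  rewrite (drv_mul dX' (sm_xc i) sq p0) (drv_sqr dX' su p0) (drv_qf e0 i dX' p0) dx_rf//.
  rewrite dx_xc eqxx (drv_mul dZ sr3X sx2qu p0) (drv_mul dZ sr3 sm_Xf p0) Zr3.
  rewrite Zf_Xf// (drv_mul dZ sx2q su2 p0) (drv_mul dZ sx2 sq p0).
  rewrite (drv_sqr dZ (sm_xc i) p0) (drv_qf e0 i dZ p0) Zf_xc// (drv_sqr dZ su p0) natrD.
  rewrite /=; ring.
(* With q = 1 / x_i^2 this would be x_i^2 D(u / x_i, u / x_i) at p. *)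
have pos := Df_psd u (xc i) (- (xc i p * qf e i p * u p)) p0.
have Sxu : Sf u (xc i) p = dX i u p.
  rewrite /Sf (eq_bigr (fun j => (i == j)%:R * dX j u p)) ?sum_delta// => j _.
  by rewrite dx_xc mulrC eq_sym.
have Sxx : Sf (xc i) (xc i) p = 1.
  rewrite /Sf (eq_bigr (fun j => (i == j)%:R * 1)) ?sum_delta// => j _.
  by rewrite dx_xc eq_sym; case: eqP => _; rewrite ?mulr1 ?mulr0.
have Dxu : Df u (xc i) p = Nf p * rf p * dX i u p - psi p * (Zf u p * xc i p).
  by rewrite DfE Sxu dt_xc Zf_xc// !mulr0 addr0.
have Dxx : Df (xc i) (xc i) p = Nf p * rf p - psi p * xc i p ^+ 2.
  by rewrite DfE Sxx dt_xc Zf_xc// !mulr0 addr0 mulr1 expr2.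
have r0 := rf_gt0 p0.
have rN3 : rf p ^+ 3 * Nf p = rf p.
  by transitivity (rf p * (rf p ^+ 2 * Nf p)); [ring|rewrite rfN// mulr1].
have s01 : sf e i p ^+ 2 <= sf e i p.
  by rewrite expr2 ler_piMr ?sf_le1 ?sf_ge0.
have c0 : 0 <= rf p ^+ 3 * Xf p * u p ^+ 2.
  by rewrite mulr_ge0 ?sqr_ge0// mulr_ge0 ?Xf_ge0// exprn_ge0// ltW.
have P1 := mulr_ge0 (sqr_ge0 (rf p)) pos.
(* Besides the square, the regularization leaves a multiple of s - s^2, nonnegative because 0 <= s
   <= 1. *)
have P2 := mulr_ge0 c0 (_ : 0 <= sf e i p - sf e i p ^+ 2).
rewrite subr_ge0 in P2; have {}P2 := P2 s01.
apply: (le_trans (addr_ge0 P1 P2)).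
rewrite le_eqVlt; apply/orP; left; apply/eqP.
rewrite HE Dxu Dxx /F /f /v /psi.
transitivity (rf p ^+ 2 * Df u u p
  - 2 * (xc i p * qf e i p * u p) * ((rf p ^+ 3 * Nf p) * dX i u p
     - rf p ^+ 3 * Xf p * (Zf u p * xc i p))
  + (xc i p * qf e i p * u p) ^+ 2 * (rf p ^+ 3 * Nf p - rf p ^+ 3 * Xf p * xc i p ^+ 2)
  + rf p ^+ 3 * Xf p * u p ^+ 2 * (sf e i p - sf e i p ^+ 2)); first by ring.
rewrite rN3 /sf; ring.
Qed.

End ground_state.

(** * The gap for even functions *)

Section angular.
Context {R : realType} {n : nat}.
Local Notation V := ('rV[R]_n * R)%type.
Implicit Types (f g h u v w c a b F G : V -> R) (p q : V) (i j k l : 'I_n).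

(* radial functions: those of |x| and t *)
Definition radial c := sm c /\ forall k l p, p != 0 -> Om k l c p = 0.

Lemma radial_sm c : radial c -> sm c. Proof. by case. Qed.

Lemma radial_cst (c : R) : radial (fun=> c).
Proof. by split => [|k l p p0]; [exact: sm_cst|rewrite (drv_cst (is_der_Om k l))]. Qed.

Lemma radial_mul a b : radial a -> radial b -> radial (fun p => a p * b p).
Proof.
move=> [sa ha] [sb hb]; split; first exact: sm_mul.
move=> k l p p0; rewrite (drv_mul (is_der_Om k l) sa sb p0) ha// hb//; ring.
Qed.

Lemma radial_add a b : radial a -> radial b -> radial (fun p => a p + b p).
Proof.
move=> [sa ha] [sb hb]; split; first exact: sm_add.
move=> k l p p0; rewrite (drv_add (is_der_Om k l) sa sb p0) ha// hb//; ring.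
Qed.

Lemma radial_opp a : radial a -> radial (fun p => - a p).
Proof.
move=> [sa ha]; split; first exact: sm_opp.
move=> k l p p0; rewrite (drv_opp (is_der_Om k l) sa p0) ha//; ring.
Qed.

Lemma radial_sqr a : radial a -> radial (fun p => a p ^+ 2).
Proof. by move=> ra; have := radial_mul ra ra; under eq_fun do rewrite -expr2. Qed.

Lemma radial_rf : radial rf. Proof. by split; [exact: sm_rf|exact: Om_rf]. Qed.
Lemma radial_psi : radial psi. Proof. by split; [exact: sm_psi|exact: Om_psi]. Qed.
Lemma radial_sg : radial sg. Proof. by split; [exact: sm_sg|exact: Om_sg]. Qed.

Lemma Gam_radial c u p : radial c -> p != 0 -> Gam u c p = 0.
Proof.
move=> [_ hc] p0; apply: (@mulfI _ 2); first by rewrite pnatr_eq0.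
rewrite -sum_Om mulr0; apply: big1 => k _; apply: big1 => l _.
by rewrite hc ?mulr0.
Qed.

Lemma intg_radial_Om c k l f : radial c -> tf f -> intg (fun p => c p * Om k l f p) = 0.
Proof.
move=> [sc hc] tff; have tcf : tf (fun p => c p * f p) by exact: tf_mull.
rewrite -(intg_Om k l tcf); congr intg; apply: tf_ext; try by tft.
by move=> p p0; rewrite (drv_mul (is_der_Om k l) sc (tf_sm tff) p0) hc// mul0r add0r.
Qed.

Lemma Gam_xc k u p : Gam (xc k) u p = Xf p * dX k u p - Ef (xc k) p * Ef u p.
Proof.
rewrite GamE /Sf; congr (_ * _ - _).
rewrite (eq_bigr (fun j => (k == j)%:R * dX j u p)) ?sum_delta// => j _.
by rewrite dx_xc eq_sym.
Qed.

(** x_k is a spherical harmonic of degree 1, with eigenvalue n - 1; this is its weak equation,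
    written as a sum of rotation derivatives of x_l h. *)
Lemma intg_Gam_xc k G h : radial G -> tf h ->
  intg (fun p => G p * (Gam (xc k) h p - (n%:R - 1) * xc k p * h p)) = 0.
Proof.
move=> rG tfh; have sG := radial_sm rG; have sh := tf_sm tfh.
transitivity (intg (fun p => \sum_l G p * Om l k (fun q => xc l q * h q) p)).
  congr intg; apply: tf_ext; first by tft.
    by apply: tf_sum => l; tft.
  move=> p p0; rewrite -mulr_sumr; congr (_ * _).
  rewrite Gam_xc Ef_xc// EfE mulr_sumr.
  rewrite [RHS](eq_bigr (fun l => (k == l)%:R * (xc l p * h p) - xc k p * h p
      + (xc l p ^+ 2 * dX k h p - xc k p * (xc l p * dX l h p)))); last first.
    move=> l _; rewrite (drv_mul (is_der_Om l k) (sm_xc l) sh p0) /Om !dx_xc eqxx mulr1; ring.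
  rewrite [RHS]big_split /= !sumrB sum_delta sumr_const card_ord -mulr_suml -mulr_natl.
  rewrite -/(Xf p); ring.
rewrite intg_sum; last by move=> l; tft.
by apply: big1 => l _; apply: intg_radial_Om => //; tft.
Qed.

(** Minus the Laplace-Beltrami operator of the unit sphere in x; the factor 1/2 is there because
    each plane is counted twice. *)
Definition Bf u p : R := - (2^-1) * \sum_k \sum_l Om k l (Om k l u) p.

Lemma tf_Bf u : tf u -> tf (Bf u).
Proof.
move=> tfu; apply: tf_mull; first exact: sm_cst.
by apply: tf_sum => k; apply: tf_sum => l; tft.
Qed.

Lemma intg_sum2 (F : 'I_n -> 'I_n -> V -> R) : (forall k l, tf (F k l)) ->
  intg (fun p => \sum_k \sum_l F k l p) = \sum_k \sum_l intg (F k l).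
Proof.
move=> tF; rewrite intg_sum; last by move=> k; exact: tf_sum.
by apply: eq_bigr => k _; rewrite intg_sum.
Qed.

Lemma intg_Bf c u g : radial c -> tf u -> tf g ->
  intg (fun p => c p * (Bf u p * g p)) = intg (fun p => c p * Gam u g p).
Proof.
move=> rc tfu tfg; have sc := radial_sm rc; have tB := tf_Bf tfu.
have su := tf_sm tfu; have sg' := tf_sm tfg.
apply/eqP; rewrite -subr_eq0 -intgB; [|by apply: tf_ig; tft|by apply: tf_ig; tft].
pose H k l p := - (2^-1) * (c p * Om k l (fun q => Om k l u q * g q) p).
have tH k l : tf (H k l) by rewrite /H; tft.
have -> : (fun p => c p * (Bf u p * g p) - c p * Gam u g p) =
    (fun p => \sum_k \sum_l H k l p).
  apply: tf_ext; [by tft|by apply: tf_sum => k; exact: tf_sum|].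
  move=> p p0.
  have E k l : H k l p = - (2^-1) * c p * (Om k l (Om k l u) p * g p)
      - 2^-1 * c p * (Om k l u p * Om k l g p).
    have dO := @is_der_Om R n k l; have sO := drv_sm dO su.
    by rewrite /H (drv_mul dO sO sg' p0); ring.
  under [RHS]eq_bigr do under eq_bigr do rewrite E.
  under [RHS]eq_bigr do rewrite sumrB -!mulr_sumr -mulr_suml.
  by rewrite sumrB -!mulr_sumr -!mulr_suml sum_Om /Bf; field.
rewrite intg_sum2//; apply/eqP; apply: big1 => k _; apply: big1 => l _.
by rewrite /H intgZ ?intg_radial_Om ?mulr0//; [tft|apply: tf_ig; tft].
Qed.

End angular.

(** * Parity under coordinate reflections *)

Section parity.
Context {R : realType} {n : nat}.
Local Notation V := ('rV[R]_n * R)%type.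
Implicit Types (f g h u w a b F G : V -> R) (p q v : V) (i j k l : 'I_n) (c d : R).

Lemma reflD i (h : R) v p : refl i (h *: v + p) = h *: refl i v + refl i p.
Proof.
congr pair; apply/rowP => j; rewrite !mxE.
by case: eqP => _ //; rewrite opprD mulrN.
Qed.

Lemma reflK i : involutive (@refl R n i).
Proof.
move=> p; rewrite [RHS]surjective_pairing; congr pair; apply/rowP => j.
by rewrite !mxE; case: eqP => _; rewrite ?opprK.
Qed.

Lemma norm_refl i p : `|refl i p| = `|p|.
Proof.
have le q : `|refl i q| <= `|q|.
  have /norm_VE[q0 [h1 h2]] : `|q| <= `|q| by [].
  apply/norm_VE; split => //; split => //= j; rewrite mxE.
  by case: eqP => _; rewrite ?normrN.
by apply/le_anti; rewrite le -{1}[p](reflK i) le.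
Qed.

Lemma refl_eq0 i p : (refl i p == 0) = (p == 0).
Proof. by rewrite -normr_eq0 norm_refl normr_eq0. Qed.

Lemma refl_cont i : continuous (@refl R n i).
Proof.
move=> p; apply/cvgrPdist_lt => e e0; near=> q.
have -> : refl i p - refl i q = refl i (p - q).
  by rewrite addrC -scaleN1r -reflD scaleN1r addrC.
rewrite norm_refl; near: q; exact: near_dist.
Unshelve. all: by end_near. Qed.

Lemma D_refl i v f p : 'D_v (fun q => f (refl i q)) p = 'D_(refl i v) f (refl i p).
Proof.
rewrite /derive; set F := (X in _ = lim (X @ _)).
by rewrite (_ : (fun h : R => _) = F)//; apply/funext => h; rewrite /F /= reflD.
Qed.

Lemma derivable_refl i v f p : derivable f (refl i p) (refl i v) ->
  derivable (fun q => f (refl i q)) p v.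
Proof.
rewrite /derivable; set F := (X in cvg (X @ _) -> _).
rewrite (_ : (fun h : R => _) = F)//.
by apply/funext => h; rewrite /F /= reflD.
Qed.

Lemma sm_refl i f : sm f -> sm (fun p => f (refl i p)).
Proof.
move=> sf k; elim: k f sf => [|k IH] f sf.
  move=> p p0; apply: (@continuous_comp _ _ _ (@refl R n i) f); first exact: refl_cont.
  by apply: sm_cont => //; rewrite refl_eq0.
have rp p : p != 0 -> refl i p != 0 by rewrite refl_eq0.
split.
  move=> p p0; split; last first.
    by move=> v; apply: (@derivable_refl i v f p); apply: sm_derivable => //; exact: rp.
  apply: (@continuous_comp _ _ _ (@refl R n i) f); first exact: refl_cont.
  by apply: sm_cont => //; exact: rp.
move=> v; apply: smk_eq (IH _ (smD (refl i v) sf)) => p p0.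
by rewrite D_refl.
Qed.

Lemma tf_refl i f : tf f -> tf (fun p => f (refl i p)).
Proof.
move=> [sf [a [M [a0 H]]]]; split; first exact: sm_refl.
by exists a, M; split => // p /H; rewrite norm_refl.
Qed.

(** Directional derivability alone does not give linearity in the direction; the substitution h ->
    -h settles this case. *)
Lemma D_oppv f v p : (forall v, derivable f p v) -> 'D_(- v) f p = - 'D_v f p.
Proof.
move=> df; have [_ <-] := is_derive_line0 (df (- v)).
have d1 := is_derive_line0 (df v).
have d2 : is_derive (0 : R) 1 (-%R : R -> R^o) (-1).
  by have := @is_deriveN _ _ R^o id (0:R) 1 1 (is_derive_id _ _).
have d3 : is_derive (- (0:R)) 1 (fun h : R => f (h *: v + p) : R^o) ('D_v f p).
  by rewrite oppr0.
have := @is_derive1_comp R (fun h : R => f (h *: v + p)) -%R 0 _ _ d3 d2.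
rewrite mulrN1 => -[_ <-]; set F := (X in derive X); set G := (X in _ = derive X _ _).
by rewrite (_ : F = G)//; apply/funext => h; rewrite /F /G /= scalerN scaleNr.
Qed.

Definition sgn i j : R := if j == i then -1 else 1.

(** Parity is recorded as a scalar, so that the parity of a product or of a derivative is computed
    by multiplying scalars. *)
Definition par i c f := forall p, f (refl i p) = c * f p.

Lemma sgn2 i j : sgn i j * sgn i j = 1.
Proof. by rewrite /sgn; case: eqP => _; rewrite ?mulrNN mulr1. Qed.

Lemma par_eq i c d f : c = d -> par i c f -> par i d f. Proof. by move=> ->. Qed.

Lemma par_mul i c d f g : par i c f -> par i d g -> par i (c * d) (fun p => f p * g p).
Proof. by move=> pf pg p; rewrite pf pg; ring. Qed.

Lemma par_add i c f g : par i c f -> par i c g -> par i c (fun p => f p + g p).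
Proof. by move=> pf pg p; rewrite pf pg mulrDr. Qed.

Lemma par_sum i c (J : Type) (s : seq J) (F : J -> V -> R) : (forall m, par i c (F m)) ->
  par i c (fun p => \sum_(m <- s) F m p).
Proof. by move=> pF p; rewrite mulr_sumr; apply: eq_bigr => m _; exact: pF. Qed.

Lemma par_scale i c d f : par i c f -> par i c (fun p => d * f p).
Proof. by move=> pf p; rewrite pf; ring. Qed.

Lemma par_xc i j : par i (sgn i j) (xc j).
Proof. by move=> p; rewrite xc_refl /sgn; case: eqP => _; rewrite ?mulN1r ?mul1r. Qed.

Lemma par_Xf i : par i 1 Xf. Proof. by move=> p; rewrite Xf_refl mul1r. Qed.
Lemma par_rf i : par i 1 rf. Proof. by move=> p; rewrite rf_refl mul1r. Qed.
Lemma par_psi i : par i 1 psi. Proof. by move=> p; rewrite /psi Xf_refl rf_refl mul1r. Qed.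
Lemma par_sg i : par i 1 sg. Proof. by move=> p; rewrite /sg tc_refl rf_refl mul1r. Qed.
Lemma par_Nf i : par i 1 Nf. Proof. by move=> p; rewrite /Nf tc_refl Xf_refl mul1r. Qed.

Lemma refl_ex i j : refl i (ex j) = sgn i j *: ex j :> V.
Proof.
rewrite /sgn; congr pair => /=; last by rewrite scaler0.
apply/rowP => m; rewrite !mxE eqxx /=; case: (eqVneq m j) => [->|mj].
  by case: eqP => _; rewrite ?mulr1.
by case: ifP => _; rewrite mulr0 ?oppr0.
Qed.

Lemma par_dX i j c u : tf u -> par i c u -> par i (sgn i j * c) (dX j u).
Proof.
move=> tfu pu p; rewrite dXE /dx -/(ex j).
have du q v : derivable u q v by exact: tf_derivable.
have := D_refl i (ex j) u p; rewrite (_ : (fun q => _) = (fun q => c * u q)); last first.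
  by apply/funext => q; exact: pu.
have -> : 'D_(ex j) (fun q => c * u q) p = c * 'D_(ex j) u p.
  by rewrite (derive_mulf _ (du p _)) ?(@derive_cst _ V R^o)// ?mul0r ?add0r//;
    exact: derivable_cst.
rewrite refl_ex -mulrA => ->; rewrite /sgn; case: eqP => _; rewrite ?scale1r ?mul1r//.
by rewrite scaleN1r D_oppv// mulN1r opprK.
Qed.

Lemma par_dT i c u : tf u -> par i c u -> par i c (dT u).
Proof.
move=> tfu pu p; rewrite dTE /dt.
have du q v : derivable u q v by exact: tf_derivable.
have := D_refl i (0, 1) u p; rewrite (_ : (fun q => _) = (fun q => c * u q)); last first.
  by apply/funext => q; exact: pu.
have -> : 'D_(0, 1) (fun q => c * u q) p = c * 'D_(0, 1) u p.
  by rewrite (derive_mulf _ (du p _)) ?(@derive_cst _ V R^o)// ?mul0r ?add0r//;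
    exact: derivable_cst.
move=> ->; congr ('D_ _ u _); congr pair.
by apply/rowP => m; rewrite !mxE; case: eqP => _; rewrite ?oppr0.
Qed.

Lemma par_ext i c f g : f =1 g -> par i c f -> par i c g.
Proof. by move=> fg pf p; rewrite -!fg. Qed.

Lemma par_Ef i c u : tf u -> par i c u -> par i c (Ef u).
Proof.
move=> tfu pu; apply: (@par_ext _ _ (fun p => \sum_j xc j p * dX j u p)).
  by move=> p; rewrite EfE.
apply: par_sum => j; apply: par_eq (par_mul (par_xc i j) (par_dX j tfu pu)).
by rewrite mulrA sgn2 mul1r.
Qed.

Lemma par_Zf i c u : tf u -> par i c u -> par i c (Zf u).
Proof.
move=> tfu pu p; have pE := par_Ef tfu pu; have pT := par_dT tfu pu.
by rewrite !ZfE pE pT tc_refl; ring.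
Qed.

Lemma par_Yf i c u : tf u -> par i c u -> par i c (Yf u).
Proof.
move=> tfu pu p; have pE := par_Ef tfu pu; have pT := par_dT tfu pu.
by rewrite !YfE pE pT tc_refl rf_refl Xf_refl; ring.
Qed.

Lemma par_Om i k l c u : tf u -> par i c u -> par i (sgn i k * sgn i l * c) (Om k l u).
Proof.
move=> tfu pu p; have p1 := par_dX k tfu pu; have p2 := par_dX l tfu pu.
by rewrite /Om p1 p2 !par_xc; ring.
Qed.

Lemma par_Sf i c d a b : tf a -> tf b -> par i c a -> par i d b -> par i (c * d) (Sf a b).
Proof.
move=> ta tb pa pb; apply: par_sum => j.
apply: par_eq (par_mul (par_dX j ta pa) (par_dX j tb pb)).
by rewrite mulrACA sgn2 mul1r.
Qed.

Lemma par_Df i c d a b : tf a -> tf b -> par i c a -> par i d b -> par i (c * d) (Df a b).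
Proof.
move=> ta tb pa pb p; rewrite !DfE (par_Sf ta tb pa pb).
rewrite (par_dT ta pa) (par_dT tb pb) (par_Zf ta pa) (par_Zf tb pb).
by rewrite par_Nf par_rf par_Xf par_psi; ring.
Qed.

Lemma par_Bf i c u : tf u -> par i c u -> par i c (Bf u).
Proof.
move=> tfu pu; apply: par_scale; apply: par_sum => k; apply: par_sum => l.
have t1 : tf (Om k l u) by tft.
apply: par_eq (par_Om k l t1 (par_Om k l tfu pu)).
by rewrite mulrA mulrACA !sgn2 !mul1r.
Qed.

End parity.

(** * Angular energy of functions odd in two coordinates *)

Section two_odd_gap.
Context {R : realType} {n : nat}.
Local Notation V := ('rV[R]_n * R)%type.
Implicit Types (f g h u w a b F G : V -> R) (p q v : V) (i j k l : 'I_n) (c d : R).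
Local Notation eps := (fun m : nat => m.+1%:R^-1 : R).

Lemma par_odd k u : par k (-1) u -> forall p, u (refl k p) = - u p.
Proof. by move=> pu p; rewrite pu mulN1r. Qed.

Lemma Gam_comb a b g (c d : R) p : sm a -> sm b -> sm g -> p != 0 ->
  Gam g (fun q => c * a q + d * b q) p = c * Gam g a p + d * Gam g b p.
Proof.
move=> sa sb sg' p0; have dG := is_der_Gam sg'.
have s1 : sm (fun q => c * a q) by smt.
have s2 : sm (fun q => d * b q) by smt.
by rewrite (drv_add dG s1 s2 p0) (drv_scale dG c sa p0) (drv_scale dG d sb p0).
Qed.

(** Ground-state argument with x_k x_l, a spherical harmonic of degree 2 and eigenvalue 2n: each
    factor contributes n - 1 through [intg_Gam_xc], and the cross term Gam(x_k, x_l) = - x_k x_l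
    contributes 2. A radial weight G is invisible to the rotations. *)
Lemma two_odd_gap k l G w : k != l -> radial G -> (forall p, p != 0 -> 0 <= G p) ->
  par k 1 G -> par l 1 G -> tf w -> par k (-1) w -> par l (-1) w ->
  0 <= intg (fun p => G p * (Gam w w p - 2 * n%:R * w p ^+ 2)).
Proof.
move=> kl rG G0 Gk Gl tfw wk wl; have sG := radial_sm rG; have sw := tf_sm tfw.
pose F p := G p * (Gam w w p - 2 * n%:R * w p ^+ 2).
pose f p := G p * w p ^+ 2.
pose v p := G p * Xf p * w p.
have tF : tf F by rewrite /F; tft.
have tff : tf f by rewrite /f; tft.
have tfv : tf v by rewrite /v; tft.
have vo m : par m 1 G -> par m (-1) w -> par m (-1) v.
  by move=> p1 p2; apply: par_eq (par_mul (par_mul p1 (par_Xf m)) p2); rewrite !mul1r.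
have f0 m p : par m (-1) w -> xc m p = 0 -> f p = 0.
  by move=> /par_odd wo x0; rewrite /f (odd_vanish wo x0) expr0n mulr0.
have L1 := lim_sf tff (fun p => f0 k p wk).
have L2 := lim_sf tff (fun p => f0 l p wl).
have L3 := lim_qsf tfv tfw (par_odd (vo k Gk wk)) (par_odd wk).
have L4 := lim_qsf tfv tfw (par_odd (vo l Gl wl)) (par_odd wl).
have L : (fun m => (n%:R + 1) * (intg (fun p => f p * sf (eps m) k p)
      + intg (fun p => f p * sf (eps m) l p))
   + (intg (fun p => v p * w p * (qf (eps m) k p * sf (eps m) k p))
      + intg (fun p => v p * w p * (qf (eps m) l p * sf (eps m) l p)))) @ \oo --> (0 : R).
  rewrite (_ : 0 = (n%:R + 1) * (0 + 0) + (0 + 0)); last by rewrite !addr0 mulr0.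
  by apply: cvgD; [apply: cvgMr; apply: cvgD|apply: cvgD].
apply: (ge0_err L) => m; have e0 := @eps_gt0 R m; set e := eps m.
have sqk := sm_qf e0 k; have ssk := sm_sf e0 k.
have sql := sm_qf e0 l; have ssl := sm_sf e0 l.
have tE1 : tf (fun p => f p * sf e k p) by tft.
have tE2 : tf (fun p => f p * sf e l p) by tft.
have tE3 : tf (fun p => v p * w p * (qf e k p * sf e k p)) by tft.
have tE4 : tf (fun p => v p * w p * (qf e l p * sf e l p)) by tft.
pose h i p := xc i p * qf e i p * w p ^+ 2.
pose H i p := G p * (Gam (xc i) (h i) p - (n%:R - 1) * xc i p * h i p).
have sq i := sm_qf e0 i.
have th i : tf (h i) by have sqi := sq i; rewrite /h; tft.
have tH i : tf (H i).
  by have t1 := th i; have sxi := @sm_xc R n i; rewrite /H; tft.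
have H0 i : intg (H i) = 0 by apply: intg_Gam_xc.
rewrite -/F.
have -> : intg F = intg (fun p => F p - H k p - H l p).
  have t1 : tf (fun p => F p - H k p) by have t1 := tH k; tft.
  by rewrite intgB ?intgB ?H0 ?subr0//; exact: tf_ig.
rewrite -[X in _ + (_ * X + _)]intgD; [|exact: tf_ig|exact: tf_ig].
rewrite -[X in _ + (X + _)]intgZ; last by apply: tf_ig; tft.
rewrite -[X in _ + (_ + X)]intgD; [|exact: tf_ig|exact: tf_ig].
have tHk := tH k; have tHl := tH l.
rewrite -[X in _ + X]intgD; [|by apply: tf_ig; tft|by apply: tf_ig; tft].
rewrite -intgD; [|by apply: tf_ig; tft|by apply: tf_ig; tft].
rewrite -[X in X <= _](@intg0 R n); apply: le_intg.
- by apply: tf_ig; exact: tf_cst0.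
- by apply: tf_ig; tft.
move=> p; have [->|p0] := eqVneq p 0.
  by rewrite (tf0 tF) (tf0 tHk) (tf0 tHl) (tf0 tE1) (tf0 tE2) (tf0 tE3) (tf0 tE4)
    !addr0 mulr0 !subr0 addr0.
have Gxx i : Gam (xc i) (xc i) p = Xf p - xc i p ^+ 2.
  by rewrite Gam_xc Ef_xc// dx_xc eqxx mulr1 expr2.
have Gxy : Gam (xc k) (xc l) p = - (xc k p * xc l p).
  by rewrite Gam_xc !Ef_xc// dx_xc (negbTE kl) mulr0 sub0r.
have HE i : H i p = G p * (2 * w p * xc i p * qf e i p * Gam (xc i) w p
   + w p ^+ 2 * ((Xf p - xc i p ^+ 2) * (qf e i p - 2 * xc i p ^+ 2 * qf e i p ^+ 2)
     - (n%:R - 1) * xc i p ^+ 2 * qf e i p)).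
  have dG := is_der_Gam (@sm_xc R n i).
  have sxq : sm (fun q => xc i q * qf e i q) by have sqi := sq i; smt.
  have sw2 : sm (fun q => w q ^+ 2) by smt.
  rewrite /H /h (drv_mul dG sxq sw2 p0) (drv_mul dG (sm_xc i) (sq i) p0).
  by rewrite (drv_sqr dG sw p0) (drv_qf e0 i dG p0) Gxx; ring.
(* Pairing with b at p replaces pairing with the logarithm of x_k x_l; the regularized coefficients
   are frozen at p. *)
pose c1 := xc k p * qf e k p; pose c2 := xc l p * qf e l p.
pose b q := c1 * xc k q + c2 * xc l q.
have sb : sm b by have sk := @sm_xc R n k; have sl := @sm_xc R n l; rewrite /b; smt.
have pos := Gam_psd w b p (- w p).
have sk := @sm_xc R n k; have sl := @sm_xc R n l.
have Gb g : sm g -> Gam g b p = c1 * Gam g (xc k) p + c2 * Gam g (xc l) p.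
  by move=> sg'; rewrite /b Gam_comb.
rewrite (Gb b sb) (Gam_sym b (xc k)) (Gam_sym b (xc l)) !Gb// in pos.
rewrite (Gam_sym (xc l) (xc k)) !Gxx Gxy (Gam_sym w (xc k)) (Gam_sym w (xc l)) in pos.
have P1 := mulr_ge0 (G0 p p0) pos.
(* What the error terms leave over once the square has been completed. *)
have P2 : 0 <= G p * w p ^+ 2 * (2 * (sf e k p * sf e l p)
   + qf e k p * sf e k p * xc k p ^+ 2 + qf e l p * sf e l p * xc l p ^+ 2).
  have q0 i := ltW (qf_gt0 e0 i p); have s0 i := sf_ge0 e0 i p.
  apply: mulr_ge0; first by rewrite mulr_ge0 ?sqr_ge0 ?G0.
  apply: addr_ge0; last by apply: mulr_ge0; [exact: mulr_ge0|exact: sqr_ge0].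
  by apply: addr_ge0; apply: mulr_ge0 => //; [exact: mulr_ge0|exact: mulr_ge0|exact: sqr_ge0].
apply: (le_trans (addr_ge0 P1 P2)).
rewrite le_eqVlt; apply/orP; left; apply/eqP.
rewrite !HE /F /f /v /c1 /c2 /sf; ring.
Qed.

End two_odd_gap.

(** * Multiplier identities and polynomial inequalities *)

Section even_gap_identities.
Context {R : realType} {n : nat}.
Local Notation V := ('rV[R]_n * R)%type.
Implicit Types (f g h u w a b F G : V -> R) (p q v : V) (i j k l : 'I_n) (c d : R).

(* the constants of [etaf] and the factor 3/2 of [even_gap] were found numerically *)
Definition etaf p : R := sg p * (26 / 5 - 3 * psi p).
Definition detaf p : R := 3 + 26 / 5 * psi p - 6 * psi p ^+ 2.

Lemma sm_etaf : sm etaf.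
Proof. by have s1 := @sm_sg R n; have s2 := @sm_psi R n; rewrite /etaf; smt. Qed.

Lemma radial_etaf : radial etaf.
Proof.
apply: radial_mul; first exact: radial_sg.
apply: radial_add; first exact: radial_cst.
apply: radial_opp; apply: radial_mul; [exact: radial_cst|exact: radial_psi].
Qed.

Lemma Yf_etaf p : p != 0 -> Yf etaf p = 2 * psi p * detaf p.
Proof.
move=> p0; have dY := @is_der_Y R n; have sp := @sm_psi R n.
have s1 : sm (fun q : V => 26 / 5 - 3 * psi q) by smt.
have s3 : sm (fun q : V => 3 * psi q) by smt.
rewrite (drv_mul dY sm_sg s1 p0) (drv_sub dY (sm_cst _) s3 p0) (drv_cst dY)//.
rewrite (drv_scale dY 3 sp p0) Yf_sg// Yf_psi// /detaf.
transitivity (2 * psi p ^+ 2 * (26 / 5 - 3 * psi p) + 6 * psi p * sg p ^+ 2); first by ring.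
have -> : sg p ^+ 2 = 1 - psi p ^+ 2 by rewrite -(psi_sg p0); ring.
ring.
Qed.

Lemma psi_Yf_Df u p : tf u -> p != 0 -> psi p * Yf (Df u u) p =
  2 * Yf u p * Yf (Yf u) p + 2 * Gam u (Yf u) p + 2 * psi p * sg p * Df u u p.
Proof.
move=> tfu p0; have dY := @is_der_Y R n; have su := tf_sm tfu.
have sD : sm (Df u u) by smt.
have sY : sm (Yf u) by smt.
have sY2 : sm (fun q => Yf u q ^+ 2) by smt.
have sG : sm (Gam u u) by smt.
have : Yf (fun q => psi q * Df u u q) p = Yf (fun q => Yf u q ^+ 2 + Gam u u q) p.
  by apply: (drv_eq dY) => // q q0; rewrite psi_Df// expr2.
rewrite (drv_mul dY sm_psi sD p0) (drv_add dY sY2 sG p0) (drv_sqr dY sY p0).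
rewrite Yf_Gam// Yf_psi// => E.
apply: (@addrI _ (- 2 * psi p * sg p * Df u u p)); rewrite E; ring.
Qed.

(** Multiplier identity of Rellich-Pohozaev type: the second derivatives of u are gathered into Y
    D(u, u), which can be integrated by parts. It is checked after multiplication by psi, where
    [psi_Df] differentiated along Y applies. *)
Lemma Df_etaf u p : tf u -> p.1 != 0 ->
  2 * Df u (fun q => etaf q * Yf u q) p =
  4 * detaf p * Yf u p ^+ 2 + etaf p * Yf (Df u u) p - 2 * sg p * etaf p * Df u u p.
Proof.
move=> tfu p1; have p0 : p != 0 by apply: contraNneq p1 => ->.
have su := tf_sm tfu; have sY : sm (Yf u) by smt.
have dY := @is_der_Y R n; have dG := is_der_Gam su.
apply: (@mulfI _ (psi p)); first by rewrite gt_eqF// psi_gt0.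
rewrite mulrCA psi_Df// (drv_mul dY sm_etaf sY p0) (drv_mul dG sm_etaf sY p0).
rewrite (Gam_radial u radial_etaf p0) Yf_etaf//.
transitivity (4 * psi p * detaf p * Yf u p ^+ 2 + etaf p * (psi p * Yf (Df u u) p)
  - 2 * psi p * sg p * etaf p * Df u u p); last by ring.
rewrite psi_Yf_Df//; ring.
Qed.

Context (n0 : (0 < n)%N).

(** Integration along Y: the divergence - n sg and the term - 2 sg eta D(u, u) combine into the
    factor n - 2. *)
Lemma intg_Df_etaf u : tf u ->
  intg (fun p => rf p ^+ 2 * (2 * Df u (fun q => etaf q * Yf u q) p)) =
  intg (fun p => rf p ^+ 2 * (4 * detaf p * Yf u p ^+ 2
    - (2 * psi p * detaf p - (n%:R - 2) * sg p * etaf p) * Df u u p)).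
Proof.
move=> tfu; have su := tf_sm tfu; have se := sm_etaf; have sp := @sm_psi R n.
have sd : sm detaf by rewrite /detaf; smt.
have teY : tf (fun q => etaf q * Yf u q) by tft.
pose f p := rf p ^+ 2 * (etaf p * Df u u p).
have tff : tf f by rewrite /f; tft.
have tH : tf (fun p => Yf f p - n%:R * sg p * f p) by tft.
apply: (intg_eq n0 _ _ tH (intg_Yf tff)); [by tft|by tft|].
move=> p p0 p1; rewrite Df_etaf//.
have dY := @is_der_Y R n.
have sr2 : sm (fun q : V => rf q ^+ 2) by smt.
have sD : sm (Df u u) by smt.
have seD : sm (fun q => etaf q * Df u u q) by smt.
rewrite /f (drv_mul dY sr2 seD p0) (drv_sqr dY sm_rf p0) (drv_mul dY se sD p0).
rewrite Yf_rf// Yf_etaf//; ring.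
Qed.

(* [T] is Df or Gam *)
Lemma intg_bilin_Bf (T : (V -> R) -> (V -> R) -> V -> R) (c0 : V -> R) u : radial c0 ->
  (forall a, sm a -> is_der (T a)) ->
  (forall k l a b p, tf a -> tf b -> p != 0 ->
    Om k l (T a b) p = T (Om k l a) b p + T a (Om k l b) p) ->
  tf u ->
  intg (fun p => c0 p * T u (Bf u) p) =
  2^-1 * \sum_k \sum_l intg (fun p => c0 p * T (Om k l u) (Om k l u) p).
Proof.
move=> rc dT OT tfu; have sc := radial_sm rc; have su := tf_sm tfu.
have tT a b : sm a -> tf b -> tf (T a b) by move=> sa; exact: (drv_tf (dT a sa)).
have tB := tf_Bf tfu.
have tw k l : tf (Om k l u) by tft.
have t1 k l : tf (T (Om k l u) (Om k l u)) by apply: tT; [exact: tf_sm|].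
have t2 k l : tf (T u (Om k l u)) by apply: tT.
have t3 k l : tf (fun p => c0 p * T (Om k l u) (Om k l u) p) by have := t1 k l => ?; tft.
have t4 k l : tf (fun p => c0 p * Om k l (T u (Om k l u)) p) by have := t2 k l => ?; tft.
have tTB := tT u (Bf u) su tB.
transitivity (intg (fun p => 2^-1 * (\sum_k \sum_l c0 p * T (Om k l u) (Om k l u) p)
   - 2^-1 * (\sum_k \sum_l c0 p * Om k l (T u (Om k l u)) p))).
  have t5 : tf (fun p => \sum_k \sum_l c0 p * T (Om k l u) (Om k l u) p).
    by apply: tf_sum => k; apply: tf_sum => l; exact: t3.
  have t6 : tf (fun p => \sum_k \sum_l c0 p * Om k l (T u (Om k l u)) p).
    by apply: tf_sum => k; apply: tf_sum => l; exact: t4.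
  congr intg; apply: tf_ext; [by tft|by tft|].
  move=> p p0; have sOO k l : sm (Om k l (Om k l u)) by smt.
  have sO1 k : sm (fun q => \sum_l Om k l (Om k l u) q) by apply: sm_sum => l.
  have sO2 : sm (fun q => \sum_k \sum_l Om k l (Om k l u) q) by exact: sm_sum.
  rewrite /Bf (drv_scale (dT u su) _ sO2 p0) (drv_sum (dT u su) _ sO1 p0).
  under eq_bigr => k _ do rewrite (drv_sum (dT u su) _ (sOO k) p0).
  rewrite mulrCA mulNr -mulrN -mulrBr; congr (_ * _).
  rewrite mulr_sumr -sumrN -sumrB; apply: eq_bigr => k _.
  rewrite mulr_sumr -sumrN -sumrB; apply: eq_bigr => l _.
  by rewrite OT//; ring.
have t5 : tf (fun p => \sum_k \sum_l c0 p * T (Om k l u) (Om k l u) p).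
  by apply: tf_sum => k; apply: tf_sum => l; exact: t3.
have t6 : tf (fun p => \sum_k \sum_l c0 p * Om k l (T u (Om k l u)) p).
  by apply: tf_sum => k; apply: tf_sum => l; exact: t4.
rewrite intgB; [|by apply: tf_ig; tft|by apply: tf_ig; tft].
rewrite intgZ ?intgZ; [|exact: tf_ig|exact: tf_ig].
rewrite !intg_sum2// [X in _ - 2^-1 * X]big1 ?mulr0 ?subr0// => k _.
by apply: big1 => l _; exact: intg_radial_Om.
Qed.

(** The weak form of [Bf] produces Gam(u, Yu), which is half of Y Gam(u, u) by [Yf_Gam]; one
    integration along Y removes the second derivatives. *)
Lemma intg_Bf_Yf u : tf u ->
  intg (fun p => (rf p ^+ 2 * (psi p * etaf p)) * (Bf u p * Yf u p)) =
  intg (fun p => rf p ^+ 2 * (- (2^-1) * (2 * psi p ^+ 2 * detaf p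
     - (n%:R + 2) * psi p * sg p * etaf p) * Gam u u p)).
Proof.
move=> tfu; have su := tf_sm tfu; have se := sm_etaf; have sp := @sm_psi R n.
have tY : tf (Yf u) by tft.
have sd : sm detaf by rewrite /detaf; smt.
have rc : radial (fun p : V => rf p ^+ 2 * (psi p * etaf p)).
  apply: radial_mul; first by apply: radial_sqr; exact: radial_rf.
  apply: radial_mul; [exact: radial_psi|exact: radial_etaf].
rewrite (intg_Bf rc tfu tY).
pose f p := rf p ^+ 2 * ((psi p * etaf p) * Gam u u p).
have tff : tf f by rewrite /f; tft.
have tH : tf (fun p => 2^-1 * (Yf f p - n%:R * sg p * f p)) by tft.
have H0 : intg (fun p => 2^-1 * (Yf f p - n%:R * sg p * f p)) = 0.
  by rewrite intgZ ?intg_Yf ?mulr0//; apply: tf_ig; tft.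
apply: (intg_eq n0 _ _ tH H0); [by tft|by tft|].
move=> p p0 p1; have dY := @is_der_Y R n.
have sr2 : sm (fun q : V => rf q ^+ 2) by smt.
have sG : sm (Gam u u) by smt.
have spe : sm (fun q : V => psi q * etaf q) by smt.
have speG : sm (fun q => psi q * etaf q * Gam u u q) by smt.
rewrite /f (drv_mul dY sr2 speG p0) (drv_sqr dY sm_rf p0) (drv_mul dY spe sG p0).
rewrite (drv_mul dY sm_psi se p0) Yf_rf// Yf_psi// Yf_etaf// Yf_Gam//; by field.
Qed.

(* The coefficients in the Bernstein basis of each of two subintervals of [0, 1]
   are nonnegative. *)
Lemma poly_bound6 (y : R) : 0 <= y -> y <= 1 ->
  0 <= 30 + 75 * y - 546 * y ^+ 2 + 555 * y ^+ 3 + 451 * y ^+ 4 - 780 * y ^+ 5 + 225 * y ^+ 6.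
Proof.
move=> y0 y1.
have B (u v : R) (i j : nat) : 0 <= u -> 0 <= v -> 0 <= u ^+ i * v ^+ j.
  by move=> u0 v0; rewrite mulr_ge0 ?exprn_ge0.
have [h|/ltW h] := leP y (2^-1).
  have v0 : 0 <= 1 - 2 * y by lra.
  have := (B _ _ 0%N 6%N y0 v0, B _ _ 1%N 5%N y0 v0, B _ _ 2%N 4%N y0 v0,
    B _ _ 3%N 3%N y0 v0, B _ _ 4%N 2%N y0 v0, B _ _ 5%N 1%N y0 v0,
    B _ _ 6%N 0%N y0 v0) => -[[[[[[]]]]]].
  by lra.
have u0 : 0 <= 2 * y - 1 by lra.
have v0 : 0 <= 1 - y by lra.
have := (B _ _ 0%N 6%N u0 v0, B _ _ 1%N 5%N u0 v0, B _ _ 2%N 4%N u0 v0,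
  B _ _ 3%N 3%N u0 v0, B _ _ 4%N 2%N u0 v0, B _ _ 5%N 1%N u0 v0,
  B _ _ 6%N 0%N u0 v0) => -[[[[[[]]]]]].
by lra.
Qed.

(** Ten times the expression of [gap_coef_Gam] at N = 3, with s^2 = 1 - y^2. The interval is cut at
    7/10, close to the minimum, where little room is left. *)
Lemma poly_bound5 (y : R) : 0 <= y -> y <= 1 ->
  0 <= 12 + 270 * y - 861 * y ^+ 2 + 465 * y ^+ 3 + 546 * y ^+ 4 - 405 * y ^+ 5.
Proof.
move=> y0 y1.
have B (u v : R) (i j : nat) : 0 <= u -> 0 <= v -> 0 <= u ^+ i * v ^+ j.
  by move=> u0 v0; rewrite mulr_ge0 ?exprn_ge0.
have [h|/ltW h] := leP y (7 / 10).
  have v0 : 0 <= 7 - 10 * y by lra.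
  have := (B _ _ 0%N 5%N y0 v0, B _ _ 1%N 4%N y0 v0, B _ _ 2%N 3%N y0 v0,
    B _ _ 3%N 2%N y0 v0, B _ _ 4%N 1%N y0 v0, B _ _ 5%N 0%N y0 v0) => -[[[[[]]]]].
  by lra.
have u0 : 0 <= 10 * y - 7 by lra.
have v0 : 0 <= 1 - y by lra.
have := (B _ _ 0%N 5%N u0 v0, B _ _ 1%N 4%N u0 v0, B _ _ 2%N 3%N u0 v0,
  B _ _ 3%N 2%N u0 v0, B _ _ 4%N 1%N u0 v0, B _ _ 5%N 0%N u0 v0) => -[[[[[]]]]].
by lra.
Qed.

(** Ten times the slope in N of the expression of [gap_coef_Gam]. Here the Bernstein basis of the
    whole interval suffices. *)
Lemma poly_bound5_step (y : R) : 0 <= y -> y <= 1 ->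
  0 <= 52 + 90 * y - 235 * y ^+ 2 + 75 * y ^+ 3 + 78 * y ^+ 4 - 45 * y ^+ 5.
Proof.
move=> y0 y1.
have B (u v : R) (i j : nat) : 0 <= u -> 0 <= v -> 0 <= u ^+ i * v ^+ j.
  by move=> u0 v0; rewrite mulr_ge0 ?exprn_ge0.
have v0 : 0 <= 1 - y by lra.
have := (B _ _ 0%N 5%N y0 v0, B _ _ 1%N 4%N y0 v0, B _ _ 2%N 3%N y0 v0,
  B _ _ 3%N 2%N y0 v0, B _ _ 4%N 1%N y0 v0, B _ _ 5%N 0%N y0 v0) => -[[[[[]]]]].
by lra.
Qed.

(** The coefficient of (Yu)^2 in the pointwise inequality multiplied by psi. It is affine in N with
    nonnegative slope, so [poly_bound6], which is 25 times its value at N = 3, decides. *)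
Lemma gap_coef_Y (N y s e de : R) : e = s * (26 / 5 - 3 * y) ->
  de = 3 + 26 / 5 * y - 6 * y ^+ 2 -> 3 <= N -> 0 <= y -> y ^+ 2 + s ^+ 2 = 1 ->
  0 <= 2 * y * de + (N - 2) * s * e - y ^+ 2 * e ^+ 2 - 4.
Proof.
move=> -> -> N3 y0 ys; have s2 : s ^+ 2 = 1 - y ^+ 2 by rewrite -ys; ring.
have y1 : y <= 1 by have := sqr_ge0 s; rewrite s2; nra.
have b := poly_bound6 y0 y1.
have c : 0 <= (N - 3) * ((1 - y ^+ 2) * (26 / 5 - 3 * y)).
  by rewrite !mulr_ge0//; [lra|rewrite -s2 sqr_ge0|lra].
rewrite [leRHS](_ : _ = 2 * y * (3 + 26 / 5 * y - 6 * y ^+ 2) 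
  + (N - 2) * (s ^+ 2 * (26 / 5 - 3 * y))
  - y ^+ 2 * (s ^+ 2 * (26 / 5 - 3 * y) ^+ 2) - 4); last by ring.
rewrite s2; lra.
Qed.

(** The coefficient of Gam(u, u) in the same inequality, again affine in N: its value at N = 3 and
    its slope are treated by the two preceding bounds. *)
Lemma gap_coef_Gam (N y s e de : R) : e = s * (26 / 5 - 3 * y) ->
  de = 3 + 26 / 5 * y - 6 * y ^+ 2 -> 3 <= N -> 0 <= y -> y ^+ 2 + s ^+ 2 = 1 ->
  0 <= y * (3 / 2 * (2 * y ^+ 2 * de - (N + 2) * y * s * e)
            + 2 * N * (6 - 21 / 4 * y)) - 2 * y * de + (N - 2) * s * e - 4.
Proof.
move=> -> -> N3 y0 ys; have s2 : s ^+ 2 = 1 - y ^+ 2 by rewrite -ys; ring.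
have y1 : y <= 1 by have := sqr_ge0 s; rewrite s2; nra.
have b := poly_bound5 y0 y1.
have c := mulr_ge0 (_ : 0 <= N - 3) (poly_bound5_step y0 y1).
have {}c := c ltac:(lra).
rewrite [leRHS](_ : _ = y * (3 / 2 * (2 * y ^+ 2 * (3 + 26 / 5 * y - 6 * y ^+ 2)
    - (N + 2) * y * (s ^+ 2 * (26 / 5 - 3 * y)))
  + 2 * N * (6 - 21 / 4 * y)) - 2 * y * (3 + 26 / 5 * y - 6 * y ^+ 2)
  + (N - 2) * (s ^+ 2 * (26 / 5 - 3 * y)) - 4);
  last by ring.
rewrite s2; lra.
Qed.

End even_gap_identities.

(** * The gap for functions even in every coordinate *)

Section even_gap.
Context {R : realType} {n : nat}.
Local Notation V := ('rV[R]_n * R)%type.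
Implicit Types (f g h u w a b F G : V -> R) (p q v : V) (i j k l : 'I_n) (c d : R).

Context (n3 : (3 <= n)%N).

Let n0 : (0 < n)%N. Proof. exact: leq_trans n3. Qed.

Definition fpsi (p : V) : R := 6 - 21 / 4 * psi p.

Lemma psi_le1 p : psi p <= 1.
Proof.
have [->|p0] := eqVneq p 0.
  by rewrite /psi (_ : Xf 0 = 0) ?mul0r//; apply/eqP; rewrite Xf_eq0.
have := psi_sg p0; have := psi_ge0 p; have := sqr_ge0 (sg p); nra.
Qed.

(* 2 (3/2) (2 - psi) - (3/2)^2 psi = fpsi, and D(w, w) >= (2 - psi) Gam(w, w) *)
Lemma pair_gap k l u : tf u -> (forall i, par i 1 u) ->
  0 <= intg (fun p => rf p ^+ 2 * (3 / 2 * Df (Om k l u) (Om k l u) p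
     - 9 / 8 * psi p * Gam (Om k l u) (Om k l u) p
     - n%:R * fpsi p * Om k l u p ^+ 2)).
Proof.
move=> tfu pu; have sp := @sm_psi R n; have sfp : sm fpsi by rewrite /fpsi; smt.
set w := Om k l u; have tfw : tf w by rewrite /w; tft.
have sw := tf_sm tfw.
have [kl|kl] := eqVneq k l.
  have w0 : w = fun=> 0 by apply/funext => p; rewrite /w kl /Om subrr.
  rewrite (_ : (fun p => _) = fun=> 0) ?intg0//.
  apply: tf_ext; [by tft|exact: tf_cst0|move=> p p0].
  rewrite w0 (drv_cst (is_der_Df (sm_cst 0)))// (drv_cst (is_der_Gam (sm_cst 0)))//.
  by rewrite expr0n /= !mulr0 !subr0 mulr0.
pose G (p : V) := rf p ^+ 2 * fpsi p.
have rG : radial G.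
  apply: radial_mul; first by apply: radial_sqr; exact: radial_rf.
  apply: radial_add; first exact: radial_cst.
  by apply: radial_opp; apply: radial_mul; [exact: radial_cst|exact: radial_psi].
have sG := radial_sm rG.
have G0 p : p != 0 -> 0 <= G p.
  by move=> _; rewrite mulr_ge0 ?sqr_ge0// /fpsi; have := psi_le1 p; lra.
have Gi i : par i 1 G by move=> p; rewrite /G /fpsi rf_refl /psi Xf_refl rf_refl mul1r.
have wk : par k (-1) w.
  apply: par_eq (par_Om k l tfu (pu k)); rewrite /sgn eqxx eq_sym (negbTE kl); ring.
have wl : par l (-1) w.
  apply: par_eq (par_Om k l tfu (pu l)); rewrite /sgn eqxx (negbTE kl); ring.
have H := two_odd_gap kl rG G0 (Gi k) (Gi l) tfw wk wl.
set K := (X in 0 <= intg X).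
have tK : tf K by rewrite /K; tft.
have tL : tf (fun p => 2^-1 * (G p * (Gam w w p - 2 * n%:R * w p ^+ 2))) by tft.
apply: (@le_trans _ _ (intg (fun p => 2^-1 * (G p * (Gam w w p - 2 * n%:R * w p ^+ 2))))).
  rewrite intgZ; first by rewrite mulr_ge0.
  by apply: tf_ig; tft.
apply: le_intg; [exact: tf_ig|exact: tf_ig|].
apply: (dense_le n0) => // p p1; have p0 : p != 0 by apply: contraNneq p1 => ->.
have ps := psi_gt0 p1; have ps1 := psi_le1 p.
have gw := Gam_ge0 w p.
(* 2 - psi is the tangent of 1 / psi at psi = 1: a lower bound that stays smooth across the axis. *)
have D2 : (2 - psi p) * Gam w w p <= Df w w p.
  rewrite -(ler_pM2l ps) psi_Df// -[Yf w p * _]expr2.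
  have := sqr_ge0 (Yf w p).
  have : 0 <= (1 - psi p) ^+ 2 * Gam w w p by rewrite mulr_ge0 ?sqr_ge0.
  lra.
rewrite /G /K -subr_ge0.
rewrite [leRHS](_ : _ = rf p ^+ 2 * (3 / 2 * (Df w w p - (2 - psi p) * Gam w w p))).
  by rewrite mulr_ge0 ?sqr_ge0// mulr_ge0 ?subr_ge0//; lra.
by rewrite /fpsi; field.
Qed.

(** In f1 and f3 the second derivatives of u disappear by integration along Y. The integrals of D(u,
    Bu) and psi (Bu)^2 become sums over the rotation derivatives of u, to which [pair_gap]
    applies. *)
Lemma even_gap u : tf u -> (forall i, par i 1 u) ->
  let F := fun p => etaf p * Yf u p + 3 / 2 * Bf u p in
  0 <= intg (fun p => rf p ^+ 2 * (2 * Df u F p - psi p * F p ^+ 2 - 4 * Df u u p)).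
Proof.
move=> tfu pu /=; have su := tf_sm tfu; have se := @sm_etaf R n; have sp := @sm_psi R n.
have sd : sm (@detaf R n) by rewrite /detaf; smt.
have sfp : sm fpsi by rewrite /fpsi; smt.
have tB := tf_Bf tfu; have tY : tf (Yf u) by tft.
pose eY p := etaf p * Yf u p; have teY : tf eY by rewrite /eY; tft.
pose F p := eY p + 3 / 2 * Bf u p; have tF : tf F by rewrite /F; tft.
rewrite -/F; set J := (X in intg X).
pose w k l := Om k l u; have tw k l : tf (w k l) by rewrite /w; tft.
pose f1 p := rf p ^+ 2 * (2 * Df u eY p).
pose f1' p := rf p ^+ 2 * (4 * detaf p * Yf u p ^+ 2
    - (2 * psi p * detaf p - (n%:R - 2) * sg p * etaf p) * Df u u p).
pose f2 p := rf p ^+ 2 * Df u (Bf u) p.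
pose f3 p := (rf p ^+ 2 * (psi p * etaf p)) * (Bf u p * Yf u p).
pose f3' p := rf p ^+ 2 * (- (2^-1) * (2 * psi p ^+ 2 * detaf p
     - (n%:R + 2) * psi p * sg p * etaf p) * Gam u u p).
pose f4 p := (rf p ^+ 2 * psi p) * (Bf u p * Bf u p).
pose f4' p := (rf p ^+ 2 * psi p) * Gam u (Bf u) p.
pose f5 p := rf p ^+ 2 * (- (psi p * etaf p ^+ 2 * Yf u p ^+ 2) - 4 * Df u u p).
pose f6 p := rf p ^+ 2 * (fpsi p * Gam u u p).
have t1 : tf f1 by rewrite /f1; tft.
have t1' : tf f1' by rewrite /f1'; tft.
have t2 : tf f2 by rewrite /f2; tft.
have t3 : tf f3 by rewrite /f3; tft.
have t3' : tf f3' by rewrite /f3'; tft.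
have t4 : tf f4 by rewrite /f4; tft.
have t5 : tf f5 by rewrite /f5; tft.
have t6 : tf f6 by rewrite /f6; tft.
have rr2 : radial (fun p : V => rf p ^+ 2) by apply: radial_sqr; exact: radial_rf.
have rr2p : radial (fun p : V => rf p ^+ 2 * psi p).
  by apply: radial_mul => //; exact: radial_psi.
have e1 : intg f1 = intg f1' by exact: intg_Df_etaf.
have e3 : intg f3 = intg f3' by exact: intg_Bf_Yf.
have e4 : intg f4 = intg f4' by exact: intg_Bf.
pose d k l := intg (fun p => rf p ^+ 2 * Df (w k l) (w k l) p).
pose g k l := intg (fun p => (rf p ^+ 2 * psi p) * Gam (w k l) (w k l) p).
pose m k l := intg (fun p => rf p ^+ 2 * (fpsi p * w k l p ^+ 2)).
have e2 : intg f2 = 2^-1 * \sum_k \sum_l d k l.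
  exact: (intg_bilin_Bf rr2 (@is_der_Df R n) (@Om_Df R n) tfu).
have e4' : intg f4' = 2^-1 * \sum_k \sum_l g k l.
  exact: (intg_bilin_Bf rr2p (@is_der_Gam R n) (@Om_Gam R n) tfu).
have e6 : intg f6 = 2^-1 * \sum_k \sum_l m k l.
  have tm k l : tf (fun p => rf p ^+ 2 * (fpsi p * w k l p ^+ 2)).
    by have := tw k l => ?; tft.
  rewrite /m -intg_sum2// -intgZ; last by apply: tf_ig; apply: tf_sum => k; exact: tf_sum.
  congr intg; apply/funext => p; rewrite /f6.
  under [in RHS]eq_bigr do under eq_bigr do rewrite mulrA.
  under [in RHS]eq_bigr do rewrite -mulr_sumr.
  rewrite -mulr_sumr; under eq_bigr do under eq_bigr do rewrite expr2.
  by rewrite sum_Om; field.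
have K0 k l : 0 <= 3 / 2 * d k l - 9 / 8 * g k l - n%:R * m k l.
  have := pair_gap k l tfu pu; rewrite -/(w k l).
  have twkl := tw k l; have swkl := tf_sm twkl.
  congr (_ <= _); rewrite /d /g /m -!intgZ; try by apply: tf_ig; tft.
  rewrite -!intgB; try by apply: tf_ig; tft.
  by congr intg; apply/funext => p; ring.
(* Summed over k and l, [pair_gap] bounds 3 f2 - (9/4) f4 below by 2n f6, which is quadratic in
   first derivatives. *)
have S0 : 0 <= 3 / 2 * (2 * intg f2) - 9 / 8 * (2 * intg f4) - n%:R * (2 * intg f6).
  rewrite e2 e4 e4' e6 !mulrA [3 / 2 * 2 * _]mulfK// [9 / 8 * 2 * _]mulfK// mulfK//.
  rewrite !mulr_sumr -!sumrB; apply: sumr_ge0 => k _.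
  by rewrite !mulr_sumr -!sumrB; apply: sumr_ge0 => l _.
(* T is a combination of (Yu)^2, D(u, u) and Gam(u, u) only; after multiplication by psi, [psi_Df]
   leaves (Yu)^2 and Gam(u, u). *)
pose T p := f1' p - 3 * f3' p + f5 p + 2 * n%:R * f6 p.
have tT : tf T by rewrite /T; tft.
have T0 : 0 <= intg T.
  rewrite -(@intg0 R n); apply: le_intg; [apply: tf_ig; exact: tf_cst0|exact: tf_ig|].
  apply: (dense_le n0) => //; first exact: tf_cst0.
  move=> p p1; have p0 : p != 0 by apply: contraNneq p1 => ->.
  have N3 : 3 <= n%:R :> R by rewrite (ler_nat R 3 n).
  have ps := psi_gt0 p1.
  have cY := gap_coef_Y erefl erefl N3 (ltW ps) (psi_sg p0).
  have cG := gap_coef_Gam erefl erefl N3 (ltW ps) (psi_sg p0).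
  rewrite -/(etaf p) -/(detaf p) in cY cG.
  have c1 := mulr_ge0 cY (sqr_ge0 (Yf u p)).
  have c2 := mulr_ge0 cG (Gam_ge0 u p).
  rewrite -(pmulr_rge0 _ ps).
  rewrite [leRHS](_ : _ = rf p ^+ 2 * (4 * psi p * detaf p * Yf u p ^+ 2
    - (2 * psi p * detaf p - (n%:R - 2) * sg p * etaf p + 4) * (psi p * Df u u p)
    - psi p ^+ 2 * etaf p ^+ 2 * Yf u p ^+ 2
    + psi p * (3 / 2 * (2 * psi p ^+ 2 * detaf p
     - (n%:R + 2) * psi p * sg p * etaf p) + 2 * n%:R * fpsi p) * Gam u u p)); last first.
    by rewrite /T /f1' /f3' /f5 /f6; field.
  rewrite psi_Df// /fpsi.
  apply: mulr_ge0; first exact: sqr_ge0.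
  apply: (le_trans (addr_ge0 c1 c2)).
  rewrite le_eqVlt; apply/orP; left; apply/eqP; ring.
have eJ : intg J = intg f1 + 3 * intg f2 - 3 * intg f3 - 9 / 4 * intg f4 + intg f5.
  rewrite -!intgZ; try exact: tf_ig.
  rewrite -intgD; try by apply: tf_ig; tft.
  rewrite -intgB; try by apply: tf_ig; tft.
  rewrite -intgB; try by apply: tf_ig; tft.
  rewrite -intgD; try by apply: tf_ig; tft.
  congr intg; apply: tf_ext; [by rewrite /J; tft|by tft|].
  move=> p p0; rewrite /J /f1 /f2 /f3 /f4 /f5.
  have sB := tf_sm tB; have seY := tf_sm teY.
  have sB' : sm (fun q => 3 / 2 * Bf u q) by smt.
  have -> : Df u F p = Df u eY p + 3 / 2 * Df u (Bf u) p.
    rewrite /F (drv_add (is_der_Df su) seY sB' p0).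
    by rewrite (drv_scale (is_der_Df su) _ sB p0).
  by rewrite /F /eY; field.
have eT : intg T = intg f1' - 3 * intg f3' + intg f5 + 2 * n%:R * intg f6.
  rewrite -!intgZ; try exact: tf_ig.
  rewrite -intgB; try by apply: tf_ig; tft.
  rewrite -intgD; try by apply: tf_ig; tft.
  by rewrite -intgD; try by apply: tf_ig; tft.
rewrite eJ; rewrite eT in T0; lra.
Qed.

End even_gap.

(** * The gap for arbitrary functions *)

Section splitting.
Context {R : realType} {n : nat}.
Local Notation V := ('rV[R]_n * R)%type.
Implicit Types (f g h u w a b e o F G : V -> R) (p q v : V) (i j k l : 'I_n) (c d : R).

Context (n3 : (3 <= n)%N).

Let n0 : (0 < n)%N. Proof. exact: leq_trans n3. Qed.

Definition gapf u F p : R :=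
  rf p ^+ 2 * (2 * Df u F p - psi p * F p ^+ 2 - 4 * Df u u p).

Lemma tf_gapf u F : tf u -> tf F -> tf (gapf u F).
Proof. by move=> tfu tfF; have sp := @sm_psi R n; rewrite /gapf; tft. Qed.

Lemma reflC i k p : refl i (refl k p) = refl k (refl i p).
Proof.
congr pair; apply/rowP => j; rewrite !mxE.
by case: (j == i); case: (j == k).
Qed.

(** With F = 4 o the integrand is 4 r^2 (D(o, o) - 4 psi o^2), and 4 <= n + 1 lets [odd_gap]
    apply. *)
Lemma odd_gapf k o : tf o -> par k (-1) o -> 0 <= intg (gapf o (fun p => 4 * o p)).
Proof.
move=> tfo po; have so := tf_sm tfo; have sp := @sm_psi R n.
have t1 : tf (fun p => rf p ^+ 2 * (Df o o p - (n%:R + 1) * (psi p * o p ^+ 2))) by tft.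
have t4 : tf (fun p => 4 * o p) by tft.
have tg := tf_gapf tfo t4.
have H := odd_gap tfo (par_odd po).
apply: (@le_trans _ _ (4 * intg (fun p => rf p ^+ 2 *
  (Df o o p - (n%:R + 1) * (psi p * o p ^+ 2))))); first exact: mulr_ge0.
rewrite -intgZ; last exact: tf_ig.
apply: le_intg; [by apply: tf_ig; tft|exact: tf_ig|move=> p].
have [->|p0] := eqVneq p 0; first by rewrite (tf0 t1) (tf0 tg) mulr0.
have N3 : 3 <= n%:R :> R by rewrite (ler_nat R 3 n).
rewrite /gapf (drv_scale (is_der_Df so) 4 so p0) -subr_ge0.
rewrite [leRHS](_ : _ = 4 * (rf p ^+ 2 * ((n%:R - 3) * (psi p * o p ^+ 2)))); last by ring.
rewrite mulr_ge0// mulr_ge0 ?sqr_ge0// mulr_ge0 ?subr_ge0// mulr_ge0 ?sqr_ge0//.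
exact: psi_ge0.
Qed.

(** The two mixed terms in D(e, o) cancel, because the factor 4 in 4 o is the constant of the gap;
    the remaining mixed terms C are odd in x_k and integrate to 0. *)
Lemma split_gapf k e o F : tf e -> tf o -> tf F ->
  par k 1 e -> par k (-1) o -> par k 1 F ->
  intg (gapf (fun p => e p + o p) (fun p => F p + 4 * o p)) =
  intg (gapf e F) + intg (gapf o (fun p => 4 * o p)).
Proof.
move=> te to tF pe po pF; have se := tf_sm te; have so := tf_sm to; have sF := tf_sm tF.
have sp := @sm_psi R n.
pose C p := rf p ^+ 2 * (2 * Df o F p - 8 * (psi p * (F p * o p))).
have tC : tf C by rewrite /C; tft.
have C0 : intg C = 0.
  apply: (intg_odd (i := k) tC); apply: par_odd.
  have p2 : par k (-1) (fun p => F p * o p) by apply: par_eq (par_mul pF po); ring.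
  have p4 : par k (-1) (Df o F) by apply: par_eq (par_Df to tF po pF); ring.
  by move=> p; rewrite /C p2 p4 rf_refl par_psi; ring.
have t4 : tf (fun p => 4 * o p) by tft.
have teo : tf (fun p => e p + o p) by tft.
have tFo : tf (fun p => F p + 4 * o p) by tft.
have tg1 := tf_gapf te tF; have tg2 := tf_gapf to t4; have tg3 := tf_gapf teo tFo.
rewrite -[RHS]addr0 -C0 -!intgD; try by apply: tf_ig; tft.
congr intg; apply: tf_ext => //; first by tft.
move=> p p0; have s4 : sm (fun q => 4 * o q) by smt.
have seo := tf_sm teo; have sFo := tf_sm tFo.
have DD a b g : sm a -> sm b -> sm g ->
    Df a (fun q => b q + g q) p = Df a b p + Df a g p.
  by move=> sa sb sg'; rewrite (drv_add (is_der_Df sa) sb sg' p0).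
have D4 a : sm a -> Df a (fun q => 4 * o q) p = 4 * Df a o p.
  by move=> sa; rewrite (drv_scale (is_der_Df sa) 4 so p0).
rewrite /gapf /C !DD// !D4// !(Df_sym (fun q => e q + o q)) !DD//.
rewrite (Df_sym F e) (Df_sym F o) (Df_sym o e); ring.
Qed.

Lemma par_etaf i : par i 1 (@etaf R n).
Proof. by move=> p; rewrite /etaf par_sg par_psi; ring. Qed.

(** Induction on the number d of coordinates in which u need not be even. Splitting along one of
    them, the odd part is settled at once by 4 o and the even part by induction. The parity of F is
    carried along because [split_gapf] requires it. *)
Lemma gap_exists_even (d : nat) u : (d <= n)%N -> tf u ->
  (forall i, (i < n - d)%N -> par i 1 u) ->
  exists F, [/\ tf F, forall i, (i < n - d)%N -> par i 1 F & 0 <= intg (gapf u F)].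
Proof.
elim: d u => [|d IH] u dn tfu pu.
  have {}pu i : par i 1 u by apply: pu; rewrite subn0.
  have se := @sm_etaf R n; have tB := tf_Bf tfu.
  exists (fun p => etaf p * Yf u p + 3 / 2 * Bf u p); split; first by tft.
    move=> i _; apply: par_add; last by apply: par_scale; exact: par_Bf.
    by apply: par_eq (par_mul (par_etaf i) (par_Yf tfu (pu i))); ring.
  exact: (even_gap n3 tfu pu).
have kn : (n - d.+1 < n)%N by rewrite ltn_subrL.
(* Evenness in coordinate n - d - 1 is what the induction hypothesis asks for in addition. *)
pose k := Ordinal kn.
have tr := tf_refl k tfu.
pose e p := 2^-1 * (u p + u (refl k p)).
pose o p := 2^-1 * (u p - u (refl k p)).
have te : tf e by apply: tf_mull; [exact: sm_cst|exact: tf_add].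
have to : tf o by apply: tf_mull; [exact: sm_cst|apply: tf_add => //; exact: tf_opp].
have uE : u = fun p => e p + o p by apply/funext => p; rewrite /e /o; field.
have pek : par k 1 e by move=> p; rewrite /e reflK; ring.
have pok : par k (-1) o by move=> p; rewrite /o reflK; ring.
have pei i : (i < n - d.+1)%N -> par i 1 e.
  by move=> /pu pi p; rewrite /e reflC !pi; ring.
have poi i : (i < n - d.+1)%N -> par i 1 o.
  by move=> /pu pi p; rewrite /o reflC !pi; ring.
have pe i : (i < n - d)%N -> par i 1 e.
  rewrite -(subnSK dn) ltnS leq_eqVlt => /orP[/eqP ik|]; last exact: pei.
  by rewrite (_ : i = k)//; exact: val_inj.
have [F [tF pF gF]] := IH e (ltnW dn) te pe.
have kd : (k < n - d)%N by rewrite /= -(subnSK dn).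
exists (fun p => F p + 4 * o p); split; first by tft.
  move=> i id; apply: par_add; last by apply: par_scale; exact: poi.
  by apply: pF; apply: (leq_trans id); rewrite leq_sub2l.
rewrite uE (split_gapf te to tF pek pok (pF k kd)).
by rewrite addr_ge0// (odd_gapf to pok).
Qed.

Lemma gap_exists u : tf u -> exists2 F, tf F & 0 <= intg (gapf u F).
Proof.
move=> tfu; have [|F [tF _ gF]] := @gap_exists_even n u (leqnn n) tfu; last by exists F.
by move=> i; rewrite subnn.
Qed.

End splitting.

(** * Weighted Rellich inequalities *)

Section link.
Context {R : realType} {n : nat}.
Local Notation V := ('rV[R]_n * R)%type.
Local Notation MR := (measurableTypeR R).
Local Notation T := (n.-tuple MR).
Local Notation mu := (lebesgue_tuple n \x @lebesgue_measure R)%E.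
Implicit Types (f g h u w F G : V -> R) (p q v : V) (i j k l : 'I_n) (b c : R).

Lemma Ck_smk m f : Ck m f -> smk m f.
Proof.
elim: m f => [|m IH] f /=; first by move=> cf p _; exact: cf.
move=> [df Df]; split; last by move=> v; exact: IH.
move=> p _; split; first exact: differentiable_continuous.
by move=> v; exact: diff_derivable.
Qed.

Lemma test_function_tf u : test_function u -> tf u.
Proof.
move=> [uC uc u0]; split; first by move=> m; exact: Ck_smk.
have /compact_bounded[B [_ HB]] := uc.
have [a a0 Ha] : exists2 a : R, 0 < a & forall p, u p != 0 -> a <= `|p|.
  have /nbhs_ballP[a /= a0 Ha] : nbhs (0 : V) (~` closure [set p | u p != 0]).
    by apply: open_nbhs_nbhs; split => //; exact/closed_openC/closed_closure.
  exists a => // p up; rewrite leNgt; apply/negP => pa.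
  apply: (Ha p); last exact: subset_closure.
  by rewrite -ball_normE /= sub0r normrN.
exists a, (`|B| + 1); split => // p up; rewrite Ha//=.
apply: (HB (`|B| + 1)); first by rewrite (le_lt_trans (ler_norm _))// ltrDl.
exact: subset_closure.
Qed.

Lemma enormE p : enorm p.1 ^+ 2 = Xf p.
Proof. by rewrite /enorm sqr_sqrtr// Xf_ge0. Qed.

Lemma varrhoE p : varrho p = Nf p `^ 4^-1.
Proof. by rewrite /varrho /Nf -enormE -exprM. Qed.

Lemma sqnorm_gradE f p : sqnorm (grad_G f p) = Sf f f p + Xf p * (dT f p * dT f p).
Proof.
rewrite /sqnorm /grad_G /= exprMn enormE; congr (_ + _ * _); last by rewrite dTE expr2.
have := enormE (\row_i dx i f p, 0); rewrite /= => ->; apply: eq_bigr => i _.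
by rewrite /xc /= mxE dXE expr2.
Qed.

Lemma L_GE f p : L_G f p = Lf f p.
Proof. by rewrite /L_G /Lf enormE dXE dTE. Qed.

Lemma dX_powR i a p : p != 0 ->
  dX i (fun q => Nf q `^ a) p = a * Nf p `^ (a - 1) * dX i Nf p.
Proof.
move=> p0; rewrite dXE /dx.
exact: (@deriv_powR R n a _ p (delta_mx 0 i, 0) (Nf_gt0 p0) (sm_derivable sm_Nf p0)).2.
Qed.

Lemma dT_powR a p : p != 0 ->
  dT (fun q => Nf q `^ a) p = a * Nf p `^ (a - 1) * dT Nf p.
Proof.
move=> p0; rewrite dTE /dt.
exact: (@deriv_powR R n a _ p (0, 1) (Nf_gt0 p0) (sm_derivable sm_Nf p0)).2.
Qed.

Lemma powR_pred a p : p != 0 -> Nf p `^ (a - 1) * Nf p = Nf p `^ a.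
Proof.
move=> p0; have N0 := Nf_gt0 p0.
rewrite -[X in _ * X]powRr1 ?ltW// -powRD ?subrK//.
by rewrite (lt0r_neq0 N0) implybT.
Qed.

Lemma Zf_powR a p : p != 0 -> Zf (fun q => Nf q `^ a) p = 4 * a * Nf p `^ a.
Proof.
move=> p0; rewrite ZfE EfE dT_powR//.
under eq_bigr do rewrite dX_powR// mulrCA.
rewrite -mulr_sumr -EfE.
transitivity (a * Nf p `^ (a - 1) * Zf Nf p); first by rewrite ZfE; ring.
rewrite (drv_Nf is_der_Z p0) Zf_Xf// Zf_tc// -(powR_pred a p0) /Nf; ring.
Qed.

Lemma sqnorm_grad_varrho p : p != 0 -> sqnorm (grad_G varrho p) = psi p.
Proof.
move=> p0; have N0 := Nf_gt0 p0.
have -> : @varrho R n = fun q => Nf q `^ 4^-1 by apply/funext => q; exact: varrhoE.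
rewrite sqnorm_gradE /Sf dT_powR//.
set m := Nf p `^ (4^-1 - 1).
have dXN i : dX i Nf p = 4 * Xf p * xc i p.
  by rewrite (drv_Nf (is_der_dX i) p0) dx_Xf// dx_tc; ring.
have dTN : dT Nf p = 8 * tc p by rewrite (drv_Nf is_der_dT p0) dt_Xf// dt_tc; ring.
under eq_bigr => i _ do rewrite dX_powR// dXN -/m.
rewrite dTN (eq_bigr (fun i => (m ^+ 2 * Xf p ^+ 2) * xc i p ^+ 2)); last by move=> i _; field.
rewrite -mulr_sumr -/(Xf p).
transitivity (Xf p * (m ^+ 2 * Nf p)); first by rewrite /Nf; field.
rewrite /psi; congr (_ * _); rewrite rfE -[m ^+ 2]powR_mulrn ?powR_ge0// -powRrM.
rewrite -[X in _ * X]powRr1 ?ltW// -powRD ?(lt0r_neq0 N0) ?implybT//.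
by congr (_ `^ _); field.
Qed.

Lemma xc_cont i : continuous (@xc R n i).
Proof.
move=> p; apply: (@continuous_comp _ _ _ fst (fun M : 'rV[R]_n => M 0 i)).
  exact: cvg_fst.
exact: coord_continuous.
Qed.

Lemma measurable_Xf : measurable_fun [set: T * MR] (@Xf R n \o emb).
Proof.
have -> : @Xf R n \o emb = fun x => \sum_(i <- enum 'I_n) xc i (emb x) ^+ 2.
  by apply/funext => x; rewrite /= /Xf big_enum.
apply: measurable_sum => i; apply: measurable_funX.
by apply: measurable_emb_cont; exact: xc_cont.
Qed.

Lemma measurable_Nf : measurable_fun [set: T * MR] (@Nf R n \o emb).
Proof.
have -> : @Nf R n \o emb = fun x => Xf (emb x) ^+ 2 + 4 * (x.2 : R) ^+ 2 by [].
apply: measurable_funD; first exact: measurable_funX measurable_Xf.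
apply: measurable_funM; first exact: measurable_cst.
by apply: measurable_funX; exact: measurable_snd.
Qed.

Lemma ae_off_axis : (0 < n)%N -> {ae mu, forall x, (emb x).1 != 0 :> 'rV[R]_n}.
Proof.
move=> n0; exists (emb @^-1` [set p : V | p.1 = 0]); split.
- have -> : emb @^-1` [set p : V | p.1 = 0] = setT `&` (@Xf R n \o emb) @^-1` [set (0 : R)].
    rewrite setTI; apply/seteqP; split => x /=.
      by move=> x0; apply/eqP; rewrite Xf_eq0; apply/eqP.
    by move=> /eqP; rewrite Xf_eq0 => /eqP.
  exact: measurable_Xf.
- exact: axis_null.
- by move=> x /= /negP; rewrite negbK => /eqP.
Qed.

(** The integral of [g] may be infinite, so no subtraction is made: the negative part of [f] is
    dropped and its positive part is compared with [g] almost everywhere. *)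
Lemma le_integral_G f g : (0 < n)%N -> tf f ->
  measurable_fun [set: T * MR] (g \o emb) -> (forall p, 0 <= g p) ->
  (forall p, p.1 != 0 -> f p <= g p) -> ((intg f)%:E <= integral_G g)%E.
Proof.
move=> n0 tff mg g0 fg; rewrite -(integral_GE (tf_ig tff)) /integral_G.
rewrite [leLHS]integralE.
set A := (X in (X - _ <= _)%E); set B := (X in (_ - X <= _)%E).
have B0 : (0 <= B)%E by apply: integral_ge0 => x _; exact: funeneg_ge0.
have mf : measurable_fun setT (fun x : T * MR => (f (emb x))%:E).
  by apply/measurable_EFinP; exact: tf_measurable.
have AG : (A <= \int[mu]_x (g (emb x))%:E)%E.
  apply: ae_ge0_le_integral => //.
  - exact: measurable_funepos.
  - by move=> x _; rewrite lee_fin.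
  - exact/measurable_EFinP.
  - apply: filterS (ae_off_axis n0) => x x0 _.
    by rewrite funeposE ge_max !lee_fin g0 fg.
apply: le_trans AG; rewrite -[leRHS]sube0; exact: leeB.
Qed.

End link.

(** * From the gap inequality to the weighted inequalities *)

Section weighted.
Context {R : realType} {n : nat}.
Local Notation V := ('rV[R]_n * R)%type.
Local Notation MR := (measurableTypeR R).
Local Notation T := (n.-tuple MR).
Implicit Types (f g h u w F G W : V -> R) (p q v : V) (i j k l : 'I_n) (b c : R).

Context (n3 : (3 <= n)%N).

Let n0 : (0 < n)%N. Proof. exact: leq_trans n3. Qed.

Lemma weighted_rellich u g W : tf u -> sm g ->
  (forall p, p != 0 -> W p =
    rf p * (2 * n%:R - g p ^+ 2 + (n%:R - 2) * g p + Zf g p)) ->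
  (integral_G (fun p => W p * sqnorm (grad_G u p))%R <=
   integral_G (fun p => `|L_G u p| ^+ 2 / sqnorm (grad_G varrho p))%R)%E.
Proof.
move=> tfu sg' WE; have tL := tf_Lf tfu; have tR := tf_Rf tfu.
have sp := @sm_psi R n.
pose om p := 2 * n%:R - g p ^+ 2 + (n%:R - 2) * g p + Zf g p.
have som : sm om by rewrite /om; smt.
pose w p := rf p ^+ 2 * om p * (psi p * Zf u p ^+ 2 + Df u u p).
have tw : tf w by rewrite /w; tft.
have -> : (fun p => W p * sqnorm (grad_G u p)) = w.
  apply/funext => p; rewrite sqnorm_gradE.
  have [->|p0] := eqVneq p 0.
    rewrite (tf0 tw) (tf0 (tf_dT tfu)) /Sf big1 ?mulr0 ?addr0 ?mulr0// => i _.
    by rewrite (tf0 (tf_dX i tfu)) mulr0.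
  by rewrite WE// grad_Df// /w /om; ring.
(* As a product of powers the quotient is visibly measurable; the identity also holds on the axis,
   where the inverse of 0 is 0, and at the origin, where L_G u = 0. *)
have -> : (fun p => `|L_G u p| ^+ 2 / sqnorm (grad_G varrho p)) =
    fun p => Lf u p ^+ 2 * (Xf p `^ (-1) * Nf p `^ 2^-1).
  apply/funext => p; rewrite L_GE real_normK ?num_real//.
  have [->|p0] := eqVneq p 0; first by rewrite (tf0 tL) expr0n /= !mul0r.
  rewrite sqnorm_grad_varrho// /psi invfM powR_inv1 ?Xf_ge0// rfE powRN invrK.
  by [].
have [F tF gap] := gap_exists n3 tfu.
pose h p := Rf u p - F p.
have th : tf h by rewrite /h; tft.
pose J p := 2 * (Lf u p * (rf p * h p)) - psi p * (rf p * h p) ^+ 2.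
have tJ : tf J by rewrite /J; tft.
rewrite (integral_GE (tf_ig tw)).
apply: (@le_trans _ _ (intg J)%:E).
  rewrite lee_fin /J square_expand//; exact: (core_ineq tfu tF sg' gap).
apply: le_integral_G => //.
- apply: measurable_funM; first exact: measurable_funX (tf_measurable tL).
  apply: measurable_funM.
    exact: (measurableT_comp (measurable_powR (-1)) measurable_Xf).
  exact: (measurableT_comp (measurable_powR 2^-1) measurable_Nf).
- by move=> p; rewrite mulr_ge0 ?sqr_ge0// mulr_ge0 ?powR_ge0.
- move=> p p1; have p0 : p != 0 by apply: contraNneq p1 => ->.
  have ps := psi_gt0 p1.
  have -> : Xf p `^ (-1) * Nf p `^ 2^-1 = (psi p)^-1.
    by rewrite /psi invfM powR_inv1 ?Xf_ge0// rfE powRN invrK.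
  rewrite /J ler_pdivlMr// -subr_ge0.
  rewrite [leRHS](_ : _ = (Lf u p - psi p * (rf p * h p)) ^+ 2); last by ring.
  exact: sqr_ge0.
Qed.

Lemma sm_Npow a : sm (fun q : V => Nf q `^ a).
Proof. exact: (sm_powR a (@Nf_gt0 R n) (@sm_Nf R n)). Qed.

(* [N^((1-b)/4)] is [varrho^(1-b)] *)
Lemma rf_Npow b p : p != 0 ->
  rf p * Nf p `^ ((1 - b) / 4) = Nf p `^ (- ((b + 1) / 4)) /\
  rf p * (Nf p `^ ((1 - b) / 4)) ^+ 2 = Nf p `^ (- (b / 2)).
Proof.
move=> p0; have N0 := lt0r_neq0 (Nf_gt0 p0).
rewrite -[_ ^+ 2]powR_mulrn ?powR_ge0// -powRrM rfE -!powRD ?N0 ?implybT//.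
by split; congr (_ `^ _); field.
Qed.

(** With g = P - 2 and P = varrho^(1-b), Zg = (1 - b) P. As -2 is a root of 2n + (n - 2) g - g^2,
    the weight is r ((n + 3 - b) P - P^2). *)
Lemma rellich_below b u W : tf u ->
  (forall p, p != 0 -> W p = (n%:R + 3 - b) * Nf p `^ (- ((b + 1) / 4))
     - Nf p `^ (- (b / 2))) ->
  (integral_G (fun p => W p * sqnorm (grad_G u p))%R <=
   integral_G (fun p => `|L_G u p| ^+ 2 / sqnorm (grad_G varrho p))%R)%E.
Proof.
move=> tfu WE; pose P p := Nf p `^ ((1 - b) / 4).
have sP : sm P by exact: sm_Npow.
apply: (@weighted_rellich u (fun p => P p - 2) W) => //; first by smt.
move=> p p0; have [e1 e2] := rf_Npow b p0; rewrite WE// -e1 -e2.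
rewrite (drv_sub (is_der_Z) sP (sm_cst 2) p0) (drv_cst is_der_Z)// Zf_powR//.
by rewrite -/(P p); field.
Qed.

(** With g = n - P around the other root, Zg = - (1 - b) P and the weight is r ((n + 1 + b) P -
    P^2). *)
Lemma rellich_above b u W : tf u ->
  (forall p, p != 0 -> W p = (n%:R + 1 + b) * Nf p `^ (- ((b + 1) / 4))
     - Nf p `^ (- (b / 2))) ->
  (integral_G (fun p => W p * sqnorm (grad_G u p))%R <=
   integral_G (fun p => `|L_G u p| ^+ 2 / sqnorm (grad_G varrho p))%R)%E.
Proof.
move=> tfu WE; pose P p := Nf p `^ ((1 - b) / 4).
have sP : sm P by exact: sm_Npow.
apply: (@weighted_rellich u (fun p => n%:R - P p) W) => //; first by smt.
move=> p p0; have [e1 e2] := rf_Npow b p0; rewrite WE// -e1 -e2.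
rewrite (drv_sub (is_der_Z) (sm_cst _) sP p0) (drv_cst is_der_Z)// Zf_powR//.
by rewrite -/(P p); field.
Qed.

Lemma varrho_powR a p : varrho p `^ a = Nf p `^ (a / 4).
Proof. by rewrite varrhoE -powRrM; congr (_ `^ _); field. Qed.

End weighted.

Theorem corollary7p2 (R : realType) (n : nat) (Q : nat)
    (hn : (2 <= n)%N) (hQdef : Q = (n + 2)%N) (hQ : (5 <= Q)%N)
    (u : 'rV[R]_n * R -> R) (hu : test_function u) :
  let lhs : \bar R :=
    integral_G (fun p => `|L_G u p| ^+ 2 / sqnorm (grad_G varrho p)) in
  let rhs (w : 'rV[R]_n * R -> R) : \bar R :=
    integral_G (fun p => w p * sqnorm (grad_G u p)) in
  [/\ (lhs >= rhs (fun p => Q%:R + 2 - varrho p ^+ 2)%R)%E,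
      (lhs >= rhs (fun p => (Q%:R + 1) / varrho p - 1)%R)%E,
      (forall b : R, b < 1 ->
        (lhs >= rhs (fun p => (Q%:R + 1 - b) / varrho p `^ (b + 1)
                              - 1 / varrho p `^ (2 * b))%R)%E) &
      (forall b : R, 1 < b ->
        (lhs >= rhs (fun p => (Q%:R + b - 1) / varrho p `^ (b + 1)
                              - 1 / varrho p `^ (2 * b))%R)%E)].
Proof.
have n3 : (3 <= n)%N by rewrite hQdef addn2 in hQ.
have tfu := test_function_tf hu.
have vp (b : R) (p : 'rV[R]_n * R) : 1 / varrho p `^ (2 * b) = Nf p `^ (- (b / 2)).
  by rewrite varrho_powR powRN div1r; congr (_ `^ _)^-1; field.
have QE : Q%:R = n%:R + 2 :> R by rewrite hQdef natrD.
split.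
(* b = -1 gives n + 3 - b = Q + 2 and the powers 0 and 2 of varrho. *)
- apply: (rellich_below n3 (b := -1) tfu) => p p0.
  rewrite QE varrhoE -[_ ^+ 2]powR_mulrn ?powR_ge0// -powRrM.
  rewrite (_ : - ((-1 + 1) / 4) = 0 :> R); last by field.
  by rewrite powRr0 (_ : - (-1 / 2) = 4^-1 * 2%:R :> R); [ring|field].
(* b = 0 gives n + 3 = Q + 1 and the powers -1 and 0 of varrho. *)
- apply: (rellich_below n3 (b := 0) tfu) => p p0.
  rewrite QE varrhoE mul0r oppr0 powRr0 add0r powRN div1r; ring.
- move=> b _; apply: (rellich_below n3 (b := b) tfu) => p p0.
  by rewrite vp varrho_powR QE !powRN; ring.
- move=> b _; apply: (rellich_above n3 (b := b) tfu) => p p0.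
  by rewrite vp varrho_powR QE !powRN; ring.
Qed.
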